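(* Let $(\mathcal V,F)$ be a Randers-Minkowski space with Zermelo data $(h,W)$. Then any $h$-flat hypersurface $S$ of $(\mathcal V,h)$ (i.e. a hypersurface whose metric induced by $h$ is flat) has scalar flag curvature with respect to $F|_S$, and the Riemannian metric of the Zermelo data of $(S,F|_S)$ is conformally flat.
   Context: Randers norm and Zermelo data: $\mathcal V$ is a finite-dimensional real vector space, $h$ a positive definite scalar product on $\mathcal V$, $W\in\mathcal V$ with $h(W,W)<1$, and $F:\mathcal V\to[0,\infty)$ is determined by $F(0)=0$ and $F(v)>0$, $h(\frac{v}{F(v)}-W,\frac{v}{F(v)}-W)=1$ for $v\neq0$. $(\mathcal V,F)$ is called a Randers-Minkowski space with Zermelo data $(h,W)$. Tangent spaces of $\mathcal V$ are identified with $\mathcal V$; $F|_S$ is the restriction of $F$ to $TS$, which is a Finsler metric on $S$. Zermelo data of $(S,F|_S)$: the pair $(h_S,W_S)$ of a Riemannian metric $h_S$ on $S$ and a vector field $W_S$ on $S$ with $h_S(W_S,W_S)<1$ such that $h_S(\frac{v}{F(v)}-W_S,\frac{v}{F(v)}-W_S)=1$ for all nonzero $v\in TS$ (with $W_S$ evaluated at the base point of $v$). Flag curvature of $(S,F|_S)$: put $L=(F|_S)^2$ on $TS\setminus\mathbf 0$, $g_v(u,w)=\frac12\frac{\partial^2}{\partial s\partial t}L(v+su+tw)|_{s=t=0}$ and $C_v(u,w,z)=\frac12\frac{\partial}{\partial t}g_{v+tz}(u,w)|_{t=0}$. The Levi-Civita-Chern connection is the unique map $(v,X,Y)\mapsto\nabla^v_XY\in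 T_{\pi(v)}S$ ($\pi(v)$ being the base point of $v$; depending smoothly on $v\in TS\setminus\mathbf 0$, for each $v$ having the usual additivity, tensoriality in $X$ and Leibniz rule in $Y$ of a linear connection at $\pi(v)$) such that, writing $\nabla^V$ for the affine connection $(\nabla^V_XY)_p=\nabla^{V_p}_XY$ defined by a nowhere zero local vector field $V$, one has $\nabla^V_XY-\nabla^V_YX=[X,Y]$ and $X(g_V(Y,Z))=g_V(\nabla^V_XY,Z)+g_V(Y,\nabla^V_XZ)+2C_V(\nabla^V_XV,Y,Z)$. Let $P_v(X,Y,Z)=\frac{\partial}{\partial t}\nabla^{v+tZ}_XY|_{t=0}$. Its curvature is $R_v(X,Y)Z=R^V(X,Y)Z|_{\pi(v)}-P_v(Y,Z,\nabla^V_XV)+P_v(X,Z,\nabla^V_YV)$, where $V$ is any local extension of $v$ and $R^V(X,Y)Z=\nabla^V_X\nabla^V_YZ-\nabla^V_Y\nabla^V_XZ-\nabla^V_{[X,Y]}Z$ (the result does not depend on $V$). The flag curvature is $K_v(u)=\dfrac{g_v(R_v(v,u)u,v)}{L(v)g_v(u,u)-g_v(u,v)^2}$ for $u\in T_{\pi(v)}S$ linearly independent of $v$. $(S,F|_S)$ is of scalar flag curvature if $K_v(u)$ depends only on $v$ and not on $u$. *)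

(* Defs.v *)
From HB Require Import structures.
From mathcomp Require Import all_boot all_order all_algebra.
From mathcomp Require Import all_classical all_reals all_analysis.
Set Implicit Arguments.
Unset Strict Implicit.
Unset Printing Implicit Defensive.
Import Order.TTheory GRing.Theory Num.Theory.
Import numFieldNormedType.Exports.
Local Open Scope classical_set_scope.
Local Open Scope ring_scope.

(* Finite-dimensional normed spaces.  The norm only provides the topology and
   the differential calculus; all norms on such a space are equivalent. *)
#[short(type="finNormedModType")]
HB.structure Definition FinNormedModule (R : numFieldType) :=
  {V of NormedModule R V & Vector R V}.

HB.instance Definition _ (R : numFieldType) n := Vector.on 'rV[R]_n.

Section Smooth.
Context {R : realType}.
Implicit Types E G : normedModType R.

(* [E] is always finite-dimensional below, where continuity of every
   directional derivative amounts to continuity of the differential. *)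
Fixpoint class_C E G (k : nat) (O : set E) (f : E -> G) : Prop :=
  match k with
  | 0 => forall x, O x -> {for x, continuous f}
  | k'.+1 => (forall x, O x -> differentiable f x) /\
             forall v, class_C k' O ('D_v f)
  end.

Definition smooth_open E G (O : set E) (f : E -> G) : Prop :=
  open O /\ forall k, class_C k O f.

(* Smoothness on an arbitrary subset [A]: [f] extends locally to a smooth map
   on an open set.  The values of [f] outside [A] play no role. *)
Definition smooth_on E G (A : set E) (f : E -> G) : Prop :=
  forall a, A a -> exists O (f' : E -> G),
    [/\ O a, smooth_open O f' & {in A `&` O, f =1 f'}].

End Smooth.

Section Submanifolds.
Context {R : realType} {V : finNormedModType R}.
Implicit Types (S O : set V) (p u v w : V) (X Y Z : V -> V).

(* [phi] is a diffeomorphism of the open set [U] onto the relatively open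
   subset [S `&` O] of [S]. *)
Definition local_param n S (U : set 'rV[R]_n) (phi : 'rV[R]_n -> V) : Prop :=
  smooth_open U phi /\
  exists O (psi : V -> 'rV[R]_n),
    [/\ open O, phi @` U = S `&` O, {in U, cancel phi psi} &
        smooth_on (S `&` O) psi].

Definition submanifold n S : Prop :=
  forall p, S p -> exists U phi, @local_param n S U phi /\ (phi @` U) p.

Definition hypersurface n S : Prop :=
  \dim {: V} = n.+1 /\ submanifold n S.

Definition tangent_space n S p : set V :=
  [set u | exists U phi a b,
    [/\ @local_param n S U phi, U a, phi a = p & 'D_b phi a = u]].

Definition slit_tangent_bundle n S : set (V * V)%type :=
  [set pv | [/\ S pv.1, tangent_space n S pv.1 pv.2 & pv.2 != 0]].

(* Vector field on the open subset [S `&` O] of [S], with values in [V]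
   through the identification of the tangent spaces of [V] with [V]. *)
Definition vector_field n S O X : Prop :=
  [/\ open O, smooth_on (S `&` O) X &
      forall p, S p -> O p -> tangent_space n S p (X p)].

(* Derivative at [p] of the map [f] on [S] along the vector [u] tangent to [S]:
   the derivative along [u] of a local smooth extension of [f], whose choice
   is immaterial because [u] is tangent to [S]. *)
Definition derive_on (G : normedModType R) S (f : V -> G) p u : G :=
  xget 0 [set l | exists O f',
    [/\ O p, smooth_open O f', {in S `&` O, f =1 f'} & l = 'D_u f' p]].

Definition lie_bracket S X Y p : V :=
  derive_on S Y p (X p) - derive_on S X p (Y p).

Definition riemannian_metric n S (m : V -> V -> V -> R) : Prop :=
  (forall p, S p ->
    [/\ {in tangent_space n S p & &, forall u v w (c : R),
           m p (c *: u + v) w = c * m p u w + m p v w},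
        {in tangent_space n S p &, forall u v, m p u v = m p v u} &
        {in tangent_space n S p, forall u, u != 0 -> 0 < m p u u}]) /\
  forall O X Y, vector_field n S O X -> vector_field n S O Y ->
    smooth_on (S `&` O) (fun p => m p (X p) (Y p)).

(* Around every point, [m] is [lam] times the Euclidean metric in some
   coordinates. *)
Definition conformally_flat n S (m : V -> V -> V -> R) : Prop :=
  forall p, S p -> exists U phi (lam : 'rV[R]_n -> R),
    [/\ local_param S U phi, (phi @` U) p, smooth_open U lam,
        {in U, forall x, 0 < lam x} &
        {in U, forall x (a b : 'rV[R]_n),
          m (phi x) ('D_a phi x) ('D_b phi x) =
          lam x * \sum_i a 0 i * b 0 i}].

(* Locally isometric to Euclidean space. *)
Definition flat n S (m : V -> V -> V -> R) : Prop :=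
  forall p, S p -> exists U (phi : 'rV[R]_n -> V),
    [/\ local_param S U phi, (phi @` U) p &
        {in U, forall x (a b : 'rV[R]_n),
          m (phi x) ('D_a phi x) ('D_b phi x) = \sum_i a 0 i * b 0 i}].

End Submanifolds.

Section Finsler.
Context {R : realType} {V : finNormedModType R}.
Variables (n : nat) (S : set V) (F : V -> R).
Implicit Types (O : set V) (p u v w x y z : V) (X Y Z T : V -> V).
Implicit Types (nabla : V -> V -> V -> (V -> V) -> V).

(* Restricted to the tangent spaces of [S], these are the tensors of the
   restriction of [F] to the tangent bundle of [S]. *)
Definition fund_tensor v u w : R :=
  2^-1 * derive1 (fun s : R =>
           derive1 (fun t : R => F (v + s *: u + t *: w) ^+ 2) 0) 0.

Definition cartan_tensor v u w z : R :=
  2^-1 * derive1 (fun t : R => fund_tensor (v + t *: z) u w) 0.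

(* [nabla p v x Y] stands for the derivative of the local vector field [Y]
   along [x] at the point [p] of [S], with reference vector [v]; [p], [v] and
   [x] are meaningful only if [v] is nonzero and tangent to [S] at [p] and so
   is [x].  Tensoriality in the field [X] is the dependence on its value [x]
   only, together with [chern_linear]. *)
Record chern_connection nabla : Prop := {
  chern_tangent : forall O Y p v x,
    vector_field n S O Y -> O p -> slit_tangent_bundle n S (p, v) ->
    tangent_space n S p x -> tangent_space n S p (nabla p v x Y) ;
  (* [Y] matters only through its restriction to a neighbourhood of [p]
     in [S] *)
  chern_local : forall O Y Y' p v x,
    vector_field n S O Y -> vector_field n S O Y' ->
    {in S `&` O, Y =1 Y'} -> O p -> slit_tangent_bundle n S (p, v) ->
    tangent_space n S p x -> nabla p v x Y = nabla p v x Y' ;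
  chern_linear : forall O Y p v x y (c : R),
    vector_field n S O Y -> O p -> slit_tangent_bundle n S (p, v) ->
    tangent_space n S p x -> tangent_space n S p y ->
    nabla p v (c *: x + y) Y = c *: nabla p v x Y + nabla p v y Y ;
  chern_add : forall O Y Y' p v x,
    vector_field n S O Y -> vector_field n S O Y' -> O p ->
    slit_tangent_bundle n S (p, v) -> tangent_space n S p x ->
    nabla p v x (fun q => Y q + Y' q) = nabla p v x Y + nabla p v x Y' ;
  chern_leibniz : forall O (f : V -> R) Y p v x,
    smooth_on (S `&` O) f -> vector_field n S O Y -> O p ->
    slit_tangent_bundle n S (p, v) -> tangent_space n S p x ->
    nabla p v x (fun q => f q *: Y q) =
    derive_on S f p x *: Y p + f p *: nabla p v x Y ;
  chern_smooth : forall O X Y,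
    vector_field n S O X -> vector_field n S O Y ->
    smooth_on (slit_tangent_bundle n S `&` [set pv | O pv.1])
      (fun pv => nabla pv.1 pv.2 (X pv.1) Y) ;
  chern_torsion_free : forall O T X Y p,
    vector_field n S O T -> (forall q, S q -> O q -> T q != 0) ->
    vector_field n S O X -> vector_field n S O Y -> S p -> O p ->
    nabla p (T p) (X p) Y - nabla p (T p) (Y p) X = lie_bracket S X Y p ;
  chern_almost_metric : forall O T X Y Z p,
    vector_field n S O T -> (forall q, S q -> O q -> T q != 0) ->
    vector_field n S O X -> vector_field n S O Y -> vector_field n S O Z ->
    S p -> O p ->
    derive_on S (fun q => fund_tensor (T q) (Y q) (Z q)) p (X p) =
    fund_tensor (T p) (nabla p (T p) (X p) Y) (Z p) +
    fund_tensor (T p) (Y p) (nabla p (T p) (X p) Z) +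
    2 * cartan_tensor (T p) (nabla p (T p) (X p) T) (Y p) (Z p) }.

Definition vertical_derivative nabla p v x Y z : V :=
  derive1 (fun t : R => nabla p (v + t *: z) x Y) 0.

(* The connection with reference field [T]. *)
Definition affine_connection nabla T X Y : V -> V :=
  fun q => nabla q (T q) (X q) Y.

Definition affine_curvature nabla T X Y Z p : V :=
  let D := affine_connection nabla T in
  D X (D Y Z) p - D Y (D X Z) p - D (lie_bracket S X Y) Z p.

Definition chern_curvature nabla T X Y Z p : V :=
  let D := affine_connection nabla T in
  affine_curvature nabla T X Y Z p
  - vertical_derivative nabla p (T p) (Y p) Z (D X T p)
  + vertical_derivative nabla p (T p) (X p) Z (D Y T p).

(* [T] and [X] extend the flagpole [v]; [Y] and [Z] extend the vector [u]. *)
Definition flag_curvature nabla T X Y Z p : R :=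
  let v := T p in let u := Y p in
  fund_tensor v (chern_curvature nabla T X Y Z p) v /
  (F v ^+ 2 * fund_tensor v u u - fund_tensor v u v ^+ 2).

Definition scalar_flag_curvature : Prop :=
  forall nabla, chern_connection nabla ->
  exists kappa : V -> V -> R, forall p v u,
    slit_tangent_bundle n S (p, v) -> tangent_space n S p u ->
    free [:: v; u] ->
    forall O T X Y Z,
    O p -> vector_field n S O T -> (forall q, S q -> O q -> T q != 0) ->
    vector_field n S O X -> vector_field n S O Y -> vector_field n S O Z ->
    T p = v -> X p = v -> Y p = u -> Z p = u ->
    flag_curvature nabla T X Y Z p = kappa p v.

Definition zermelo_data (m : V -> V -> V -> R) (A : V -> V) : Prop :=
  [/\ riemannian_metric n S m, vector_field n S setT A,
      forall p, S p -> m p (A p) (A p) < 1 &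
      forall p v, slit_tangent_bundle n S (p, v) ->
        m p ((F v)^-1 *: v - A p) ((F v)^-1 *: v - A p) = 1].

End Finsler.

Definition randers_minkowski (R : realType) (V : finNormedModType R)
    (h : {dot V for idfun}) (W : V) (F : V -> R) : Prop :=
  [/\ h W W < 1, F 0 = 0 &
      forall v, v != 0 ->
        0 < F v /\ h ((F v)^-1 *: v - W) ((F v)^-1 *: v - W) = 1].

(* Main.v *)
(* In an isometric chart [phi] of the flat hypersurface, put [f x = h(W, phi x)],
   [w = grad f] and [l0 = 1 - h(W, W)].  The pulled back metric is
     [F (x, y) = (sqrt (l0 |y|^2 + df(y)^2) - df(y)) / l0],
   a Randers metric of the flat space whose 1-form is closed.  Since the second
   fundamental form takes its values in a normal line, the Gauss equation of a
   flat hypersurface says that [Hess f] has rank at most one, and then the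
   curvature of the nonlinear connection of [F] is explicitly
     [R (y, u) = Xi u + tau y]
   with [Xi] independent of [u], so that the flag curvature is [- Xi / F^2].
     On a tangent line the indicatrix consists of [v / F v] and [- v / F (- v)];
   thus any Zermelo data [(m, A)] satisfy
     [m (v, v) = (1 - m (A, A)) F v F (- v)],
   and so do [(h, W)].  Hence [m] is a multiple of [h] on the tangent spaces. *)
Require Import Defs.
From HB Require Import structures.
From mathcomp Require Import all_boot all_order all_algebra.
From mathcomp Require Import all_classical all_reals all_analysis.
From mathcomp Require Import ring lra.
Set Implicit Arguments.
Unset Strict Implicit.
Unset Printing Implicit Defensive.
Import Order.TTheory GRing.Theory Num.Theory.
Import numFieldNormedType.Exports.
Local Open Scope classical_set_scope.
Local Open Scope ring_scope.

(** * Calculus in finite-dimensional normed spaces *)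

(** The statement concerns every connection that satisfies the axioms, and the Chern symbols of a
    Randers metric are unwieldy, so they are never computed. The form g_v(v, .) is parallel along
    horizontal lifts and the bracket of two lifts is vertical; hence g_v(R_v(X, Y)Z, v) is minus the
    pairing of [Z] with the curvature of the nonlinear connection. The latter is half the vertical
    derivative of the spray, which the axioms determine by one equation in F^2. It suffices to
    exhibit a spray and check that equation. The candidate is projective: as the 1-form is closed,
    [F] has the unparametrized geodesics of the Riemannian metric l0 |y|^2 + df(y)^2, and the two
    sprays differ by a multiple of [y]. The coefficient tau is forced by g_v(R (y, u), y) = 0, and
    with it the flag quotient no longer depends on [u]. Zermelo data exist because [W] splits into a
    tangential part [A] and a normal part [N]: in a tangent space of [S] the indicatrix is the
    [h]-sphere around [A] whose squared radius is 1 - h(N, N), so [h] divided by that number,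
    together with [A], has the required properties. *)

Lemma sum_continuous (K : numFieldType) (T : topologicalType)
    (V : normedModType K) n (f : 'I_n -> T -> V) (x : T) :
  (forall i, {for x, continuous (f i)}) ->
  {for x, continuous (fun y => \sum_i f i y)}.
Proof.
by move=> fx; apply: cvg_big; [exact: add_continuous|move=> i _; exact: fx].
Qed.

Section FiniteDimension.
Context {R : realType}.
Implicit Type V : finNormedModType R.

(** On the compact unit sphere the norm of the combination attains a minimum, which independence
    makes nonzero. From this bound follows the continuity of coordinates for the given norm of
    [V]. *)
Lemma lincomb_norm_ge V n (e : 'I_n -> V) :
  (forall c : 'rV[R]_n, \sum_i c ord0 i *: e i = 0 -> c = 0) ->
  exists2 m : R, 0 < m &
    forall c : 'rV[R]_n, m * `|c| <= `|\sum_i c ord0 i *: e i|.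
Proof.
move=> efree; pose L (c : 'rV[R]_n) := \sum_i c ord0 i *: e i.
have Lcont : continuous L.
  move=> c; apply: sum_continuous => i.
  by apply: continuousZr_tmp; exact: coord_continuous.
have nLcont : continuous (fun c => `|L c|).
  move=> c; apply: (@continuous_comp _ _ _ L); first exact: Lcont.
  exact: norm_continuous.
have LZ k c : L (k *: c) = k *: L c.
  by rewrite /L scaler_sumr; apply: eq_bigr => i _; rewrite mxE scalerA.
pose A : set 'rV[R]_n := [set c | `|c| = 1].
have [A0|/set0P/negP/negPn/eqP A0] := pselect (A !=set0); last first.
  (* Empty unit sphere: every [c] is zero and any positive constant serves. *)
  exists 1 => // c; have [->|c0] := eqVneq c 0; first by rewrite normr0 mulr0.
  suff : A (`|c|^-1 *: c) by rewrite A0.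
  by rewrite /A /= normrZ normfV normr_id mulVf ?normr_eq0.
have cA : compact A.
  apply: bounded_closed_compact.
    exists 1; split; first exact: num_real.
    by move=> M M1 c /= ->; apply: ltW.
  have -> : A = (fun c : 'rV[R]_n => `|c|) @^-1` [set x | x = 1] by [].
  apply: preimage_closed; last exact: closed_eq.
  by move=> ? _; apply: norm_continuous.
have [c /set_mem /= Ac minc] :=
  EVT_min_rV A0 cA (continuous_subspaceT nLcont).
exists `|L c|.
  rewrite normr_gt0; apply/eqP => /efree c0; move: Ac.
  by rewrite /A /= c0 normr0 => /esym/eqP; rewrite oner_eq0.
move=> d; have [->|d0] := eqVneq d 0; first by rewrite normr0 mulr0.
have /minc : `|d|^-1 *: d \in A.
  by rewrite inE /A /= normrZ normfV normr_id mulVf ?normr_eq0.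
by rewrite LZ normrZ normfV normr_id ler_pdivlMl ?normr_gt0 // mulrC.
Qed.

Lemma coord_vbasis_continuous V i :
  continuous (coord (vbasis {: V}) i : V -> R).
Proof.
have efree (c : 'rV[R]_(\dim {: V})) :
    \sum_j c ord0 j *: (vbasis {: V})`_j = 0 -> c = 0.
  move=> c0; apply/rowP => j; rewrite mxE.
  have /freeP := basis_free (vbasisP {: V}).
  by move=> /(_ (fun i => c ord0 i) c0 j).
have [m m0 mP] := lincomb_norm_ge efree.
apply: (@bounded_linear_continuous R V R (coord (vbasis {: V}) i : {linear V -> R})).
apply/linear_boundedP; exists m^-1; split; first exact: num_real.
move=> M mM v; apply: (@le_trans _ _ (m^-1 * `|v|)); last first.
  by rewrite ler_wpM2r // ltW.
have := mP (\row_j coord (vbasis {: V}) j v).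
under eq_bigr do rewrite mxE.
rewrite -(coord_vbasis (memvf v)) -ler_pdivlMl //; apply: le_trans.
rewrite [leRHS]mx_normrE; apply/bigmax_geP; right.
by exists (ord0, i); rewrite //= mxE.
Qed.

Lemma linear_fd_continuous V (G : normedModType R) (f : {linear V -> G}) :
  continuous f.
Proof.
have -> : (f : V -> G) = fun v => \sum_i coord (vbasis {: V}) i v *: f (vbasis {: V})`_i.
  apply/funext => v; rewrite {1}(coord_vbasis (memvf v)) linear_sum.
  by apply: eq_bigr => i _; rewrite linearZ.
move=> v; apply: sum_continuous => i; apply: continuousZr_tmp.
exact: coord_vbasis_continuous.
Qed.

End FiniteDimension.

HB.instance Definition _ (R : numFieldType) (U V : finNormedModType R) :=
  Vector.on (U * V)%type.

Lemma near_eq_differentiable (K : numFieldType) (V W : normedModType K)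
    (f g : V -> W) (a : V) :
  {near a, f =1 g} -> differentiable f a -> differentiable g a.
Proof.
move=> fg /diff_locallyP [dfc dfe].
have fga : f a = g a by exact: nbhs_singleton fg.
have fg0 : \forall h \near 0, f (h + a) = g (h + a).
  by move: fg; rewrite (near_shift 0) subr0.
have ge : g \o shift a = cst (g a) + 'd f a +o_ 0 id.
  apply/eqaddoP => _/posnumP[e].
  have /eqaddoP /(_ e%:num) /(_ [gt0 of e%:num]) := dfe.
  apply: filter_app; near=> h => /=.
  rewrite /= !fctE /= -fga.
  suff -> : f (h + a) = g (h + a) by [].
  by near: h.
have dge := diff_unique dfc ge.
by apply/diff_locallyP; rewrite dge.
Unshelve. all: by end_near. Qed.

Lemma differentiable_linear_fd (R : realType) (V : finNormedModType R)
    (G : normedModType R) (f : {linear V -> G}) x : differentiable f x.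
Proof. by apply: linear_differentiable; exact: linear_fd_continuous. Qed.

Section DerivativeCalculus.
Context {R : realType}.
Implicit Types E G H : normedModType R.

Lemma derive_linear E G (f : E -> G) x : differentiable f x ->
  linear (fun v => 'D_v f x).
Proof. by move=> df a u v; rewrite !deriveE // linearP. Qed.

Lemma derive_chain E G H (f : E -> G) (g : G -> H) x v :
  differentiable f x -> differentiable g (f x) ->
  'D_v (g \o f) x = 'D_('D_v f x) g (f x).
Proof.
move=> df dg; rewrite deriveE; last exact: differentiable_comp.
by rewrite diff_comp //= -deriveE // -deriveE.
Qed.

Lemma derive_linearE E G H (g : {linear G -> H}) (f : E -> G) x v :
  continuous g -> differentiable f x ->
  'D_v (g \o f) x = g ('D_v f x).
Proof.
move=> cg df; rewrite derive_chain //; last exact: linear_differentiable.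
by rewrite deriveE ?diff_lin //; exact: linear_differentiable.
Qed.

Lemma derive1_line E G (f : E -> G) x v :
  derive1 (fun t : R => f (x + t *: v)) 0 = 'D_v f x.
Proof.
rewrite /derive1 /derive.
suff -> : (fun t : R => t^-1 *: (f (x + (t + 0) *: v) - f (x + 0 *: v))) =
          (fun t : R => t^-1 *: ((f \o shift x) (t *: v) - f x)) by [].
by apply/funext => t /=; rewrite addr0 scale0r addr0 [x + _]addrC.
Qed.

Lemma derive_fd (E : finNormedModType R) G (f : E -> G) x v :
  differentiable f x ->
  'D_v f x = \sum_i coord (vbasis {: E}) i v *: 'D_((vbasis {: E})`_i) f x.
Proof.
move=> df; rewrite deriveE // {1}(coord_vbasis (memvf v)) linear_sum.
by apply: eq_bigr => i _; rewrite linearZ /= deriveE.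
Qed.

End DerivativeCalculus.

(** * Closure properties of the classes C^k *)

Section ClassC.
Context {R : realType}.
Implicit Types E G H : normedModType R.

Lemma class_CS E G k (O : set E) (f : E -> G) :
  class_C k.+1 O f -> class_C k O f.
Proof.
elim: k f => [|k IH] f [df Df]; first by move=> x Ox; apply/differentiable_continuous/df.
by split=> // v; apply: IH; exact: Df.
Qed.

Lemma class_C_sub E G k (O Q : set E) (f : E -> G) :
  Q `<=` O -> class_C k O f -> class_C k Q f.
Proof.
move=> OO; elim: k f => [|k IH] f; first by move=> cf x /OO; exact: cf.
by move=> [df Df]; split=> [x /OO|v]; [exact: df|exact/IH/Df].
Qed.

Lemma near_open E (O : set E) (P : set E) x :
  open O -> O x -> (forall y, O y -> P y) -> \forall y \near x, P y.
Proof. by move=> oO Ox OP; apply: filterS OP _; exact: open_nbhs_nbhs. Qed.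

(** Differentiability and directional derivatives at a point depend on the germ only. This allows
    replacing a function by a formula valid merely on an open set. *)
Lemma class_C_local E G k (O : set E) (f : E -> G) :
  (forall x, O x -> exists (Q : set E) (g : E -> G),
    [/\ Q x, open Q, (forall y, Q y -> f y = g y) & class_C k Q g]) ->
  class_C k O f.
Proof.
elim: k f => [|k IH] f Of.
  move=> x Ox; have [Q [g [Qx oQ fg cg]]] := Of x Ox.
  have fgx : {near x, f =1 g} by exact: near_open fg.
  rewrite /prop_for /continuous_at (nbhs_singleton fgx).
  by apply: cvg_trans (cg x Qx); apply: near_eq_cvg; apply: filterS fgx => y ->.
split=> [x Ox|v].
  have [Q [g [Qx oQ fg [dg _]]]] := Of x Ox.
  apply: near_eq_differentiable (dg x Qx).
  by apply: (near_open oQ Qx) => y /fg.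
apply: IH => x Ox; have [Q [g [Qx oQ fg [dg Dg]]]] := Of x Ox.
exists Q, ('D_v g); split=> [||y Qy|]; [by []|by []| |exact: Dg].
by apply: near_eq_derive; exact: near_open fg.
Qed.

Lemma class_C_eq E G k (O : set E) (f g : E -> G) : open O ->
  (forall x, O x -> f x = g x) -> class_C k O g -> class_C k O f.
Proof. by move=> oO fg cg; apply: class_C_local => x Ox; exists O, g. Qed.

Lemma class_C_cst E G k (O : set E) (c : G) : class_C k O (fun _ : E => c).
Proof.
elim: k c => [|k IH] c /=; first by move=> x _; exact: cvg_cst.
split=> [x _|v]; first exact: differentiable_cst.
have -> : 'D_v (fun _ : E => c) = fun _ => 0 by apply/funext => x; rewrite derive_cst.
exact: IH.
Qed.

Lemma class_CD E G k (O : set E) (f g : E -> G) : open O ->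
  class_C k O f -> class_C k O g -> class_C k O (fun x => f x + g x).
Proof.
move=> oO; elim: k f g => [|k IH] f g.
  by move=> cf cg x Ox; apply: continuousD; [exact: cf|exact: cg].
move=> [df Df] [dg Dg]; split=> [x Ox|v].
  by apply: differentiableD; [exact: df|exact: dg].
apply: class_C_eq (IH _ _ (Df v) (Dg v)) => // x Ox.
by rewrite deriveD //; apply: diff_derivable; [exact: df|exact: dg].
Qed.

Lemma class_C_sum E G k (O : set E) n (f : 'I_n -> E -> G) : open O ->
  (forall i, class_C k O (f i)) -> class_C k O (fun x => \sum_i f i x).
Proof.
move=> oO; elim: n f => [|n IH] f cf.
  under eq_fun do rewrite big_ord0; exact: class_C_cst.
under eq_fun do rewrite big_ord_recr /=.
by apply: class_CD => //; apply: IH => i; exact: cf.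
Qed.

Lemma class_C_linear E (G : finNormedModType R) H k (O : set E)
    (l : {linear G -> H}) (f : E -> G) : open O ->
  class_C k O f -> class_C k O (l \o f).
Proof.
move=> oO; have cl := @linear_fd_continuous R G H l.
elim: k f => [|k IH] f.
  by move=> cf x Ox; apply: continuous_comp; [exact: cf|exact: cl].
move=> [df Df]; split=> [x Ox|v].
  by apply: differentiable_comp; [exact: df|exact: differentiable_linear_fd].
apply: class_C_eq (IH _ (Df v)) => // x Ox.
by rewrite derive_linearE //; exact: df.
Qed.

Section Bilinear.
Context {E G1 G2 H : normedModType R} (b : {bilinear G1 -> G2 -> H}).
Hypothesis bcont : continuous (fun p => b p.1 p.2).

Lemma differentiable_bilinear (f : E -> G1) (g : E -> G2) x :
  differentiable f x -> differentiable g x ->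
  differentiable (fun y => b (f y) (g y)) x.
Proof.
move=> df dg.
apply: (@differentiable_comp _ _ _ _ (fun y => (f y, g y)) (fun p => b p.1 p.2)).
  exact: differentiable_pair.
exact: differentiable_bilin.
Qed.

Lemma derive_bilinear (f : E -> G1) (g : E -> G2) x v :
  differentiable f x -> differentiable g x ->
  'D_v (fun y => b (f y) (g y)) x = b ('D_v f x) (g x) + b (f x) ('D_v g x).
Proof.
move=> df dg.
rewrite (@derive_chain _ _ _ _ (fun y => (f y, g y)) (fun p => b p.1 p.2)).
- rewrite deriveE; last exact: differentiable_bilin.
  rewrite diff_bilin //= deriveE; last exact: differentiable_pair.
  by rewrite diff_pair //= -!deriveE // addrC.
- exact: differentiable_pair.
- exact: differentiable_bilin.
Qed.

Lemma class_C_bilinear k (O : set E) (f : E -> G1) (g : E -> G2) : open O ->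
  class_C k O f -> class_C k O g -> class_C k O (fun x => b (f x) (g x)).
Proof.
move=> oO; elim: k f g => [|k IH] f g.
  move=> cf cg x Ox.
  apply: (@continuous_comp _ _ _ (fun y => (f y, g y)) (fun p => b p.1 p.2)).
    by apply: cvg_pair; [exact: cf|exact: cg].
  exact: bcont.
move=> cf cg; have [df Df] := cf; have [dg Dg] := cg; split=> [x Ox|v].
  by apply: differentiable_bilinear; [exact: df|exact: dg].
apply: (class_C_eq oO (g := fun x => b ('D_v f x) (g x) + b (f x) ('D_v g x))).
  by move=> x Ox; rewrite derive_bilinear //; [exact: df|exact: dg].
apply: class_CD => //; apply: IH => //.
- exact: Df.
- exact: class_CS.
- exact: class_CS.
- exact: Dg.
Qed.

End Bilinear.

Lemma bilinear_fd_continuous (G1 G2 : finNormedModType R) H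
  (b : {bilinear G1 -> G2 -> H}) : continuous (fun p => b p.1 p.2).
Proof.
have -> : (fun p => b p.1 p.2) = fun p =>
    \sum_i coord (vbasis {: G1}) i p.1 *: b (vbasis {: G1})`_i p.2.
  apply/funext => p; rewrite {1}(coord_vbasis (memvf p.1)) linear_sumlz.
  by apply: eq_bigr => i _; rewrite linearZl_LR.
move=> p; apply: sum_continuous => i; apply: continuousZ.
  apply: (@continuous_comp _ _ _ fst); first exact: cvg_fst.
  exact: coord_vbasis_continuous.
apply: (@continuous_comp _ _ _ snd); first exact: cvg_snd.
exact: linear_fd_continuous.
Qed.

Lemma scale_is_bilinear E : bilinear_for
    (GRing.Scale.Law.clone _ _ *:%R _) (GRing.Scale.Law.clone _ _ *:%R _)
    (@GRing.scale R E : R -> E -> E).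
Proof.
by split=> [u'|u] a x y /=; rewrite ?scalerDl ?scalerDr !scalerA // mulrC.
Qed.
HB.instance Definition _ E :=
  bilinear_isBilinear.Build R R E E _ _ (@GRing.scale R E) (@scale_is_bilinear E).

Lemma mulr_bilinear_continuous : continuous (fun p : R * R => p.1 * p.2 : R).
Proof. exact: mul_continuous. Qed.

Lemma scale_bilinear_continuous G :
  continuous (fun p : R * G => p.1 *: p.2).
Proof. exact: scale_continuous. Qed.

Lemma differentiable_scale E G (s : E -> R) (f : E -> G) x :
  differentiable s x -> differentiable f x ->
  differentiable (fun y => s y *: f y) x.
Proof. exact: (differentiable_bilinear (@scale_bilinear_continuous G)). Qed.

Lemma derive_scale E G (s : E -> R) (f : E -> G) x v :
  differentiable s x -> differentiable f x ->
  'D_v (fun y => s y *: f y) x = 'D_v s x *: f x + s x *: 'D_v f x.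
Proof. exact: (derive_bilinear (@scale_bilinear_continuous G)). Qed.

Lemma class_CZ E G k (O : set E) (s : E -> R) (f : E -> G) : open O ->
  class_C k O s -> class_C k O f -> class_C k O (fun x => s x *: f x).
Proof. exact: (class_C_bilinear (@scale_bilinear_continuous G)). Qed.

Lemma differentiable_mul E (f g : E -> R) x :
  differentiable f x -> differentiable g x ->
  differentiable (fun y => f y * g y) x.
Proof. exact: (differentiable_bilinear mulr_bilinear_continuous). Qed.

Lemma derive_mul E (f g : E -> R) x v :
  differentiable f x -> differentiable g x ->
  'D_v (fun y => f y * g y) x = 'D_v f x * g x + f x * 'D_v g x.
Proof. exact: (derive_bilinear mulr_bilinear_continuous). Qed.

Lemma class_CM E k (O : set E) (f g : E -> R) : open O ->
  class_C k O f -> class_C k O g -> class_C k O (fun x => f x * g x).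
Proof. exact: (class_C_bilinear mulr_bilinear_continuous). Qed.

Lemma derive_inv E (f : E -> R) x v : differentiable f x -> f x != 0 ->
  'D_v (fun y => (f y)^-1) x = - 'D_v f x / f x ^+ 2.
Proof.
move=> df f0; rewrite deriveV //; last exact: diff_derivable.
by rewrite /GRing.scale /= mulNr mulrC mulNr.
Qed.

(** The derivative of [1 / f] is [- f' (1 / f)^2], so order [k] for [1 / f] itself feeds the
    induction. *)
Lemma class_CV E k (O : set E) (f : E -> R) : open O ->
  (forall x, O x -> f x != 0) -> class_C k O f ->
  class_C k O (fun x => (f x)^-1).
Proof.
move=> oO f0; elim: k => [|k IH].
  by move=> cf x Ox; apply: continuousV; [exact: f0|exact: cf].
move=> cf; have [df Df] := cf; split=> [x Ox|v].
  by apply: differentiableV; [exact: df|exact: f0].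
have cV := IH (class_CS cf).
apply: (class_C_eq oO (g := fun x => (-1) * ('D_v f x * ((f x)^-1 * (f x)^-1)))).
  move=> x Ox; rewrite derive_inv; [|exact: df|exact: f0].
  by rewrite mulN1r mulNr expr2 invfM.
apply: class_CM => //; first exact: class_C_cst.
by apply: class_CM => //; [exact: Df|exact: class_CM].
Qed.

Lemma differentiable_sqrt (x : R) : 0 < x -> differentiable (@Num.sqrt R) x.
Proof. by move=> x0; apply/derivable1_diffP; have [] := is_derive1_sqrt x0. Qed.

Lemma derive_sqrt_comp E (f : E -> R) x v : differentiable f x -> 0 < f x ->
  'D_v (fun y => Num.sqrt (f y)) x = 'D_v f x / (2 * Num.sqrt (f x)).
Proof.
move=> df f0; rewrite (@derive_chain _ _ _ _ f Num.sqrt) //; last exact: differentiable_sqrt.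
rewrite deriveE; last exact: differentiable_sqrt.
rewrite -[X in 'd _ _ X]mulr1 -/(_ *: (1 : R)) linearZ /= -deriveE; last exact: differentiable_sqrt.
by rewrite derive_sqrt.
Qed.

Lemma class_C_sqrt E k (O : set E) (f : E -> R) : open O ->
  (forall x, O x -> 0 < f x) -> class_C k O f ->
  class_C k O (fun x => Num.sqrt (f x)).
Proof.
move=> oO f0; elim: k => [|k IH].
  move=> cf x Ox; apply: continuous_comp; first exact: cf.
  exact: sqrt_continuous.
move=> cf; have [df Df] := cf; split=> [x Ox|v].
  apply: (@differentiable_comp _ _ _ _ f Num.sqrt); first exact: df.
  by apply: differentiable_sqrt; exact: f0.
have cs := IH (class_CS cf).
apply: (class_C_eq oO (g := fun x => 'D_v f x * (2 * Num.sqrt (f x))^-1)).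
  by move=> x Ox; rewrite derive_sqrt_comp //; [exact: df|exact: f0].
apply: class_CM => //; first exact: Df.
apply: class_CV => //; last by apply: class_CM => //; exact: class_C_cst.
by move=> x Ox; rewrite mulf_neq0 // ?pnatr_eq0 // gt_eqF // sqrtr_gt0 f0.
Qed.

(** [class_C] speaks of derivatives in fixed directions, whereas the chain rule produces the moving
    direction ['D_v f x]; expanding it in a basis of the middle space restores fixed directions. *)
Lemma class_C_comp E (G : finNormedModType R) H k (O : set E) (Q : set G)
    (f : E -> G) (g : G -> H) : open O ->
  (forall x, O x -> Q (f x)) -> class_C k O f -> class_C k Q g ->
  class_C k O (fun x => g (f x)).
Proof.
move=> oO OQ; elim: k g => [|k IH] g.
  move=> cf cg x Ox; apply: (@continuous_comp _ _ _ f g); first exact: cf.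
  by apply: cg; exact: OQ.
move=> cf [dg Dg]; have [df Df] := cf; split=> [x Ox|v].
  apply: (@differentiable_comp _ _ _ _ f g); first exact: df.
  by apply: dg; exact: OQ.
apply: (class_C_eq oO (g := fun x => \sum_i coord (vbasis {: G}) i ('D_v f x) *:
    'D_((vbasis {: G})`_i) g (f x))).
  move=> x Ox; rewrite (@derive_chain _ _ _ _ f g); [|exact: df|exact/dg/OQ].
  by rewrite -derive_fd //; exact/dg/OQ.
apply: class_C_sum => // i; apply: class_CZ => //.
  exact: (class_C_linear (coord (vbasis {: G}) i) oO (Df v)).
exact: (IH _ (class_CS cf) (Dg _)).
Qed.

Lemma class_C_pair E G H k (O : set E) (f : E -> G) (g : E -> H) : open O ->
  class_C k O f -> class_C k O g -> class_C k O (fun x => (f x, g x)).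
Proof.
move=> oO; elim: k f g => [|k IH] f g.
  by move=> cf cg x Ox; apply: cvg_pair; [exact: cf|exact: cg].
move=> [df Df] [dg Dg]; split=> [x Ox|v].
  by apply: differentiable_pair; [exact: df|exact: dg].
apply: class_C_eq (IH _ _ (Df v) (Dg v)) => // x Ox.
rewrite deriveE; last by apply: differentiable_pair; [exact: df|exact: dg].
rewrite diff_pair; [|exact: df|exact: dg].
by rewrite -!deriveE //; [exact: dg|exact: df].
Qed.

Lemma class_C_id E k (O : set E) : class_C k O (@id E).
Proof.
case: k => [|k] /=; first by move=> x _; exact: cvg_id.
split=> [x _|v]; first exact: (@ex_diff _ _ _ _ _ _ _ (is_diff_id x)).
have -> : 'D_v (@id E) = fun _ => v by apply/funext => x; rewrite derive_id.
exact: class_C_cst.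
Qed.

Lemma class_C_lin (E : finNormedModType R) H k (O : set E)
    (l : {linear E -> H}) : open O -> class_C k O l.
Proof. by move=> oO; exact: (class_C_linear l oO (@class_C_id E k O)). Qed.

(* Otherwise unification unfolds directional derivatives into limits. *)
Opaque derive.

Lemma differentiable_id E (x : E) : differentiable id x.
Proof. exact: (@ex_diff _ _ _ _ _ _ _ (is_diff_id x)). Qed.

(** * Mean value theorem and symmetry of second derivatives *)

Lemma is_derive_line E G (f : E -> G) p v (t : R) :
  differentiable f (p + t *: v) ->
  is_derive t 1 (fun s : R => f (p + s *: v)) ('D_v f (p + t *: v)).
Proof.
move=> df; have ds : differentiable (fun s : R => s *: v) t.
  by apply: differentiable_scale; [exact: differentiable_id|exact: differentiable_cst].
have dl : differentiable (fun s : R => p + s *: v) t.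
  by apply: differentiableD => //; exact: differentiable_cst.
split.
  by apply/derivable1_diffP; exact: (@differentiable_comp _ _ _ _ (fun s : R => p + s *: v) f).
rewrite (@derive_chain _ _ _ _ (fun s : R => p + s *: v) f) //.
rewrite deriveD; [|exact: derivable_cst|exact: diff_derivable].
rewrite derive_cst add0r derive_scale; [|exact: differentiable_id|exact: differentiable_cst].
by rewrite derive_id derive_cst scale1r scaler0 addr0.
Qed.

Lemma mvt_line E (f : E -> R) p v (h : R) : 0 < h ->
  (forall t, 0 <= t <= h -> differentiable f (p + t *: v)) ->
  exists2 t, 0 <= t <= h & f (p + h *: v) - f p = 'D_v f (p + t *: v) * h.
Proof.
move=> h0 df.
have [t||t /andP[t0 th]] := @MVT R (fun s => f (p + s *: v))
    (fun s => 'D_v f (p + s *: v)) 0 h h0.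
- rewrite in_itv /= => /andP[t0 th]; apply: is_derive_line.
  by apply: df; rewrite !ltW.
- apply: continuous_in_subspaceT => t; rewrite inE /= in_itv /= => th.
  apply: differentiable_continuous.
  by apply/derivable1_diffP; have [] := is_derive_line (df t th).
- rewrite scale0r addr0 subr0 => e; exists t => //.
  by move: t0 th; rewrite !bnd_simp => t0 th; rewrite !ltW.
Qed.

Lemma near_parallelogram E (P : set E) x u v : (\forall y \near x, P y) ->
  exists2 h : R, 0 < h & forall s t : R, 0 <= s <= h -> 0 <= t <= h ->
    P (x + s *: u + t *: v).
Proof.
move=> /nbhs_ballP[e /= e0 Pe]; pose c := `|u| + `|v| + 1.
have c0 : 0 < c by rewrite ltr_wpDl.
exists (e / c) => [|s t /andP[s0 sh] /andP[t0 th]]; first by rewrite divr_gt0.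
apply: Pe; rewrite -ball_normE /ball_ /= -addrA opprD addrA subrr sub0r normrN.
apply: (le_lt_trans (ler_normD _ _)); rewrite !normrZ !ger0_norm //.
apply: (@le_lt_trans _ _ (e / c * (`|u| + `|v|))).
  by rewrite mulrDr lerD // ler_wpM2r.
rewrite -mulrA gtr_pMr // ltr_pdivrMl // mulr1 /c.
by rewrite ltrDl.
Qed.

(** The mean value theorem along [u] for the increment of [f] by [h *: v], and then along [v] for
    ['D_u f]. *)
Lemma second_difference E (f : E -> R) (O : set E) x u v (h : R) : 0 < h ->
  (forall s t : R, 0 <= s <= h -> 0 <= t <= h -> O (x + s *: u + t *: v)) ->
  class_C 2 O f ->
  exists s t : R, [/\ 0 <= s <= h, 0 <= t <= h &
    f (x + h *: u + h *: v) - f (x + h *: u) - (f (x + h *: v) - f x) =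
    'D_v ('D_u f) (x + s *: u + t *: v) * h * h].
Proof.
move=> h0 Oh [df /(_ u)[dDf _]].
have hh : 0 <= h <= h by rewrite ltW //=.
have h00 : (0 : R) <= 0 <= h by rewrite lexx ltW.
have dfs s : 0 <= s <= h -> differentiable f (x + s *: u).
  by move=> sh; apply: df; rewrite -[_ + _]addr0 -(scale0r v); exact: Oh.
have dfsh s : 0 <= s <= h -> differentiable (fun q => f (q + h *: v)) (x + s *: u).
  move=> sh; apply: (@differentiable_comp _ _ _ _ (fun q => q + h *: v) f).
    exact: differentiableD.
  by apply: df; exact: Oh.
have [s sh gs] := @mvt_line E (fun q => f (q + h *: v) - f q) x u h h0
  (fun s sh => differentiableB (dfsh s sh) (dfs s sh)).
have [t th Df] := @mvt_line E ('D_u f) (x + s *: u) v h h0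
  (fun t th => dDf _ (Oh s t sh th)).
exists s, t; split=> //; rewrite -Df {}gs; congr (_ * _).
rewrite deriveB; [|exact/diff_derivable/dfsh|exact/diff_derivable/dfs].
congr (_ - _).
rewrite (@derive_chain _ _ _ _ (fun q => q + h *: v) f); last exact/df/Oh.
  by rewrite deriveD // derive_id derive_cst addr0.
exact: differentiableD.
Qed.

(** The second difference over a small parallelogram is symmetric in [u] and [v], and is [h^2] times
    either mixed derivative at some nearby point; continuity of both at [x] concludes. *)
Lemma derive_comm_real E (f : E -> R) (O : set E) x u v : open O -> O x ->
  class_C 2 O f -> 'D_v ('D_u f) x = 'D_u ('D_v f) x.
Proof.
move=> oO Ox cf; apply/eqP; rewrite -subr_eq0 -normr_le0; apply/ler_addgt0Pr => e e0.
have e20 : 0 < e / 2 by rewrite divr_gt0.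
have [_ /[dup] /(_ u)[_ /(_ v) cuv] /(_ v)[_ /(_ u) cvu]] := cf.
have nO : \forall y \near x, O y by exact: open_nbhs_nbhs.
have nuv : \forall y \near x, `|'D_v ('D_u f) x - 'D_v ('D_u f) y| < e / 2.
  by have /cvgrPdist_lt := cuv x Ox; apply.
have nvu : \forall y \near x, `|'D_u ('D_v f) x - 'D_u ('D_v f) y| < e / 2.
  by have /cvgrPdist_lt := cvu x Ox; apply.
have [h h0 hP] := near_parallelogram u v (filterI nO (filterI nuv nvu)).
have [s [t [sh th e1]]] := second_difference h0 (fun s t sh th => (hP s t sh th).1) cf.
have Oh' s' t' : 0 <= s' <= h -> 0 <= t' <= h -> O (x + s' *: v + t' *: u).
  by move=> sh' th'; rewrite addrAC; have [] := hP t' s' th' sh'.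
have [t' [s' [th' sh' e2]]] := second_difference h0 Oh' cf.
have ee : 'D_v ('D_u f) (x + s *: u + t *: v) = 'D_u ('D_v f) (x + s' *: u + t' *: v).
  apply: (mulIf (lt0r_neq0 h0)); apply: (mulIf (lt0r_neq0 h0)).
  rewrite [x + s' *: u + t' *: v]addrAC.
  apply: (etrans (esym e1)); apply: etrans e2.
  have -> : x + h *: v + h *: u = x + h *: u + h *: v by rewrite addrAC.
  move: (f _) (f _) (f _) (f _) => a b c d; ring.
have [_ [n1 _]] := hP s t sh th; have [_ [_ n2]] := hP s' t' sh' th'.
have tri (a b c : R) : `|a - c| < e / 2 -> `|b - c| < e / 2 -> `|a - b| <= 0 + e.
  move=> ac bc; rewrite add0r -(subrK c a) -addrA [leRHS]splitr.
  apply: (le_trans (ler_normD _ _)); apply: lerD; first exact: ltW.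
  by rewrite distrC ltW.
by rewrite ee in n1; exact: tri n1 n2.
Qed.

Lemma derive_comm E (G : finNormedModType R) (f : E -> G) (O : set E) x u v :
  open O -> O x -> class_C 2 O f -> 'D_v ('D_u f) x = 'D_u ('D_v f) x.
Proof.
move=> oO Ox cf.
suff cE i : coord (vbasis {: G}) i ('D_v ('D_u f) x) =
            coord (vbasis {: G}) i ('D_u ('D_v f) x).
  apply: etrans (esym (coord_vbasis (memvf ('D_u ('D_v f) x)))).
  rewrite (coord_vbasis (memvf ('D_v ('D_u f) x))).
  by apply: eq_bigr => i _; exact: (congr1 (fun c => c *: _) (cE i)).
have cc := class_C_linear (coord (vbasis {: G}) i) oO cf.
have [df Df] := cf.
have D1 w y : O y -> 'D_w (coord (vbasis {: G}) i \o f) y = coord (vbasis {: G}) i ('D_w f y).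
  by move=> Oy; rewrite derive_linearE //; [exact: coord_vbasis_continuous|exact: df].
have D2 w z : coord (vbasis {: G}) i ('D_z ('D_w f) x) = 'D_z ('D_w (coord (vbasis {: G}) i \o f)) x.
  rewrite -derive_linearE; first last.
  - by have [dd _] := Df w; exact: dd.
  - exact: coord_vbasis_continuous.
  by apply: near_eq_derive; apply: (near_open oO Ox) => y Oy; rewrite D1.
by rewrite (D2 u v) (D2 v u); exact: (derive_comm_real u v oO Ox cc).
Qed.

End ClassC.

(** * Derivatives in a variable direction *)

Section DirectionalDerivatives.
Context {R : realType}.
Implicit Types D G H : normedModType R.

Lemma class_C_differentiable D G k (O : set D) (f : D -> G) x :
  class_C k.+1 O f -> O x -> differentiable f x.
Proof. by move=> [df _]; exact: df. Qed.

Lemma derive_sum_scale D G n (s : 'I_n -> D -> R) (f : 'I_n -> D -> G) x v :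
  (forall i, differentiable (s i) x) -> (forall i, differentiable (f i) x) ->
  'D_v (fun y => \sum_i s i y *: f i y) x =
  \sum_i ('D_v (s i) x *: f i x + s i x *: 'D_v (f i) x).
Proof.
move=> ds df.
have dsf i : differentiable (fun y => s i y *: f i y) x.
  exact: differentiable_scale.
have -> : (fun y => \sum_i s i y *: f i y) = \sum_i (fun y => s i y *: f i y).
  by apply/funext => y; rewrite fct_sumE.
rewrite derive_sum; last by move=> i; exact: diff_derivable.
by apply: eq_bigr => i _; rewrite derive_scale.
Qed.

Lemma differentiable_coord_vbasis D (E : finNormedModType R) (v : D -> E) i x :
  differentiable v x ->
  differentiable (fun y => coord (vbasis {: E}) i (v y)) x.
Proof.
move=> dv; apply: (@differentiable_comp _ _ _ _ v (coord (vbasis {: E}) i)) => //.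
exact: differentiable_linear_fd.
Qed.

(** Point and direction both move; a basis expansion of the direction turns the expression into a
    sum of products. *)
Lemma derive_along D (E : finNormedModType R) G (f : E -> G) (U : set E)
    (h v : D -> E) z xi : open U -> U (h z) -> class_C 2 U f ->
  differentiable h z -> differentiable v z ->
  'D_xi (fun y => 'D_(v y) f (h y)) z =
  'D_('D_xi v z) f (h z) + 'D_('D_xi h z) ('D_(v z) f) (h z).
Proof.
move=> oU Uhz [df Df] dh dv; pose e := vbasis {: E}.
have dDf w x : U x -> differentiable ('D_w f) x by move=> Ux; exact: (Df w).1.
have nU : \forall y \near z, U (h y).
  by apply: (differentiable_continuous dh); exact: open_nbhs_nbhs.
rewrite (@near_eq_derive _ _ _ _ (fun y => \sum_i coord e i (v y) *: 'D_(e`_i) f (h y))); last first.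
  by apply: filterS nU => y Uhy; rewrite -derive_fd //; exact: df.
have dDfh w : differentiable (fun y => 'D_w f (h y)) z.
  by apply: (@differentiable_comp _ _ _ _ h ('D_w f)) => //; exact: dDf.
rewrite derive_sum_scale //; last by move=> i; exact: differentiable_coord_vbasis.
rewrite big_split /=; congr (_ + _).
  rewrite (derive_fd _ (df _ Uhz)); apply: eq_bigr => i _; congr (_ *: _).
  rewrite -(derive_linearE _ _ dv) //; exact: coord_vbasis_continuous.
have -> : 'D_('D_xi h z) ('D_(v z) f) (h z) =
    'D_('D_xi h z) (fun x => \sum_i coord e i (v z) *: 'D_(e`_i) f x) (h z).
  apply: near_eq_derive; apply: (near_open oU Uhz) => x Ux.
  by rewrite -derive_fd //; exact: df.
rewrite derive_sum_scale; last 2 first.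
- by move=> i; exact: differentiable_cst.
- by move=> i; exact: dDf.
apply: eq_bigr => i _; rewrite derive_cst scale0r add0r; congr (_ *: _).
by rewrite (@derive_chain _ _ _ _ h ('D_(e`_i) f)) //; exact: dDf.
Qed.

Lemma differentiable_along D (E : finNormedModType R) G (f : E -> G) (U : set E)
    (h v : D -> E) z : open U -> U (h z) -> class_C 2 U f ->
  differentiable h z -> differentiable v z ->
  differentiable (fun y => 'D_(v y) f (h y)) z.
Proof.
move=> oU Uhz [df Df] dh dv; pose e := vbasis {: E}.
have nU : \forall y \near z, U (h y).
  by apply: (differentiable_continuous dh); exact: open_nbhs_nbhs.
apply: (@near_eq_differentiable _ _ _
    (fun y => \sum_i coord e i (v y) *: 'D_(e`_i) f (h y))).
  by apply: filterS nU => y Uhy; rewrite -derive_fd //; exact: df.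
have -> : (fun y => \sum_i coord e i (v y) *: 'D_(e`_i) f (h y)) =
    \sum_i (fun y => coord e i (v y) *: 'D_(e`_i) f (h y)).
  by apply/funext => y; rewrite fct_sumE.
apply: differentiable_sum => i; apply: differentiable_scale.
  exact: differentiable_coord_vbasis.
apply: (@differentiable_comp _ _ _ _ h ('D_(e`_i) f)) => //.
exact: (Df _).1.
Qed.

Lemma class_C_along D (E : finNormedModType R) G (f : E -> G) (U : set E)
    (Q : set D) (h v : D -> E) k : open Q -> (forall z, Q z -> U (h z)) ->
  class_C k.+1 U f -> class_C k Q h -> class_C k Q v ->
  class_C k Q (fun z => 'D_(v z) f (h z)).
Proof.
move=> oQ QU [df Df] ch cv; pose e := vbasis {: E}.
apply: (class_C_eq oQ (g := fun z => \sum_i coord e i (v z) *: 'D_(e`_i) f (h z))).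
  by move=> z Qz; rewrite -derive_fd //; exact/df/QU.
apply: class_C_sum => // i; apply: class_CZ => //.
  exact: (class_C_linear (coord e i) oQ cv).
by apply: class_C_comp QU ch (Df _).
Qed.

Lemma derive_pair D G H (f : D -> G) (g : D -> H) x v :
  differentiable f x -> differentiable g x ->
  'D_v (fun y => (f y, g y)) x = ('D_v f x, 'D_v g x).
Proof.
move=> df dg; rewrite deriveE; last exact: differentiable_pair.
by rewrite diff_pair // -!deriveE.
Qed.

End DirectionalDerivatives.

(** * The Chern connection in coordinates *)

(* A point [(x, y)] of [E * E] stands for the tangent vector [y] at [x], so
   that ['D_(X, 0)] and ['D_(0, Y)] are the base and fibre derivatives, and [L]
   is the square of the Finsler metric.  [vert_hessian Y Z] is [g_v (Y, Z)] and
   [vert_derivative Z] is [g_v (v, Z)]. *)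
Section ChernCoordinates.
Context {R : realType} {E : finNormedModType R}.
Variables (M : set (E * E)) (L : E * E -> R).
Hypothesis openM : open M.
Hypothesis smoothL : forall k, class_C k M L.
Hypothesis eulerL : forall z, M z -> 'D_(0, z.2) L z = 2 * L z.

Definition vert_derivative (Z : E) (z : E * E) : R := 2^-1 * 'D_(0, Z) L z.
Definition vert_hessian (Y Z : E) (z : E * E) : R :=
  2^-1 * 'D_(0, Y) ('D_(0, Z) L) z.

Local Notation ell := vert_derivative.
Local Notation g := vert_hessian.

Lemma class_C_derive k v : class_C k M ('D_v L).
Proof. exact: (smoothL k.+1).2. Qed.

Lemma class_C_derive2 k u v : class_C k M ('D_u ('D_v L)).
Proof. exact: (class_C_derive k.+1 v).2. Qed.

Lemma class_C_ell k Z : class_C k M (ell Z).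
Proof.
by apply: class_CM => //; [exact: class_C_cst|exact: class_C_derive].
Qed.

Lemma differentiable_ell Z z : M z -> differentiable (ell Z) z.
Proof. exact: (class_C_ell 1 Z).1. Qed.

Lemma class_C_g k Y Z : class_C k M (g Y Z).
Proof.
by apply: class_CM => //; [exact: class_C_cst|exact: class_C_derive2].
Qed.

Lemma derive_half (f : E * E -> R) v z : differentiable f z ->
  'D_v (fun z => 2^-1 * f z) z = 2^-1 * 'D_v f z.
Proof.
by move=> df; rewrite derive_mul ?derive_cst ?mul0r ?add0r //; exact: differentiable_cst.
Qed.

Lemma derive_ell v Z z : M z ->
  'D_v (ell Z) z = 2^-1 * 'D_v ('D_(0, Z) L) z.
Proof. by move=> Mz; apply: derive_half; exact: (class_C_derive 1 _).1. Qed.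

Lemma derive_commL u v z : M z -> 'D_u ('D_v L) z = 'D_v ('D_u L) z.
Proof. by move=> Mz; apply: (derive_comm_real _ _ openM Mz); exact: smoothL. Qed.

Lemma derive_comm_ell u v Z z : M z -> 'D_u ('D_v (ell Z)) z = 'D_v ('D_u (ell Z)) z.
Proof. by move=> Mz; apply: (derive_comm_real _ _ openM Mz); exact: class_C_ell. Qed.

Lemma gE Y Z z : M z -> g Y Z z = 'D_(0, Y) (ell Z) z.
Proof. by move=> Mz; rewrite derive_ell. Qed.

Lemma g_sym Y Z z : M z -> g Y Z z = g Z Y z.
Proof. by move=> Mz; rewrite /g derive_commL. Qed.

Lemma eq_derive_M (f h : E * E -> R) v z : M z ->
  (forall z, M z -> f z = h z) -> 'D_v f z = 'D_v h z.
Proof. by move=> Mz fh; apply: near_eq_derive; exact: near_open fh. Qed.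

Lemma derive_g v Y Z z : M z -> 'D_v (g Y Z) z = 'D_v ('D_(0, Y) (ell Z)) z.
Proof. by move=> Mz; apply: eq_derive_M => // {Mz}z Mz; exact: gE. Qed.

Lemma differentiable_snd (z : E * E) : differentiable (snd : E * E -> E) z.
Proof. exact: differentiable_linear_fd. Qed.

Lemma differentiable_vert (v : E * E -> E) z : differentiable v z ->
  differentiable (fun z => (0 : E, v z)) z.
Proof. by move=> dv; apply: differentiable_pair => //; exact: differentiable_cst. Qed.

Lemma derive_vert (v : E * E -> E) xi z : differentiable v z ->
  'D_xi (fun z => (0 : E, v z)) z = (0, 'D_xi v z).
Proof.
move=> dv; rewrite (derive_pair (f := fun=> 0)) //.
by rewrite derive_cst.
Qed.

(** In the last term the direction is frozen at [v z] before differentiating; the first term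
    accounts for its motion. The Euler identities below are to be read with this convention. *)
Lemma derive_along_M (f : E * E -> R) (v : E * E -> E * E) xi z : M z ->
  class_C 2 M f -> differentiable v z ->
  'D_xi (fun z => 'D_(v z) f z) z = 'D_('D_xi v z) f z + 'D_xi ('D_(v z) f) z.
Proof.
move=> Mz cf dv.
rewrite (derive_along xi (h := id) openM Mz cf) ?derive_id //.
Qed.

Lemma differentiable_along_M (f : E * E -> R) (v : E * E -> E * E) z : M z ->
  class_C 2 M f -> class_C 1 M v -> differentiable (fun z => 'D_(v z) f z) z.
Proof.
move=> Mz cf cv.
have := @class_C_along R _ _ _ f M M id v 1 openM (fun _ => id) cf
  (@class_C_id _ _ 1 M) cv.
by move=> /class_C_differentiable; exact.
Qed.

Lemma derive_snd xi (z : E * E) : 'D_xi (snd : E * E -> E) z = xi.2.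
Proof.
by rewrite deriveE ?diff_lin //; [exact: linear_fd_continuous|exact: differentiable_snd].
Qed.

Lemma derive_along_vert (f : E * E -> R) (v : E * E -> E) xi z : M z ->
  class_C 2 M f -> differentiable v z ->
  'D_xi (fun z => 'D_(0, v z) f z) z =
  'D_(0, 'D_xi v z) f z + 'D_xi ('D_(0, v z) f) z.
Proof.
move=> Mz cf dv; rewrite (derive_along_M (v := fun z => (0, v z)) xi Mz cf).
  by rewrite derive_vert.
exact: differentiable_vert.
Qed.

Lemma derive_along_hor (f : E * E -> R) xi z : M z -> class_C 2 M f ->
  'D_xi (fun z => 'D_(z.2, 0) f z) z = 'D_(xi.2, 0) f z + 'D_xi ('D_(z.2, 0) f) z.
Proof.
move=> Mz cf; have ds := differentiable_snd z.
have dc : differentiable (fun _ : E * E => 0 : E) z by [].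
rewrite (derive_along_M (v := fun z => (z.2, 0)) xi Mz cf).
  by rewrite (derive_pair (f := snd) _ ds dc) derive_snd derive_cst.
exact: (differentiable_pair ds dc).
Qed.

Lemma derive_euler (f : E * E -> R) xi z : M z -> class_C 2 M f ->
  'D_xi (fun z => 'D_(0, z.2) f z) z = 'D_(0, xi.2) f z + 'D_xi ('D_(0, z.2) f) z.
Proof.
move=> Mz cf; rewrite (derive_along_vert xi Mz cf (differentiable_snd z)).
by rewrite derive_snd.
Qed.

Lemma derive_eulerL xi z : M z ->
  'D_(0, xi.2) L z + 'D_xi ('D_(0, z.2) L) z = 2 * 'D_xi L z.
Proof.
move=> Mz; rewrite -derive_euler //.
rewrite (eq_derive_M _ Mz eulerL) derive_mul ?derive_cst ?mul0r ?add0r //.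
exact: (smoothL 1).1.
Qed.

Lemma euler_ell Z z : M z -> 'D_(0, z.2) (ell Z) z = ell Z z.
Proof.
move=> Mz; rewrite derive_ell // /ell derive_commL //.
by have /= := derive_eulerL (0, Z) Mz; set a := 'D_(0,Z) L z; set b := 'D__ _ z; lra.
Qed.

Lemma derive_euler_ell xi Z z : M z ->
  'D_(0, xi.2) (ell Z) z + 'D_xi ('D_(0, z.2) (ell Z)) z = 'D_xi (ell Z) z.
Proof.
move=> Mz; rewrite -derive_euler //; last exact: class_C_ell.
by apply: eq_derive_M => // {Mz}z; exact: euler_ell.
Qed.

(** Homogeneity of degree zero, from differentiating the homogeneity of degree one of [ell]. It
    makes the Cartan tensor vanish on the flagpole. *)
Lemma euler_g Y Z z : M z -> 'D_(0, z.2) (g Y Z) z = 0.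
Proof.
move=> Mz; rewrite derive_g // derive_comm_ell //.
by have /= := derive_euler_ell (0, Y) Z Mz; rewrite -[RHS]addr0 => /addrI.
Qed.

Lemma g_eulerl Z z : M z -> g z.2 Z z = ell Z z.
Proof. by move=> Mz; rewrite gE // euler_ell. Qed.

Lemma ell_euler z : M z -> ell z.2 z = L z.
Proof. by move=> Mz; rewrite /ell eulerL // mulrA mulVf ?mul1r ?pnatr_eq0. Qed.

Lemma hor_g_euler X Z z : M z -> 'D_(X, 0) (g z.2 Z) z = 'D_(X, 0) (ell Z) z.
Proof.
move=> Mz; rewrite derive_g //; have /= := derive_euler_ell (X, 0) Z Mz.
by rewrite (_ : (0, 0) = 0) // derive0 add0r.
Qed.

Lemma hor_ell_euler X z : M z -> 'D_(X, 0) (ell z.2) z = 'D_(X, 0) L z.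
Proof.
move=> Mz; rewrite derive_ell //; have /= := derive_eulerL (X, 0) Mz.
rewrite (_ : (0, 0) = 0) // derive0 add0r => ->.
by rewrite mulrA mulVf ?mul1r ?pnatr_eq0.
Qed.

Lemma vert_pairD (u v : E) c : (0 : E, c *: u + v) = c *: (0, u) + (0, v).
Proof. by rewrite (_ : _ + _ = (c *: 0 + 0, c *: u + v)) // scaler0 addr0. Qed.

Lemma hor_vert (u v : E) : (u, v) = (u, 0) + (0, v) :> E * E.
Proof. by rewrite (_ : _ + _ = (u + 0, 0 + v)) // addr0 add0r. Qed.

Lemma derive_vertP (f : E * E -> R) z c u v : differentiable f z ->
  'D_(0, c *: u + v) f z = c * 'D_(0, u) f z + 'D_(0, v) f z.
Proof. by move=> df; rewrite vert_pairD (derive_linear df). Qed.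

Lemma derive_vert0 (f : E * E -> R) z : 'D_(0, 0) f z = 0.
Proof. by rewrite (_ : (0, 0) = 0) // derive0. Qed.

Lemma derive_vertZ (f : E * E -> R) z c u : differentiable f z ->
  'D_(0, c *: u) f z = c * 'D_(0, u) f z.
Proof. by move=> df; rewrite -[c *: u]addr0 derive_vertP // derive_vert0 addr0. Qed.

Lemma derive_vertN (f : E * E -> R) z u : differentiable f z ->
  'D_(0, - u) f z = - 'D_(0, u) f z.
Proof. by move=> df; rewrite -scaleN1r derive_vertZ // mulN1r. Qed.

Lemma derive_vertB (f : E * E -> R) z u v : differentiable f z ->
  'D_(0, u - v) f z = 'D_(0, u) f z - 'D_(0, v) f z.
Proof. by move=> df; rewrite addrC -scaleN1r derive_vertP // mulN1r addrC. Qed.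

Lemma ellP c u v z : M z -> ell (c *: u + v) z = c * ell u z + ell v z.
Proof.
move=> Mz; rewrite /ell derive_vertP; last exact: (smoothL 1).1.
by rewrite mulrDr mulrCA.
Qed.

Lemma ellD u v z : M z -> ell (u + v) z = ell u z + ell v z.
Proof. by move=> Mz; rewrite -[u in LHS]scale1r ellP // mul1r. Qed.

Lemma ellB u v z : M z -> ell (u - v) z = ell u z - ell v z.
Proof. by move=> Mz; rewrite addrC -scaleN1r ellP // mulN1r addrC. Qed.

Lemma gPl c u v Z z : M z -> g (c *: u + v) Z z = c * g u Z z + g v Z z.
Proof. by move=> Mz; rewrite !gE // derive_vertP //; exact: differentiable_ell. Qed.

Lemma gZl c u Z z : M z -> g (c *: u) Z z = c * g u Z z.
Proof. by move=> Mz; rewrite !gE // derive_vertZ //; exact: differentiable_ell. Qed.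

Lemma ellZ c u z : M z -> ell (c *: u) z = c * ell u z.
Proof.
move=> Mz; rewrite /ell derive_vertZ; last exact: (smoothL 1).1.
by rewrite mulrCA.
Qed.

Lemma gBl u v Z z : M z -> g (u - v) Z z = g u Z z - g v Z z.
Proof. by move=> Mz; rewrite addrC -scaleN1r gPl // mulN1r addrC. Qed.

(** * From the axioms of the connection to its nonlinear part and its curvature *)

Variables (Gam : E * E -> E -> E -> E) (G2 : E * E -> E).
Hypothesis Gam_sym : forall z X Y, M z -> Gam z X Y = Gam z Y X.
Hypothesis Gam_diff : forall z X Y, M z -> differentiable (fun z => Gam z X Y) z.
Hypothesis Gam_almost_metric : forall z X Y Z, M z ->
  'D_(X, 0) (g Y Z) z = g (Gam z X Y) Z z + g Y (Gam z X Z) z +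
    'D_(0, Z) (g (Gam z X z.2) Y) z.
Hypothesis g_nondeg : forall z u, M z -> (forall Z, g u Z z = 0) -> u = 0.
Hypothesis smoothG2 : forall k, class_C k M G2.
Hypothesis sprayG2 : forall z Z, M z ->
  'D_(0, G2 z) (ell Z) z = 'D_(z.2, 0) (ell Z) z - 2^-1 * 'D_(Z, 0) L z.

Lemma g_inj z u v : M z -> (forall Z, g u Z z = g v Z z) -> u = v.
Proof.
move=> Mz uv; apply/eqP; rewrite -subr_eq0; apply/eqP; apply: (g_nondeg Mz) => Z.
by rewrite gBl // uv subrr.
Qed.

(** In horizontal directions [y] is fixed, so [ell Y] may be replaced by [g Y y]. The almost-metric
    axiom applies, and its Cartan term, a derivative of [g] along [y], vanishes by homogeneity. *)
Lemma hor_ell X Y z : M z ->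
  'D_(X, 0) (ell Y) z = ell (Gam z X Y) z + g Y (Gam z X z.2) z.
Proof.
move=> Mz; rewrite -hor_g_euler //.
rewrite (@eq_derive_M _ (g Y z.2) _ _ Mz); last by move=> z' Mz'; exact: g_sym.
by rewrite Gam_almost_metric // euler_g // addr0 g_sym // g_eulerl.
Qed.

Lemma hor_L X z : M z -> 'D_(X, 0) L z = 2 * ell (Gam z X z.2) z.
Proof.
move=> Mz; rewrite -hor_ell_euler // hor_ell // g_eulerl //; ring.
Qed.

(** [sprayG2] is the Euler-Lagrange equation of [L]. After [hor_ell] and [hor_L], the symmetry of
    [Gam] cancels the [ell] terms, and nondegeneracy of [g] removes the test vector. *)
Lemma Gam_spray z : M z -> Gam z z.2 z.2 = G2 z.
Proof.
move=> Mz; apply: (g_inj Mz) => Z; rewrite [RHS]gE // sprayG2 // hor_ell //.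
rewrite hor_L // (Gam_sym _ Z) // (g_sym Z) //.
by move: (ell _ z) (g _ _ z) => a b; field.
Qed.

Lemma eq_subr (a b a' b' : R) : a = a' -> b = b' -> a - b = a' - b'.
Proof. by move=> -> ->. Qed.

Lemma eq_addr (a b a' b' : R) : a = a' -> b = b' -> a + b = a' + b'.
Proof. by move=> -> ->. Qed.

(** Differentiate the spray equation vertically along [X]. The mixed derivative of [ell Z] is given
    by the almost-metric axiom along [y], whose Cartan term cancels against a term of the left side;
    by [hor_ell], what remains on the right is twice the pairing of [Gam z X z.2] with [Z]. *)
Lemma Gam_nonlinear z X : M z -> Gam z X z.2 = 2^-1 *: 'D_(0, X) G2 z.
Proof.
have fin (a b c d t p q s : R) : p + t = q + s - a ->
  s = b + c + t -> q = d + b -> a = d + c -> b = 2^-1 * p by lra.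
move=> Mz; apply: (g_inj Mz) => Z.
have dG2 : differentiable G2 z by exact: (smoothG2 1).1.
have dD : differentiable ('D_(Z, 0) L) z by exact: (class_C_derive 1 _).1.
have dDh : differentiable (fun z => 2^-1 * 'D_(Z, 0) L z) z.
  by apply: differentiable_mul => //; exact: differentiable_cst.
have dE : differentiable (fun z => 'D_(z.2, 0) (ell Z) z) z.
  apply: differentiable_along_M => //; first exact: class_C_ell.
  by apply: class_C_pair => //; [exact: class_C_lin|exact: class_C_cst].
have cZ := class_C_ell 2 Z.
have e1 : 'D_(0, X) (fun z => 'D_(0, G2 z) (ell Z) z) z =
    'D_(0, X) (fun z => 'D_(z.2, 0) (ell Z) z - 2^-1 * 'D_(Z, 0) L z) z.
  by apply: eq_derive_M => // z' Mz'; exact: sprayG2.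
have e2 : 'D_(0, X) (fun z => 'D_(z.2, 0) (ell Z) z - 2^-1 * 'D_(Z, 0) L z) z =
    'D_(X, 0) (ell Z) z + 'D_(0, X) ('D_(z.2, 0) (ell Z)) z - 'D_(Z, 0) (ell X) z.
  have eB : 'D_(0, X) (fun z => 2^-1 * 'D_(Z, 0) L z) z = 'D_(Z, 0) (ell X) z.
    apply: (etrans (derive_half _ dD)).
    by apply: etrans (esym (derive_ell (Z, 0) X Mz)); rewrite derive_commL.
  apply: (etrans (deriveB (diff_derivable dE) (diff_derivable dDh))).
  exact: (eq_subr (derive_along_hor (0, X) Mz cZ) eB).
have e3 := derive_along_vert (0, X) Mz cZ dG2.
(* The Cartan term contains [Gam z z.2 z.2], that is [G2 z]; the total symmetry of third vertical
   derivatives of [L] then exchanges [X] and [Z]. *)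
have e4 : 'D_(0, X) ('D_(z.2, 0) (ell Z)) z =
    g (Gam z z.2 X) Z z + g X (Gam z z.2 Z) z + 'D_(0, X) ('D_(0, G2 z) (ell Z)) z.
  apply: (etrans (derive_comm_ell (0, X) (z.2, 0) Z Mz)).
  apply: (etrans (esym (derive_g (z.2, 0) X Z Mz))).
  apply: (etrans (Gam_almost_metric z.2 X Z Mz)); apply: eq_addr => //.
  rewrite (Gam_spray Mz); apply: (etrans (derive_g (0, Z) (G2 z) X Mz)).
  apply: (etrans (derive_comm_ell (0, Z) (0, G2 z) X Mz)).
  apply: (etrans (esym (derive_g (0, G2 z) Z X Mz))).
  apply: (etrans (eq_derive_M (0, G2 z) Mz (fun z' => @g_sym Z X z'))).
  apply: (etrans (derive_g (0, G2 z) X Z Mz)).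
  exact: derive_comm_ell.
have e5 := etrans (esym e3) (etrans e1 e2).
have e6 := hor_ell X Z Mz.
have e7 := hor_ell Z X Mz.
have e8 : g (2^-1 *: 'D_(0, X) G2 z) Z z = 2^-1 * 'D_(0, 'D_(0, X) G2 z) (ell Z) z.
  by rewrite gE // (derive_vertZ _ _ (differentiable_ell Z Mz)).
apply: etrans (esym e8).
rewrite (Gam_sym z.2 X Mz) in e4; rewrite (Gam_sym Z X Mz) in e7.
rewrite (g_sym Z _ Mz) in e6; rewrite (Gam_sym Z z.2 Mz) in e7.
exact: fin e5 e4 e6 e7.
Qed.

(* [G2] is twice the spray: geodesics satisfy [x'' + G2 (x, x') = 0]. *)
Definition nonlinear_connection (X : E) (z : E * E) : E := 2^-1 *: 'D_(0, X) G2 z.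
Local Notation N := nonlinear_connection.

Definition horizontal_lift (X : E) (z : E * E) : E * E := (X, - N X z).
Local Notation delta := horizontal_lift.

(** Here [X] and [Y] are constant fields, which commute; hence no bracket term. *)
Definition curvature (X Y Z : E) (z : E * E) : E :=
  'D_(delta X z) (fun z => Gam z Y Z) z + Gam z X (Gam z Y Z)
  - ('D_(delta Y z) (fun z => Gam z X Z) z + Gam z Y (Gam z X Z)).

Definition nonlinear_curvature (X Y : E) (z : E * E) : E :=
  'D_(delta X z) (N Y) z - 'D_(delta Y z) (N X) z.

Lemma class_C_N k X : class_C k M (N X).
Proof.
apply: class_CZ => //; first exact: class_C_cst.
exact: (smoothG2 k.+1).2.
Qed.

Lemma differentiable_N X z : M z -> differentiable (N X) z.
Proof. exact: (class_C_N 1 X).1. Qed.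

Lemma derive_delta (f : E * E -> R) X z : differentiable f z ->
  'D_(delta X z) f z = 'D_(X, 0) f z - 'D_(0, N X z) f z.
Proof.
move=> df; rewrite /delta hor_vert -[(X, 0)]scale1r (derive_linear df) scale1r.
by rewrite derive_vertN // scale1r.
Qed.

(** The vertical part of the lift removes exactly the term [g Z (Gam z Y z.2) z] of [hor_ell]. *)
Lemma delta_ell Y Z z : M z -> 'D_(delta Y z) (ell Z) z = ell (Gam z Y Z) z.
Proof.
move=> Mz; rewrite (derive_delta _ (differentiable_ell Z Mz)) (hor_ell Y Z Mz).
by rewrite -(gE _ _ Mz) /N -(Gam_nonlinear _ Mz) (g_sym Z _ Mz) addrK.
Qed.

Lemma delta_L Y z : M z -> 'D_(delta Y z) L z = 0.
Proof.
move=> Mz; rewrite derive_delta; last exact: (smoothL 1).1.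
rewrite (hor_L Y Mz) /N -(Gam_nonlinear _ Mz) /ell.
by rewrite mulrA mulfV ?pnatr_eq0 // mul1r subrr.
Qed.

Lemma differentiable_delta X z : M z -> differentiable (delta X) z.
Proof.
move=> Mz; apply: differentiable_pair => //.
by apply: differentiableN; exact: differentiable_N.
Qed.

Lemma derive_of_delta xi X z : M z ->
  'D_xi (delta X) z = (0, - 'D_xi (N X) z).
Proof.
move=> Mz; have dN := differentiable_N X Mz.
have dN' : differentiable (fun z => - N X z) z by exact: differentiableN.
rewrite (derive_pair (f := fun=> X) _ _ dN') // derive_cst.
by rewrite (_ : (fun z => - N X z) = - N X) // deriveN //; exact: diff_derivable.
Qed.

(** Second derivatives of [f] in fixed directions commute, so only the derivatives of the fibre
    components [- N X] and [- N Y] of the lifts survive. *)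
Lemma delta_delta (f : E * E -> R) X Y z : M z -> class_C 2 M f ->
  'D_(delta X z) (fun z => 'D_(delta Y z) f z) z -
  'D_(delta Y z) (fun z => 'D_(delta X z) f z) z =
  - 'D_(0, nonlinear_curvature X Y z) f z.
Proof.
move=> Mz cf; have df : differentiable f z by exact: cf.1.
have e1 := derive_along_M (delta X z) Mz cf (differentiable_delta Y Mz).
have e2 := derive_along_M (delta Y z) Mz cf (differentiable_delta X Mz).
apply: (etrans (eq_subr e1 e2)).
rewrite !derive_of_delta //.
have e3 := derive_comm_real (delta X z) (delta Y z) openM Mz cf.
have fin (a b c d : R) : c = d -> - a + c - (- b + d) = - (a - b).
  by move=> ->; ring.
apply: etrans (congr1 (fun c => - c) (esym (derive_vertB _ _ df))).
apply: etrans (fin _ _ _ _ (esym e3)).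
exact: (eq_subr (eq_addr (derive_vertN _ df) erefl)
  (eq_addr (derive_vertN _ df) erefl)).
Qed.

Lemma delta_ell_Gam U V Z z : M z ->
  'D_(delta U z) (fun z => ell (Gam z V Z) z) z =
  ell ('D_(delta U z) (fun z => Gam z V Z) z + Gam z U (Gam z V Z)) z.
Proof.
move=> Mz; have dG := Gam_diff V Z Mz; have cL := smoothL 2.
have dDL : differentiable (fun z => 'D_(0, Gam z V Z) L z) z.
  have dv := differentiable_vert dG.
  exact: (differentiable_along (h := id) openM Mz cL (differentiable_id z) dv).
rewrite (ellD _ _ Mz) -(delta_ell U _ Mz).
apply: (etrans (derive_half _ dDL)).
apply: (etrans (congr1 (fun c => 2^-1 * c) (derive_along_vert (delta U z) Mz cL dG))).
apply: (etrans (mulrDr _ _ _)).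
exact: (eq_addr erefl (esym (derive_ell _ _ Mz))).
Qed.

(** The commutator of two lifts applied to [ell Z]: each order of differentiation yields [ell] of
    one half of [curvature], by [delta_ell] used twice. The right side depends on the connection
    through the spray only. *)
Lemma ell_curvature X Y Z z : M z ->
  ell (curvature X Y Z z) z = - g (nonlinear_curvature X Y z) Z z.
Proof.
move=> Mz; have cZ := class_C_ell 2 Z.
have e U V : 'D_(delta U z) (fun z => 'D_(delta V z) (ell Z) z) z =
    ell ('D_(delta U z) (fun z => Gam z V Z) z + Gam z U (Gam z V Z)) z.
  rewrite -delta_ell_Gam //; apply: eq_derive_M => // z' Mz'.
  exact: delta_ell.
apply: (etrans (ellB _ _ Mz)); apply: (etrans (eq_subr (esym (e X Y)) (esym (e Y X)))).
apply: (etrans (delta_delta X Y Mz cZ)).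
by rewrite gE.
Qed.

(** The same commutator applied to [L], whose horizontal derivatives vanish. *)
Lemma ell_nonlinear_curvature X Y z : M z -> ell (nonlinear_curvature X Y z) z = 0.
Proof.
have fin (a : R) : 0 - 0 = - a -> 2^-1 * a = 0 by lra.
move=> Mz; have d := delta_delta X Y Mz (smoothL 2).
have e U V : 'D_(delta U z) (fun z => 'D_(delta V z) L z) z = 0.
  rewrite (@eq_derive_M _ (fun=> 0) _ _ Mz); first exact: derive_cst.
  by move=> z' Mz'; exact: delta_L.
exact: fin (etrans (esym (eq_subr (e X Y) (e Y X))) d).
Qed.

End ChernCoordinates.

(** * Derivatives as a relation *)

Section HasDerive.
Context {R : realType}.
Implicit Types D G : normedModType R.

(** Bundling differentiability with the value lets the rules assemble the derivative of a long
    expression, so that only the final value has to be simplified. *)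
Definition has_derive D G (f : D -> G) (xi z : D) (l : G) : Prop :=
  differentiable f z /\ 'D_xi f z = l.

Lemma has_derive_eq D G (f : D -> G) xi z l l' :
  has_derive f xi z l -> l = l' -> has_derive f xi z l'.
Proof. by move=> fl <-. Qed.

Lemma differentiable_has_derive D G (f : D -> G) xi z :
  differentiable f z -> has_derive f xi z ('D_xi f z).
Proof. by []. Qed.

Lemma near_has_derive D G (f g : D -> G) (O : set D) xi z l : open O -> O z ->
  (forall x, O x -> f x = g x) -> has_derive g xi z l -> has_derive f xi z l.
Proof.
move=> oO Oz fg [dg <-]; split; last by apply: near_eq_derive; exact: near_open fg.
by apply: near_eq_differentiable dg; apply: (near_open oO Oz) => x /fg.
Qed.

Lemma has_derive_cst D G (c : G) (xi z : D) : has_derive (fun=> c) xi z 0.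
Proof. by split; [exact: differentiable_cst|exact: derive_cst]. Qed.

Lemma has_deriveD D G (f g : D -> G) xi z a b :
  has_derive f xi z a -> has_derive g xi z b ->
  has_derive (fun x => f x + g x) xi z (a + b).
Proof.
move=> [df <-] [dg <-]; split; first exact: differentiableD.
by apply: deriveD; exact: diff_derivable.
Qed.

Lemma has_deriveN D G (f : D -> G) xi z a :
  has_derive f xi z a -> has_derive (fun x => - f x) xi z (- a).
Proof.
move=> [df <-]; split; first exact: differentiableN.
by apply: deriveN; exact: diff_derivable.
Qed.

Lemma has_deriveB D G (f g : D -> G) xi z a b :
  has_derive f xi z a -> has_derive g xi z b ->
  has_derive (fun x => f x - g x) xi z (a - b).
Proof. by move=> fa gb; apply: has_deriveD => //; exact: has_deriveN. Qed.

Lemma has_deriveM D (f g : D -> R) xi z a b :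
  has_derive f xi z a -> has_derive g xi z b ->
  has_derive (fun x => f x * g x) xi z (a * g z + f z * b).
Proof.
move=> [df <-] [dg <-]; split; first exact: differentiable_mul.
exact: derive_mul.
Qed.

Lemma has_deriveZ D G (f : D -> R) (g : D -> G) xi z a b :
  has_derive f xi z a -> has_derive g xi z b ->
  has_derive (fun x => f x *: g x) xi z (a *: g z + f z *: b).
Proof.
move=> [df <-] [dg <-]; split; first exact: differentiable_scale.
exact: derive_scale.
Qed.

Lemma has_deriveV D (f : D -> R) xi z a : f z != 0 ->
  has_derive f xi z a -> has_derive (fun x => (f x)^-1) xi z (- a / f z ^+ 2).
Proof.
move=> f0 [df <-]; split; first exact: differentiableV.
exact: derive_inv.
Qed.

Lemma has_derive_sqrt D (f : D -> R) xi z a : 0 < f z -> has_derive f xi z a ->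
  has_derive (fun x => Num.sqrt (f x)) xi z (a / (2 * Num.sqrt (f z))).
Proof.
move=> f0 [df <-]; split; last exact: derive_sqrt_comp.
apply: (@differentiable_comp _ _ _ _ f Num.sqrt) => //.
exact: differentiable_sqrt.
Qed.

Lemma has_derive_linear D (E : finNormedModType R) G (l : {linear E -> G})
    (f : D -> E) xi z a :
  has_derive f xi z a -> has_derive (fun x => l (f x)) xi z (l a).
Proof.
move=> [df <-]; split.
  apply: (@differentiable_comp _ _ _ _ f l) => //; exact: differentiable_linear_fd.
by apply: derive_linearE => //; exact: linear_fd_continuous.
Qed.

Lemma has_derive_id D (xi z : D) : has_derive id xi z xi.
Proof. by split; [exact: differentiable_id|exact: derive_id]. Qed.

Lemma has_derive_fst (E1 E2 : finNormedModType R) (xi z : E1 * E2) :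
  has_derive fst xi z xi.1.
Proof. exact: (has_derive_linear (fst : {linear (E1 * E2)%type -> E1}) (has_derive_id xi z)). Qed.

Lemma has_derive_snd (E1 E2 : finNormedModType R) (xi z : E1 * E2) :
  has_derive snd xi z xi.2.
Proof. exact: (has_derive_linear (snd : {linear (E1 * E2)%type -> E2}) (has_derive_id xi z)). Qed.

Lemma has_derive_bilinear D (E1 E2 : finNormedModType R) G
    (b : {bilinear E1 -> E2 -> G}) (f : D -> E1) (g : D -> E2) xi z a c :
  has_derive f xi z a -> has_derive g xi z c ->
  has_derive (fun x => b (f x) (g x)) xi z (b a (g z) + b (f z) c).
Proof.
move=> [df <-] [dg <-]; have bc : continuous (fun p => b p.1 p.2) by exact: bilinear_fd_continuous.
split.
  exact: differentiable_bilinear.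
exact: derive_bilinear.
Qed.

Lemma has_derive_comp D (E : finNormedModType R) G (f : E -> G) (h : D -> E) xi z a :
  has_derive h xi z a -> differentiable f (h z) ->
  has_derive (fun x => f (h x)) xi z ('D_a f (h z)).
Proof.
move=> [dh <-] df; split; first exact: (@differentiable_comp _ _ _ _ h f).
exact: (@derive_chain _ _ _ _ h f).
Qed.

Lemma has_derive_along D (E : finNormedModType R) G (f : E -> G) (U : set E)
    (h v : D -> E) xi z a b : open U -> U (h z) -> class_C 2 U f ->
  has_derive h xi z a -> has_derive v xi z b ->
  has_derive (fun y => 'D_(v y) f (h y)) xi z
    ('D_b f (h z) + 'D_a ('D_(v z) f) (h z)).
Proof.
move=> oU Uz cf [dh <-] [dv <-]; split; first exact: (differentiable_along oU Uz cf dh dv).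
exact: (derive_along xi oU Uz cf dh dv).
Qed.

End HasDerive.

(** * The Euclidean scalar product of the coordinates *)

Section DotProduct.
Context {R : realType} {n : nat}.
Implicit Types u v : 'rV[R]_n.

Definition dotr u v : R := \sum_i u ord0 i * v ord0 i.

Lemma dotr_is_bilinear : bilinear_for
    (GRing.Scale.Law.clone _ _ *:%R _) (GRing.Scale.Law.clone _ _ *:%R _) dotr.
Proof.
have sumP (a : R) (f g : 'I_n -> R) :
    \sum_i (a * f i + g i) = a *: \sum_i f i + \sum_i g i.
  by rewrite big_split -mulr_sumr.
split=> [v|u] a x y; rewrite /dotr /= -sumP; apply: eq_bigr => i _.
  by rewrite !mxE mulrDl mulrA.
by rewrite !mxE mulrDr mulrCA.
Qed.
HB.instance Definition _ := bilinear_isBilinear.Build R _ _ _ _ _ dotr dotr_is_bilinear.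

Lemma dotr0l u : dotr 0 u = 0. Proof. exact: linear0l. Qed.

Lemma dotr0r u : dotr u 0 = 0. Proof. exact: linear0r. Qed.

Lemma dotrC u v : dotr u v = dotr v u.
Proof. by apply: eq_bigr => i _; rewrite mulrC. Qed.

Lemma dotrDl u v u' : dotr (u + v) u' = dotr u u' + dotr v u'.
Proof. exact: linearDl. Qed.

Lemma dotrZl c u v : dotr (c *: u) v = c * dotr u v.
Proof. exact: linearZl_LR. Qed.

Lemma dotrNl u v : dotr (- u) v = - dotr u v.
Proof. exact: linearNl. Qed.

Lemma dotrDr u v u' : dotr u' (u + v) = dotr u' u + dotr u' v.
Proof. exact: linearDr. Qed.

Lemma dotrZr c u v : dotr v (c *: u) = c * dotr v u.
Proof. exact: linearZr_LR. Qed.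

Lemma dotrNr u v : dotr u (- v) = - dotr u v.
Proof. exact: linearNr. Qed.

Lemma dotr_ge0 u : 0 <= dotr u u.
Proof. by apply: sumr_ge0 => i _; rewrite -expr2 sqr_ge0. Qed.

Lemma dotr_eq0 u : dotr u u = 0 -> u = 0.
Proof.
move=> /eqP; rewrite psumr_eq0 => [/allP uu|i _]; last by rewrite -expr2 sqr_ge0.
by apply/rowP => i; have := uu i (mem_index_enum _); rewrite mulf_eq0 orbb mxE => /eqP.
Qed.

Lemma dotr_gt0 u : u != 0 -> 0 < dotr u u.
Proof.
move=> u0; rewrite lt_neqAle dotr_ge0 andbT eq_sym.
by apply: contra_neq u0; exact: dotr_eq0.
Qed.

Lemma dotr_inj u v : (forall w, dotr u w = dotr v w) -> u = v.
Proof.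
move=> uv; apply/eqP; rewrite -subr_eq0; apply/eqP/dotr_eq0.
by rewrite dotrDl uv -dotrDl subrr dotr0l.
Qed.

Lemma has_derive_dotr (D : normedModType R) (f g : D -> 'rV[R]_n) xi z a b :
  has_derive f xi z a -> has_derive g xi z b ->
  has_derive (fun x => dotr (f x) (g x)) xi z (dotr a (g z) + dotr (f z) b).
Proof. exact: (has_derive_bilinear dotr). Qed.

Lemma has_derive_dotr_cst (D : normedModType R) (f : D -> 'rV[R]_n) v xi z a :
  has_derive f xi z a -> has_derive (fun x => dotr (f x) v) xi z (dotr a v).
Proof.
by move=> fa; rewrite -[dotr a v]addr0 -(dotr0r (f z)); exact: has_derive_dotr (has_derive_cst _ _ _).
Qed.

End DotProduct.

(** * Randers metrics on a flat space with a Hessian of rank one *)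
Section FlatRanders.
Context {R : realType} {n : nat}.
Local Notation E := 'rV[R]_n.
Variables (U : set E) (w : E -> E) (l0 : R).
Hypothesis openU : open U.
Hypothesis smoothw : forall k, class_C k U w.
Hypothesis w_sym : forall x X Y, U x ->
  dotr ('D_X w x) Y = dotr ('D_Y w x) X.
Hypothesis w_rank1 : forall x X Y Z T, U x ->
  dotr ('D_X w x) Y * dotr ('D_Z w x) T =
  dotr ('D_Z w x) Y * dotr ('D_X w x) T.
Hypothesis l0_gt0 : 0 < l0.

Definition slit : set (E * E) := [set z | U z.1 /\ z.2 != 0].
Local Notation M := slit.

Definition rform (x y z : E) : R := l0 * dotr y z + dotr (w x) y * dotr (w x) z.
Definition rnorm (z : E * E) : R := Num.sqrt (rform z.1 z.2 z.2).
Definition rbeta (z : E * E) : R := dotr (w z.1) z.2.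
(** For nonzero [y], the positive root of [l0 F^2 + 2 beta F = |y|^2], which is Zermelo's equation
    for a tangent vector with coordinates [y]. *)
Definition rfinsler (z : E * E) : R := (rnorm z - rbeta z) / l0.
Definition renergy (z : E * E) : R := rfinsler z * rfinsler z.

Local Notation A := rnorm.
Local Notation beta := rbeta.
Local Notation F := rfinsler.
Local Notation L := renergy.

Definition rhess (z : E * E) : E := 'D_(z.2) w z.1.
Definition rmu (x : E) : R := l0 + dotr (w x) (w x).
Definition rc (z : E * E) : R := dotr (rhess z) z.2 / rmu z.1.
(** [rc z *: w z.1] is the geodesic spray of the metric [rform]: its lowered Christoffel form is
    [Hess f (y, y)] times [df], and raising the index turns [df] into [w / rmu]. The multiple of [y]
    is the projective change caused by the closed 1-form. *)
Definition rspray (z : E * E) : E := rc z *: w z.1 - (rc z / F z) *: z.2.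
Local Notation H := rhess.
Local Notation mu := rmu.
Local Notation c := rc.
Local Notation G2 := rspray.

Lemma open_slit : open M.
Proof.
apply: (@openI _ [set z : E * E | U z.1] [set z | z.2 != 0]).
  have -> : [set z : E * E | U z.1] = fst @^-1` U by [].
  by apply: open_comp => // z _; exact: cvg_fst.
have -> : [set z : E * E | z.2 != 0] = snd @^-1` (~` [set 0 : E]).
  by apply/seteqP; split=> z /= /eqP.
apply: open_comp => [z _|]; first exact: cvg_snd.
by apply: closed_openC; apply: accessible_closed_set1; apply: hausdorff_accessible; exact: norm_hausdorff.
Qed.

Lemma l0_neq0 : l0 != 0. Proof. by rewrite gt_eqF. Qed.

Lemma rform_gt0 x y : y != 0 -> 0 < rform x y y.
Proof.
by move=> y0; rewrite ltr_wpDr ?mulr_gt0 ?dotr_gt0 // -expr2 sqr_ge0.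
Qed.

Lemma rnorm_gt0 z : M z -> 0 < A z.
Proof. by move=> [_ y0]; rewrite sqrtr_gt0 rform_gt0. Qed.

Lemma rnorm_sqr z : M z -> A z * A z = l0 * dotr z.2 z.2 + beta z * beta z.
Proof. by move=> [_ y0]; rewrite -expr2 sqr_sqrtr // ltW // rform_gt0. Qed.

Lemma rbeta_lt z : M z -> beta z < A z.
Proof.
move=> Mz; have A0 := rnorm_gt0 Mz; have [_ y0] := Mz.
rewrite ltNge; apply/negP => Ab; have := ler_pM (ltW A0) (ltW A0) Ab Ab.
by rewrite rnorm_sqr // gerDr leNgt mulr_gt0 ?dotr_gt0.
Qed.

Lemma rfinsler_gt0 z : M z -> 0 < F z.
Proof. by move=> Mz; rewrite divr_gt0 // subr_gt0 rbeta_lt. Qed.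

Lemma rmu_gt0 x : 0 < mu x.
Proof. by rewrite ltr_wpDr // dotr_ge0. Qed.

Lemma rmu_neq0 x : mu x != 0. Proof. by rewrite gt_eqF ?rmu_gt0. Qed.

Lemma class_C_fst k (O : set (E * E)) : open O -> class_C k O fst.
Proof. exact: (@class_C_lin R (E * E)%type E k O (fst : {linear (E * E)%type -> E})). Qed.

Lemma class_C_snd k (O : set (E * E)) : open O -> class_C k O snd.
Proof. exact: (@class_C_lin R (E * E)%type E k O (snd : {linear (E * E)%type -> E})). Qed.

Lemma class_C_dotr (D : normedModType R) k (O : set D) (f g : D -> E) : open O ->
  class_C k O f -> class_C k O g -> class_C k O (fun x => dotr (f x) (g x)).
Proof. by apply: class_C_bilinear; exact: bilinear_fd_continuous. Qed.

Lemma class_C_w1 k : class_C k M (fun z => w z.1).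
Proof.
exact: (class_C_comp open_slit (fun z (Mz : M z) => proj1 Mz)
  (@class_C_fst k M open_slit) (smoothw k)).
Qed.

Lemma class_C_beta k : class_C k M beta.
Proof.
have oM := open_slit.
by apply: class_C_dotr => //; [exact: class_C_w1|exact: class_C_snd].
Qed.

Lemma class_C_rnorm k : class_C k M A.
Proof.
have oM := open_slit; apply: class_C_sqrt => //.
  by move=> z [_ y0]; exact: rform_gt0.
apply: class_CD => //.
  apply: class_CM => //; first exact: class_C_cst.
  by apply: class_C_dotr => //; exact: class_C_snd.
by apply: class_CM => //; exact: class_C_beta.
Qed.

Lemma class_C_rfinsler k : class_C k M F.
Proof.
have oM := open_slit; apply: class_CM => //; last exact: class_C_cst.
apply: class_CD => //; first exact: class_C_rnorm.
apply: (class_C_eq oM (g := fun z => (-1) * beta z)); first by move=> z; rewrite mulN1r.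
by apply: class_CM => //; [exact: class_C_cst|exact: class_C_beta].
Qed.

Lemma class_C_renergy k : class_C k M L.
Proof. by apply: class_CM; [exact: open_slit|exact: class_C_rfinsler|exact: class_C_rfinsler]. Qed.

Lemma class_C_rhess k : class_C k M H.
Proof.
have oM := open_slit.
exact: (class_C_along oM (fun z (Mz : M z) => proj1 Mz) (smoothw k.+1)
  (@class_C_fst k M oM) (@class_C_snd k M oM)).
Qed.

Lemma class_C_rc k : class_C k M c.
Proof.
have oM := open_slit; apply: class_CM => //.
  by apply: class_C_dotr => //; [exact: class_C_rhess|exact: class_C_snd].
apply: class_CV => //; first by move=> z _; exact: rmu_neq0.
apply: class_CD => //; first exact: class_C_cst.
by apply: class_C_dotr => //; exact: class_C_w1.
Qed.

Lemma class_C_rspray k : class_C k M G2.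
Proof.
have oM := open_slit; apply: class_CD => //.
  by apply: class_CZ => //; [exact: class_C_rc|exact: class_C_w1].
apply: (class_C_eq oM (g := fun z => (-1 * (c z / F z)) *: z.2)).
  by move=> z _; rewrite mulN1r scaleNr.
apply: class_CZ => //; last exact: class_C_snd.
apply: class_CM => //; first exact: class_C_cst.
apply: class_CM => //; first exact: class_C_rc.
apply: class_CV => //; first by move=> z /rfinsler_gt0 /lt0r_neq0.
exact: class_C_rfinsler.
Qed.

Lemma differentiable_w x : U x -> differentiable w x.
Proof. exact: (smoothw 1).1. Qed.

Lemma has_derive_w1 xi z : M z ->
  has_derive (fun z => w z.1) xi z ('D_(xi.1) w z.1).
Proof.
move=> [Uz _]; apply: (has_derive_comp (has_derive_fst xi z)).
exact: differentiable_w.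
Qed.

Lemma has_derive_beta xi z : M z ->
  has_derive beta xi z (dotr (H z) xi.1 + dotr (w z.1) xi.2).
Proof.
move=> Mz; apply: has_derive_eq.
  exact: (has_derive_dotr (has_derive_w1 xi Mz) (has_derive_snd xi z)).
by congr (_ + _); rewrite w_sym //; case: Mz.
Qed.

Lemma has_derive_rnorm xi z : M z ->
  has_derive A xi z ((l0 * dotr z.2 xi.2 +
    beta z * (dotr (H z) xi.1 + dotr (w z.1) xi.2)) / A z).
Proof.
move=> Mz; have b := has_derive_beta xi Mz; have s := has_derive_snd xi z.
apply: has_derive_eq.
  apply: has_derive_sqrt; first by apply: rform_gt0; case: Mz.
  apply: has_deriveD; last exact: (has_deriveM b b).
  by apply: has_deriveM (has_derive_dotr s s); exact: has_derive_cst.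
rewrite -/(A z) /= (dotrC xi.2).
have := rnorm_gt0 Mz; rewrite -/(beta z).
move: (A z) (dotr z.2 xi.2) (dotr (H z) xi.1) (dotr (w z.1) xi.2) (beta z).
by move=> a p q r d a0; field; rewrite gt_eqF.
Qed.

Lemma has_derive_rfinsler xi z : M z ->
  has_derive F xi z (((l0 * dotr z.2 xi.2 +
    beta z * (dotr (H z) xi.1 + dotr (w z.1) xi.2)) / A z
    - (dotr (H z) xi.1 + dotr (w z.1) xi.2)) / l0).
Proof.
move=> Mz; apply: has_derive_eq.
  apply: has_deriveM (has_derive_cst _ _ _).
  by apply: has_deriveB; [exact: has_derive_rnorm|exact: has_derive_beta].
by rewrite mulr0 addr0.
Qed.

Lemma derive_renergy xi z : M z -> 'D_xi L z = 2 * (F z * 'D_xi F z).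
Proof.
move=> Mz; have [dF _] := has_derive_rfinsler xi Mz.
rewrite derive_mul //; ring.
Qed.

Lemma euler_rfinsler z : M z -> 'D_(0, z.2) F z = F z.
Proof.
move=> Mz; have [_ ->] := has_derive_rfinsler (0, z.2) Mz.
rewrite /= dotr0r add0r -/(beta z) -rnorm_sqr //.
by rewrite /F mulfK ?gt_eqF ?rnorm_gt0.
Qed.

Lemma euler_renergy z : M z -> 'D_(0, z.2) L z = 2 * L z.
Proof. by move=> Mz; rewrite derive_renergy // euler_rfinsler. Qed.

Definition rfd (Z : E) (z : E * E) : R :=
  ((l0 * dotr z.2 Z + beta z * dotr (w z.1) Z) / A z - dotr (w z.1) Z) / l0.

Lemma derive_vert_rfinsler Z z : M z -> 'D_(0, Z) F z = rfd Z z.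
Proof.
move=> Mz; have [_ ->] := has_derive_rfinsler (0, Z) Mz.
by rewrite /= dotr0r add0r.
Qed.

Lemma derive_hor_rfinsler X z : M z -> 'D_(X, 0) F z = - (F z / A z) * dotr (H z) X.
Proof.
move=> Mz; have [_ ->] := has_derive_rfinsler (X, 0) Mz.
have A0 := rnorm_gt0 Mz; have l1 := l0_neq0.
rewrite /= !dotr0r mulr0 add0r addr0 /F.
by move: (A z) (beta z) (dotr _ _) A0 => a b h a0; field; rewrite l1 gt_eqF.
Qed.

Lemma rell_eq Z z : M z -> vert_derivative L Z z = F z * rfd Z z.
Proof.
move=> Mz; rewrite /vert_derivative derive_renergy // derive_vert_rfinsler //.
by rewrite mulKf ?pnatr_eq0.
Qed.

Definition drnorm (xi z : E * E) : R :=
  (l0 * dotr z.2 xi.2 + beta z * (dotr (H z) xi.1 + dotr (w z.1) xi.2)) / A z.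

Definition drfinsler (xi z : E * E) : R :=
  (drnorm xi z - (dotr (H z) xi.1 + dotr (w z.1) xi.2)) / l0.

Definition drfd (Z : E) (xi z : E * E) : R :=
  ((l0 * dotr xi.2 Z + (dotr (H z) xi.1 + dotr (w z.1) xi.2) * dotr (w z.1) Z
      + beta z * dotr ('D_(xi.1) w z.1) Z) / A z
   - (l0 * dotr z.2 Z + beta z * dotr (w z.1) Z) * drnorm xi z / A z ^+ 2
   - dotr ('D_(xi.1) w z.1) Z) / l0.

Lemma has_derive_rfd Z xi z : M z -> has_derive (rfd Z) xi z (drfd Z xi z).
Proof.
move=> Mz; have A0 : A z != 0 by rewrite gt_eqF ?rnorm_gt0.
have dw := has_derive_dotr_cst Z (has_derive_w1 xi Mz).
have db := has_derive_beta xi Mz.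
have dy := has_derive_dotr_cst Z (has_derive_snd xi z).
have dA := has_derive_rnorm xi Mz.
have dl := has_derive_cst l0 xi z.
have d1 := has_deriveD (has_deriveM dl dy) (has_deriveM db dw).
have d2 := has_deriveM d1 (has_deriveV A0 dA).
have d3 := has_deriveM (has_deriveB d2 dw) (has_derive_cst l0^-1 xi z).
apply: (has_derive_eq d3); rewrite /drfd /drnorm; have l1 := l0_neq0.
move: A0; clear -l1.
move: (A z) (dotr z.2 Z) (dotr xi.2 Z) (dotr (H z) xi.1) (dotr (w z.1) xi.2)
  (dotr (w z.1) Z) (beta z) (dotr ('D_xi.1 w z.1) Z) (dotr z.2 xi.2).
by move=> a p q r s t u v x a0; field; rewrite l1 a0.
Qed.

Lemma derive_rell Z xi z : M z ->
  'D_xi (vert_derivative L Z) z = drfinsler xi z * rfd Z z + F z * drfd Z xi z.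
Proof.
move=> Mz; have dF : has_derive F xi z (drfinsler xi z) by exact: has_derive_rfinsler.
have [_ <-] := has_deriveM dF (has_derive_rfd Z xi Mz).
apply: near_eq_derive; apply: (near_open open_slit Mz) => z' Mz'; exact: rell_eq.
Qed.

Lemma rspray_spray z Z : M z ->
  'D_(0, G2 z) (vert_derivative L Z) z =
  'D_(z.2, 0) (vert_derivative L Z) z - 2^-1 * 'D_(Z, 0) L z.
Proof.
move=> Mz; have A0 := rnorm_gt0 Mz; have l1 := l0_neq0.
have Ab : A z - beta z != 0 by rewrite gt_eqF // subr_gt0 rbeta_lt.
(* Eliminating [|y|^2] and [Hess f (y, y)] in favour of [A], [beta] and [c] leaves a rational
   identity in independent variables. *)
have yy : dotr z.2 z.2 = (A z * A z - beta z * beta z) / l0.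
  by rewrite rnorm_sqr // addrK mulrC mulKf.
have hy : dotr (H z) z.2 = c z * (l0 + dotr (w z.1) (w z.1)).
  by rewrite divfK // rmu_neq0.
rewrite !derive_rell // derive_renergy // derive_hor_rfinsler //.
rewrite mulKf ?pnatr_eq0 //.
rewrite /drfinsler /drfd /drnorm /= derive0 !dotr0l !dotr0r !add0r !mulr0 !add0r !addr0 subr0.
rewrite /rfd /rspray !(dotrDr, dotrDl, dotrNr, dotrNl, dotrZr, dotrZl) (dotrC z.2 (w _)) -/(beta z).
rewrite -/(H z) hy yy /rfinsler; clear yy hy Mz.
move: (dotr (w z.1) (w z.1)) (dotr (w z.1) Z) (dotr z.2 Z) (dotr (H z) Z) (c z) (A z) (beta z) A0 Ab.
move=> p q r s t a b /lt0r_neq0 a0 ab.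
field.
by rewrite a0 l1 ab.
Qed.

(** Strict Cauchy-Schwarz inequality: the difference is [rform x y y] times the squared norm of the
    component of [u] orthogonal to [y]. *)
Lemma rform_cauchy x y u : y != 0 -> (forall k, u <> k *: y) ->
  0 < rform x u u * rform x y y - rform x y u ^+ 2.
Proof.
move=> y0 uy; have a0 := rform_gt0 x y0.
pose k := rform x y u / rform x y y.
have uk : u - k *: y != 0 by rewrite subr_eq0; apply/eqP; exact: uy.
have := mulr_gt0 a0 (rform_gt0 x uk).
suff -> : rform x y y * rform x (u - k *: y) (u - k *: y) =
    rform x u u * rform x y y - rform x y u ^+ 2 by [].
have e : rform x (u - k *: y) (u - k *: y) =
    rform x u u - 2 * k * rform x y u + k ^+ 2 * rform x y y.
  rewrite /rform !(dotrDl, dotrDr, dotrNl, dotrNr, dotrZl, dotrZr) (dotrC u y).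
  ring.
by rewrite e /k; field; rewrite gt_eqF.
Qed.

(** This is [dF(u)^2 + F d^2F(u, u)], with the second derivative of [F] written as a Gram
    determinant of [rform]. Convexity and the denominator of the flag curvature are both read off
    this form. *)
Lemma rhessian_diag z u : M z -> vert_hessian L u u z =
  rfd u z ^+ 2 + F z * ((rform z.1 u u * rform z.1 z.2 z.2 -
                         rform z.1 z.2 u ^+ 2) / (A z ^+ 3 * l0)).
Proof.
move=> Mz; rewrite (gE class_C_renergy) // derive_rell //.
have A0 := lt0r_neq0 (rnorm_gt0 Mz); have l1 := l0_neq0.
have -> : drfinsler (0, u) z = rfd u z.
  by rewrite /drfinsler /drnorm /= dotr0r add0r.
have -> : rform z.1 z.2 z.2 = A z * A z by rewrite rnorm_sqr.
rewrite /drfd /drnorm /= derive0 dotr0l dotr0r mulr0 addr0 subr0 add0r /rform -/(beta z).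
rewrite expr2; congr (_ + _ * _).
move: (dotr u u) (dotr z.2 u) (dotr (w z.1) u) (beta z) (A z) A0 => p q r b a a0.
by field; rewrite a0 l1.
Qed.

Lemma rfdZ k z : M z -> rfd (k *: z.2) z = k * F z.
Proof.
move=> Mz; rewrite -[F z]euler_rfinsler // derive_vert_rfinsler //.
by rewrite /rfd !dotrZr; ring.
Qed.

(** On the line of [y] the Gram determinant vanishes but [dF] does not; off that line the
    determinant is positive. *)
Lemma rhessian_gt0 z u : M z -> u != 0 -> 0 < vert_hessian L u u z.
Proof.
move=> Mz u0; have F0 := rfinsler_gt0 Mz; rewrite rhessian_diag //.
have D0 : 0 < A z ^+ 3 * l0 by rewrite mulr_gt0 // exprn_gt0 // rnorm_gt0.
have [[k uk]|uk] := pselect (exists k, u = k *: z.2).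
  have -> : rform z.1 u u * rform z.1 z.2 z.2 - rform z.1 z.2 u ^+ 2 = 0.
    by rewrite uk /rform !(dotrZl, dotrZr); ring.
  rewrite mul0r mulr0 addr0.
  have k0 : k != 0 by apply: contra_neq u0 => k0; rewrite uk k0 scale0r.
  by rewrite uk rfdZ // exprn_even_gt0 //= mulf_neq0 // gt_eqF.
rewrite ltr_pwDr ?sqr_ge0 // mulr_gt0 // divr_gt0 // rform_cauchy //.
  by case: Mz.
by move=> k e; apply: uk; exists k.
Qed.

Lemma rhessian_nondeg z u : M z -> (forall Z, vert_hessian L u Z z = 0) -> u = 0.
Proof.
move=> Mz gu; apply/eqP; apply: contraT => u0.
by have := rhessian_gt0 Mz u0; rewrite gu ltxx.
Qed.

Lemma rflag_denominator z u : M z -> (forall k, u <> k *: z.2) ->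
  0 < L z * vert_hessian L u u z - vert_derivative L u z ^+ 2.
Proof.
move=> Mz uy; have F0 := rfinsler_gt0 Mz.
have D0 : 0 < A z ^+ 3 * l0 by rewrite mulr_gt0 // exprn_gt0 // rnorm_gt0.
rewrite rhessian_diag // rell_eq //.
have := rform_cauchy z.1 (proj2 Mz) uy; set t := (X in 0 < X) => t0.
suff -> : L z * (rfd u z ^+ 2 + F z * (t / (A z ^+ 3 * l0))) - (F z * rfd u z) ^+ 2 =
    F z ^+ 3 * (t / (A z ^+ 3 * l0)).
  by rewrite mulr_gt0 ?divr_gt0 // exprn_gt0.
by rewrite /renergy; ring.
Qed.

(** The projective factor: the spray is [rc w - rratio y]. *)
Definition rratio (z : E * E) : R := c z / F z.
Local Notation r := rratio.

Lemma class_C_rratio k : class_C k M r.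
Proof.
have oM := open_slit; apply: class_CM => //; first exact: class_C_rc.
apply: class_CV => //; first by move=> z /rfinsler_gt0 /lt0r_neq0.
exact: class_C_rfinsler.
Qed.

Lemma has_derive_rhess xi z : M z ->
  has_derive H xi z ('D_(xi.2) w z.1 + 'D_(xi.1) ('D_(z.2) w) z.1).
Proof.
move=> Mz; exact: (has_derive_along openU (proj1 Mz) (smoothw 2)
  (has_derive_fst xi z) (has_derive_snd xi z)).
Qed.

Lemma has_derive_rmu xi z : M z ->
  has_derive (fun z => mu z.1) xi z (2 * dotr ('D_(xi.1) w z.1) (w z.1)).
Proof.
move=> Mz; have dw := has_derive_w1 xi Mz.
apply: has_derive_eq (has_deriveD (has_derive_cst l0 xi z) (has_derive_dotr dw dw)) _.
by rewrite (dotrC (w z.1)) add0r; ring.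
Qed.

Lemma derive_vert_rc X z : M z -> has_derive c (0, X) z (2 * (dotr (H z) X / mu z.1)).
Proof.
move=> Mz; have dh := has_derive_rhess (0, X) Mz.
have ds := has_derive_snd (0, X) z; have m0 := rmu_neq0 z.1.
have dm := has_deriveV (f := fun z => mu z.1) m0 (has_derive_rmu (0, X) Mz).
apply: has_derive_eq (has_deriveM (has_derive_dotr dh ds) dm) _.
rewrite /= !derive0 addr0 dotr0l mulr0 oppr0 mul0r mulr0 addr0 w_sym; last exact: (proj1 Mz).
by rewrite -/(H z); ring.
Qed.

Lemma euler_rratio z : M z -> 'D_(0, z.2) r z = r z.
Proof.
move=> Mz; have F0 := lt0r_neq0 (rfinsler_gt0 Mz).
have dF := differentiable_has_derive (0, z.2) (class_C_differentiable (class_C_rfinsler 1) Mz).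
have [_ ->] := has_deriveM (derive_vert_rc z.2 Mz) (has_deriveV F0 dF).
rewrite euler_rfinsler // -/(c z) /rratio.
by move: (c z) (F z) F0 => a b b0; field.
Qed.

Definition rN (X : E) (z : E * E) : E :=
  (dotr (H z) X / mu z.1) *: w z.1 - 2^-1 *: ('D_(0, X) r z *: z.2 + r z *: X).

Lemma nonlinear_connection_rspray X z : M z -> nonlinear_connection G2 X z = rN X z.
Proof.
move=> Mz; have dw := has_derive_w1 (0, X) Mz.
have ds := has_derive_snd (0, X) z.
have dr := differentiable_has_derive (0, X) (class_C_differentiable (class_C_rratio 1) Mz).
have dc := derive_vert_rc X Mz.
have [_ e] := has_deriveB (has_deriveZ dc dw) (has_deriveZ dr ds).
rewrite /nonlinear_connection [X in _ *: X]e /= derive0 scaler0 addr0.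
by rewrite scalerBr scalerA mulKf ?pnatr_eq0.
Qed.

Lemma has_derive_rN X xi z : M z -> has_derive (rN X) xi z
  (((dotr ('D_(xi.2) w z.1 + 'D_(xi.1) ('D_(z.2) w) z.1) X / mu z.1
     - dotr (H z) X * (2 * dotr ('D_(xi.1) w z.1) (w z.1)) / mu z.1 ^+ 2) *: w z.1
    + (dotr (H z) X / mu z.1) *: 'D_(xi.1) w z.1)
   - 2^-1 *: ('D_xi ('D_(0, X) r) z *: z.2 + 'D_(0, X) r z *: xi.2 + 'D_xi r z *: X)).
Proof.
move=> Mz; have dw := has_derive_w1 xi Mz.
have dh := has_derive_dotr_cst X (has_derive_rhess xi Mz).
have dm := has_deriveV (f := fun z => mu z.1) (rmu_neq0 z.1) (has_derive_rmu xi Mz).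
have ds := has_derive_snd xi z.
have dr := differentiable_has_derive xi (class_C_differentiable (class_C_rratio 1) Mz).
have dr1 : has_derive ('D_(0, X) r) xi z ('D_xi ('D_(0, X) r) z).
  by apply: differentiable_has_derive; apply: ((class_C_rratio 2).2 _).1.
have d1 := has_deriveZ (has_deriveM dh dm) dw.
have d2 := has_deriveD (has_deriveZ dr1 ds) (has_deriveZ dr (has_derive_cst X xi z)).
have d3 := has_deriveZ (has_derive_cst (2^-1 : R) xi z) d2.
apply: has_derive_eq (has_deriveB d1 d3) _.
by rewrite scale0r scaler0 add0r addr0 mulNr mulrN mulrA.
Qed.

(** [w] is locally a gradient, so this is the symmetry of the third derivatives of its potential,
    obtained by differentiating [w_sym]. *)
Lemma third_derivative_sym x u v : U x ->
  dotr ('D_v ('D_v w) x) u = dotr ('D_u ('D_v w) x) v.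
Proof.
move=> Ux; have dD a : differentiable ('D_a w) x by exact: ((smoothw 2).2 a).1.
have -> : 'D_u ('D_v w) x = 'D_v ('D_u w) x.
  by apply: (derive_comm _ _ openU Ux); exact: smoothw.
have [_ e1] := has_derive_dotr_cst u (differentiable_has_derive v (dD v)).
have [_ e2] := has_derive_dotr_cst v (differentiable_has_derive v (dD u)).
apply: (etrans (esym e1)); apply: etrans e2.
by apply: near_eq_derive; apply: (near_open openU Ux) => y Uy; exact: w_sym.
Qed.

Lemma w_rank1_diag x u v T : U x ->
  dotr ('D_v w x) u * dotr ('D_v w x) T = dotr ('D_v w x) v * dotr ('D_u w x) T.
Proof.
move=> Ux; apply: etrans (w_rank1 u v v T Ux).
exact: (congr1 (fun a => a * _) (w_sym v u Ux)).
Qed.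

(** The curvature computation after pairing with a test vector [Z], as an identity of real numbers.
    Here [a] and [b] stand for [Hess f (y, u)] and [Hess f (y, y)]; [p] and [q] are the Hessian on
    [(y, w)] and [(u, w)], and [hZ] and [kZ] on [(y, Z)] and [(u, Z)]. *)
Lemma rcurvature_arith
  (D1 D2 wZ vZ uZ hZ kZ a a' b p q t t' m r0 rho drho dr sig dsig dr' dW dW' nv nu : R) :
  m != 0 -> a * p = b * q -> a * hZ = b * kZ -> sig = r0 -> a' = a -> t = t' ->
  D1 = ((dW + t) / m - a * (2 * p) / m ^+ 2) * wZ + a / m * hZ
       - 2^-1 * (drho * vZ + rho * nv + dr * uZ) ->
  D2 = ((dW' + t') / m - b * (2 * q) / m ^+ 2) * wZ + b / m * kZ
       - 2^-1 * (dsig * vZ + sig * nu + dr' * vZ) ->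
  dW = - (b / m * q - 2^-1 * (sig * a + r0 * a)) ->
  dW' = - (a / m * p - 2^-1 * (rho * b + r0 * a')) ->
  nv = - (b / m * wZ - 2^-1 * (sig * vZ + r0 * vZ)) ->
  nu = - (a / m * wZ - 2^-1 * (rho * vZ + r0 * uZ)) ->
  D1 - D2 = (r0 ^+ 2 / 4 - dr / 2) * uZ
    + (- (drho / 2) - r0 * rho / 4 + dsig / 2 + dr' / 2) * vZ.
Proof.
move=> m0 e1 e2 -> -> -> -> -> -> -> -> ->.
(* The identity holds only modulo the two rank-one relations; these are the multiples of them that
   have to be added. *)
have e1' : (b * q - a * p) * (wZ / m ^+ 2) = 0 by rewrite e1 subrr mul0r.
have e2' : (a * hZ - b * kZ) * m^-1 = 0 by rewrite e2 subrr mul0r.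
rewrite -[RHS]addr0 -e1' -[RHS]addr0 -e2'; clear -m0.
by field.
Qed.

Lemma dotr_derive_rN X a b z Z : M z ->
  dotr ('D_(a, b) (rN X) z) Z =
  ((dotr ('D_b w z.1) X + dotr ('D_a ('D_(z.2) w) z.1) X) / mu z.1
    - dotr (H z) X * (2 * dotr ('D_a w z.1) (w z.1)) / mu z.1 ^+ 2) * dotr (w z.1) Z
  + dotr (H z) X / mu z.1 * dotr ('D_a w z.1) Z
  - 2^-1 * ('D_(a, b) ('D_(0, X) r) z * dotr z.2 Z + 'D_(0, X) r z * dotr b Z
            + 'D_(a, b) r z * dotr X Z).
Proof.
move=> Mz; have [_ e] := has_derive_rN X (a, b) Mz.
apply: (etrans (congr1 (fun v => dotr v Z) e)).
by rewrite !(dotrDl, dotrNl, dotrZl).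
Qed.

Lemma dotr_rN X z Z : dotr (rN X z) Z = dotr (H z) X / mu z.1 * dotr (w z.1) Z
  - 2^-1 * ('D_(0, X) r z * dotr z.2 Z + r z * dotr X Z).
Proof. by rewrite !(dotrDl, dotrNl, dotrZl). Qed.

Lemma derive_w_rN X z Y : M z ->
  dotr ('D_(- rN X z) w z.1) Y =
  - (dotr (H z) X / mu z.1 * dotr ('D_Y w z.1) (w z.1)
     - 2^-1 * ('D_(0, X) r z * dotr (H z) Y + r z * dotr ('D_X w z.1) Y)).
Proof.
move=> Mz; have Uz := proj1 Mz.
apply: (etrans (w_sym _ _ Uz)); apply: (etrans (dotrC _ _)).
apply: (etrans (dotrNl _ _)); apply: (etrans (congr1 (fun c => - c) (dotr_rN X z _))).
have e1 : dotr z.2 ('D_Y w z.1) = dotr (H z) Y.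
  exact: etrans (dotrC _ _) (w_sym Y z.2 Uz).
have e2 : dotr X ('D_Y w z.1) = dotr ('D_X w z.1) Y.
  exact: etrans (dotrC _ _) (w_sym Y X Uz).
have f (p q q' s t t' v v' : R) : q = q' -> t = t' -> v = v' ->
    - (p * q - 2^-1 * (s * t + r z * v)) = - (p * q' - 2^-1 * (s * t' + r z * v')).
  by move=> -> -> ->.
exact: f (dotrC _ _) e1 e2.
Qed.

(** The terms along [w] and along the Hessian assemble into 2x2 minors of the Hessian, which vanish
    by rank one. What is left comes from the projective factor alone. *)
Lemma nonlinear_curvature_rspray u z : M z ->
  exists tau, nonlinear_curvature G2 z.2 u z =
    (r z ^+ 2 / 4 - 'D_(horizontal_lift G2 z.2 z) r z / 2) *: u + tau *: z.2.
Proof.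
move=> Mz; have Uz := proj1 Mz.
pose xi : E * E := horizontal_lift G2 z.2 z; pose eta : E * E := horizontal_lift G2 u z.
exists (- ('D_xi ('D_(0, u) r) z / 2) - r z * 'D_(0, u) r z / 4 +
  'D_eta ('D_(0, z.2) r) z / 2 + 'D_eta r z / 2).
have eN X zeta : 'D_zeta (nonlinear_connection G2 X) z = 'D_zeta (rN X) z.
  apply: near_eq_derive; apply: (near_open open_slit Mz) => z' Mz'.
  exact: nonlinear_connection_rspray.
have exi : xi = (z.2, - rN z.2 z).
  by rewrite -(nonlinear_connection_rspray z.2 Mz).
have eeta : eta = (u, - rN u z).
  by rewrite -(nonlinear_connection_rspray u Mz).
apply: dotr_inj => Z.
have D1 := dotr_derive_rN u z.2 (- rN z.2 z) Z Mz; rewrite -exi in D1.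
have D2 := dotr_derive_rN z.2 u (- rN u z) Z Mz; rewrite -eeta in D2.
have nv := etrans (dotrNl _ _) (congr1 (fun c => - c) (dotr_rN z.2 z Z)).
have nu := etrans (dotrNl _ _) (congr1 (fun c => - c) (dotr_rN u z Z)).
have e1 := w_rank1_diag u z.2 (w z.1) Uz.
have e2 := w_rank1_diag u z.2 Z Uz.
have e := rcurvature_arith (rmu_neq0 z.1) e1 e2 (euler_rratio Mz) (w_sym u z.2 Uz)
  (third_derivative_sym u z.2 Uz) D1 D2
  (derive_w_rN z.2 u Mz) (derive_w_rN u z.2 Mz) nv nu.
have lin (v v' : E) : dotr (v - v') Z = dotr v Z - dotr v' Z by rewrite dotrDl dotrNl.
apply: (etrans (congr1 (fun v => dotr v Z) (congr2 (fun a b => a - b) (eN u xi) (eN z.2 eta)))).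
apply: (etrans (lin _ _)); apply: (etrans e).
by apply: esym; apply: (etrans (dotrDl _ _ _)); rewrite !dotrZl.
Qed.

Theorem rflag_curvature (Gam : E * E -> E -> E -> E) z :
  (forall z X Y, M z -> Gam z X Y = Gam z Y X) ->
  (forall z X Y, M z -> differentiable (fun z => Gam z X Y) z) ->
  (forall z X Y Z, M z ->
    'D_(X, 0) (vert_hessian L Y Z) z =
    vert_hessian L (Gam z X Y) Z z + vert_hessian L Y (Gam z X Z) z +
    'D_(0, Z) (vert_hessian L (Gam z X z.2) Y) z) ->
  M z ->
  exists kappa, forall u, (forall k, u <> k *: z.2) ->
    vert_derivative L (curvature Gam G2 z.2 u u z) z /
    (L z * vert_hessian L u u z - vert_derivative L u z ^+ 2) = kappa.
Proof.
move=> Gsym Gdiff Gmet Mz.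
have oM := open_slit; have sL := class_C_renergy.
pose Xi := r z ^+ 2 / 4 - 'D_(horizontal_lift G2 z.2 z) r z / 2.
exists (- Xi / L z) => u uy.
have [tau curv] := nonlinear_curvature_rspray u Mz; rewrite -/Xi in curv.
have e1 := ell_curvature oM sL euler_renergy Gsym Gdiff Gmet rhessian_nondeg
  class_C_rspray rspray_spray z.2 u u Mz.
have e2 := ell_nonlinear_curvature oM sL euler_renergy Gsym Gmet rhessian_nondeg
  class_C_rspray rspray_spray z.2 u Mz.
have D0 := lt0r_neq0 (rflag_denominator Mz uy).
have L0 : L z != 0 by rewrite mulf_neq0 // gt_eqF // rfinsler_gt0.
have g1 := etrans (gPl oM sL Xi u (tau *: z.2) u Mz)
  (congr1 (fun a => _ + a) (gZl oM sL tau z.2 u Mz)).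
have g2 := g_eulerl oM sL euler_renergy u Mz.
have l1 := etrans (ellP sL Xi u (tau *: z.2) Mz)
  (congr1 (fun a => _ + a) (ellZ sL tau z.2 Mz)).
have l2 := ell_euler euler_renergy Mz.
have arith (k num guu gvu lu Lz t x y lv : R) : Lz != 0 -> Lz * guu - lu ^+ 2 != 0 ->
    num = - x -> y = 0 -> x = k * guu + t * gvu -> gvu = lu ->
    y = k * lu + t * lv -> lv = Lz ->
    num / (Lz * guu - lu ^+ 2) = - k / Lz.
  move=> Lz0 d0 -> y0 -> -> e lvE; move: e; rewrite y0 lvE => e.
  (* The form [ell] annihilates the nonlinear curvature, which fixes the coefficient of [y]; the
     numerator then becomes [- Xi / L] times the denominator. *)
  have -> : t = - k * lu / Lz.
    by apply: (mulIf Lz0); rewrite mulfVK // mulNr; apply/eqP; rewrite -addr_eq0 addrC -e.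
  by field; rewrite Lz0 d0.
rewrite curv in e1 e2.
exact: arith L0 D0 e1 e2 g1 g2 l1 l2.
Qed.

End FlatRanders.

(** * The ambient scalar product and orthogonal families *)

Section ScalarProduct.
Context {R : realType} {V : finNormedModType R} (h : {dot V for idfun}).

(** A plain function in place of the sesquilinear form, so that it can carry the structure of a real
    bilinear map and enter the calculus above. *)
Definition hdot (u v : V) : R := h u v.

Lemma hdotC u v : hdot u v = hdot v u.
Proof. by rewrite /hdot hermC /= expr0 mul1r. Qed.

Lemma hdotPl a u v w : hdot (a *: u + v) w = a * hdot u w + hdot v w.
Proof. by rewrite /hdot linearPl. Qed.

Lemma hdotPr a u v w : hdot w (a *: u + v) = a * hdot w u + hdot w v.
Proof. by rewrite !(hdotC w) hdotPl. Qed.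

Lemma hdot_is_bilinear : bilinear_for
    (GRing.Scale.Law.clone _ _ *:%R _) (GRing.Scale.Law.clone _ _ *:%R _) hdot.
Proof. by split=> [v|u] a x y; [exact: hdotPl|exact: hdotPr]. Qed.
HB.instance Definition _ := bilinear_isBilinear.Build R _ _ _ _ _ hdot hdot_is_bilinear.

Lemma hdot0l u : hdot 0 u = 0. Proof. exact: linear0l. Qed.

Lemma hdot0r u : hdot u 0 = 0. Proof. exact: linear0r. Qed.

Lemma hdotDl u v u' : hdot (u + v) u' = hdot u u' + hdot v u'.
Proof. exact: linearDl. Qed.

Lemma hdotZl c u v : hdot (c *: u) v = c * hdot u v.
Proof. exact: linearZl_LR. Qed.

Lemma hdotNl u v : hdot (- u) v = - hdot u v.
Proof. exact: linearNl. Qed.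

Lemma hdotDr u v u' : hdot u' (u + v) = hdot u' u + hdot u' v.
Proof. exact: linearDr. Qed.

Lemma hdotZr c u v : hdot v (c *: u) = c * hdot v u.
Proof. exact: linearZr_LR. Qed.

Lemma hdotNr u v : hdot u (- v) = - hdot u v.
Proof. exact: linearNr. Qed.

Lemma hdot_sumr m u (f : 'I_m -> V) : hdot u (\sum_i f i) = \sum_i hdot u (f i).
Proof. exact: linear_sumr. Qed.

Lemma hdot_gt0 u : u != 0 -> 0 < hdot u u.
Proof. exact: neq0_dnorm_gt0. Qed.

Lemma hdot_eq0 u : hdot u u = 0 -> u = 0.
Proof. by move=> uu; apply/eqP/negPn/negP => /hdot_gt0; rewrite uu ltxx. Qed.

Lemma hdot_ge0 u : 0 <= hdot u u.
Proof. by have [->|/hdot_gt0/ltW//] := eqVneq u 0; rewrite hdot0l. Qed.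

End ScalarProduct.

Section OrthogonalFamilies.
Context {R : realType} {V : finNormedModType R} (h : {dot V for idfun}).

Lemma orthogonal_free (s : seq V) :
  pairwise (fun u v => hdot h u v == 0) s -> 0 \notin s -> free s.
Proof.
elim: s => [|x s IH] /=; first by rewrite nil_free.
move=> /andP[xs ps]; rewrite inE negb_or eq_sym => /andP[x0 s0].
rewrite free_cons IH // andbT; apply: contra x0 => /(@coord_span _ _ _ (in_tuple s)) xE.
apply/eqP/(@hdot_eq0 _ _ h); rewrite {2}xE hdot_sumr big1 // => i _.
rewrite hdotZr; move: xs => /allP /(_ ((in_tuple s)`_i)).
by rewrite mem_nth // => /(_ isT) /eqP ->; rewrite mulr0.
Qed.

Lemma orthogonal_size (s : seq V) :
  pairwise (fun u v => hdot h u v == 0) s -> 0 \notin s -> (size s <= \dim {: V})%N.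
Proof.
move=> ps s0; have /eqP <- : \dim (span s) == size s by exact: orthogonal_free.
exact: dimvS (subvf _).
Qed.

End OrthogonalFamilies.

(** * Linear maps depending on a parameter *)

Section LinearFamilies.
Context {R : realType} {n : nat}.
Local Notation E := 'rV[R]_n.
Local Notation e := (delta_mx ord0).
Implicit Types (D G : normedModType R).

Lemma dotr_basis (u : E) i : dotr u (e i) = u ord0 i.
Proof.
rewrite /dotr (bigD1 i) //= big1 ?addr0 => [|k /negPf ki].
  by rewrite mxE !eqxx mulr1.
by rewrite mxE eqxx ki mulr0.
Qed.

Lemma row_sum_dotr (u : E) : u = \sum_i dotr u (e i) *: e i.
Proof. by rewrite [LHS]row_sum_delta; apply: eq_bigr => i _; rewrite dotr_basis. Qed.

Lemma linear_row_sum G (l : E -> G) : linear l -> forall u,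
  l u = \sum_i dotr u (e i) *: l (e i).
Proof.
move=> ll u; pose lL := GRing.isLinear.Build _ _ _ _ l ll.
pose l' : {linear E -> G} := HB.pack l lL.
rewrite {1}[u]row_sum_dotr -[LHS]/(l' _) linear_sum; apply: eq_bigr => i _.
by rewrite linearZ.
Qed.

Lemma has_derive_sum D G m (f : 'I_m -> D -> G) xi z (l : 'I_m -> G) :
  (forall i, has_derive (f i) xi z (l i)) ->
  has_derive (fun x => \sum_i f i x) xi z (\sum_i l i).
Proof.
elim: m f l => [|m IH] f l fl.
  rewrite big_ord0; under eq_fun do rewrite big_ord0; exact: has_derive_cst.
rewrite big_ord_recl; under eq_fun do rewrite big_ord_recl.
by apply: has_deriveD; [exact: fl|apply: IH => i; exact: fl].
Qed.

(** A product rule in which only the functions [A ^~ v] with fixed [v] are known to be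
    differentiable; expanding [b x] in the standard basis reduces to them. *)
Lemma has_derive_family D G (A : D -> E -> G) (b : D -> E) (P : set D) xi z b' a' :
  open P -> P z -> (forall x, P x -> linear (A x)) ->
  (forall v, differentiable (A ^~ v) z) ->
  has_derive b xi z b' -> has_derive (A ^~ (b z)) xi z a' ->
  has_derive (fun x => A x (b x)) xi z (a' + A z b').
Proof.
move=> oP Pz lA dA db [_ <-].
have sum (c : D -> E) x : P x -> A x (c x) = \sum_i dotr (c x) (e i) *: A x (e i).
  by move=> Px; apply: linear_row_sum; exact: lA.
have dAe i := differentiable_has_derive xi (dA (e i)).
have s1 : has_derive (fun x => A x (b z)) xi z
    (\sum_i dotr (b z) (e i) *: 'D_xi (A ^~ (e i)) z).
  apply: (near_has_derive oP Pz (sum (fun=> b z))); apply: has_derive_sum => i.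
  have := has_deriveZ (has_derive_cst (dotr (b z) (e i)) xi z) (dAe i).
  by rewrite scale0r add0r.
have s2 : has_derive (fun x => A x (b x)) xi z
    (\sum_i (dotr b' (e i) *: A z (e i) + dotr (b z) (e i) *: 'D_xi (A ^~ (e i)) z)).
  apply: (near_has_derive oP Pz (sum b)); apply: has_derive_sum => i.
  exact: has_deriveZ (has_derive_dotr_cst _ db) (dAe i).
apply: (has_derive_eq s2); rewrite s1.2 big_split /= addrC.
by rewrite -linear_row_sum //; exact: lA.
Qed.

Lemma class_C_family D G (A : D -> E -> G) (b : D -> E) (P : set D) k :
  open P -> (forall x, P x -> linear (A x)) ->
  (forall v, class_C k P (A ^~ v)) -> class_C k P b ->
  class_C k P (fun x => A x (b x)).
Proof.
move=> oP lA cA cb.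
apply: (class_C_eq oP (g := fun x => \sum_i dotr (b x) (e i) *: A x (e i))).
  by move=> x Px; apply: linear_row_sum; exact: lA.
apply: class_C_sum => // i; apply: class_CZ => //.
by apply: class_C_dotr => //; exact: class_C_cst.
Qed.

Lemma open_within_preimage D (G : topologicalType) (f : D -> G) (P : set D) (Q : set G) :
  open P -> (forall x, P x -> {for x, continuous f}) -> open Q ->
  open (P `&` f @^-1` Q).
Proof.
move=> oP cf oQ; rewrite openE => x [Px Qx]; apply: filterI.
  exact: open_nbhs_nbhs.
by apply: (cf x Px); exact: open_nbhs_nbhs.
Qed.

End LinearFamilies.

(** * Covariant derivatives with a reference field, and their curvature *)

Section CoordinateConnections.
Context {R : realType} {n : nat}.
Local Notation E := 'rV[R]_n.
Variables (U : set E) (Gam : E * E -> E -> E -> E).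
Local Notation M := (slit U).
Hypothesis openU : open U.
Hypothesis Gam_linear : forall z Y, M z -> linear (fun X => Gam z X Y).
Hypothesis Gam_sym : forall z X Y, M z -> Gam z X Y = Gam z Y X.
Hypothesis smooth_Gam : forall k X Y, class_C k M (fun z => Gam z X Y).

(* The coordinates of the covariant derivative of [c] along [b] with reference
   field [t]. *)
Definition covariant (t b c : E -> E) (x : E) : E :=
  'D_(b x) c x + Gam (x, t x) (b x) (c x).
Local Notation cov := covariant.

Lemma Gam_linear_r z X : M z -> linear (Gam z X).
Proof. by move=> Mz a u v; rewrite ![Gam z X _]Gam_sym // Gam_linear. Qed.

Lemma GamDl z X X' Y : M z -> Gam z (X + X') Y = Gam z X Y + Gam z X' Y.
Proof. by move=> Mz; have := Gam_linear Y Mz 1 X X'; rewrite !scale1r. Qed.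

Lemma GamBl z X X' Y : M z -> Gam z (X - X') Y = Gam z X Y - Gam z X' Y.
Proof.
by move=> Mz; have := Gam_linear Y Mz (-1) X' X; rewrite !scaleN1r => e; rewrite addrC e addrC.
Qed.

Lemma GamDr z X X' Y : M z -> Gam z Y (X + X') = Gam z Y X + Gam z Y X'.
Proof. by move=> Mz; rewrite !(Gam_sym Y) // GamDl. Qed.

Variables (P : set E) (t : E -> E).
Hypothesis openP : open P.
Hypothesis PU : P `<=` U.
Hypothesis smooth_t : forall k, class_C k P t.
Hypothesis t_neq0 : forall x, P x -> t x != 0.

Lemma slit_field x : P x -> M (x, t x).
Proof. by move=> Px; split; [exact: PU|exact: t_neq0]. Qed.

Lemma class_C_Gam_field k X Y : class_C k P (fun x => Gam (x, t x) X Y).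
Proof.
have cz : class_C k P (fun x : E => (x, t x)) by apply: class_C_pair => //; exact: class_C_id.
exact: (class_C_comp openP slit_field cz (smooth_Gam k X Y)).
Qed.

Lemma class_C_Gam_fields k (b c : E -> E) : class_C k P b -> class_C k P c ->
  class_C k P (fun x => Gam (x, t x) (b x) (c x)).
Proof.
move=> cb cc.
apply: (class_C_family (A := fun x => Gam (x, t x) (b x)) openP) => // [x Px|v].
  exact/Gam_linear_r/slit_field.
apply: (class_C_family (A := fun x X => Gam (x, t x) X v) openP) => // [x Px|X].
  exact/Gam_linear/slit_field.
exact: class_C_Gam_field.
Qed.

Lemma class_C_covariant (b c : E -> E) : (forall k, class_C k P b) ->
  (forall k, class_C k P c) -> forall k, class_C k P (cov t b c).
Proof.
move=> cb cc k; apply: class_CD => //; last exact: class_C_Gam_fields.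
exact: (class_C_along openP (fun _ => id) (cc k.+1) (@class_C_id _ _ k P) (cb k)).
Qed.

Lemma has_derive_Gam_fields (b c : E -> E) x v : P x ->
  differentiable b x -> differentiable c x ->
  has_derive (fun x => Gam (x, t x) (b x) (c x)) v x
    ('D_(v, 'D_v t x) (fun z => Gam z (b x) (c x)) (x, t x)
     + Gam (x, t x) ('D_v b x) (c x) + Gam (x, t x) (b x) ('D_v c x)).
Proof.
move=> Px db dc; have Mz := slit_field Px.
have dt : has_derive (fun x : E => (x, t x)) v x (v, 'D_v t x).
  have d2 : differentiable t x by exact: (smooth_t 1).1.
  split; first by apply: differentiable_pair => //; exact: differentiable_id.
  by rewrite (derive_pair (f := id)) ?derive_id //; exact: differentiable_id.
have dG X Y : has_derive (fun x => Gam (x, t x) X Y) v x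
    ('D_(v, 'D_v t x) (fun z => Gam z X Y) (x, t x)).
  by apply: (has_derive_comp dt); exact: (smooth_Gam 1 X Y).1.
have dGb Y : has_derive (fun x => Gam (x, t x) (b x) Y) v x
    ('D_(v, 'D_v t x) (fun z => Gam z (b x) Y) (x, t x) + Gam (x, t x) ('D_v b x) Y).
  apply: (has_derive_family (A := fun x X => Gam (x, t x) X Y) openP Px) => // [y Py|X].
    exact/Gam_linear/slit_field.
  exact: (dG _ _).1.
apply: (has_derive_family (A := fun x => Gam (x, t x) (b x)) openP Px) => // [y Py|Y].
  exact/Gam_linear_r/slit_field.
exact: (dGb _).1.
Qed.

Lemma has_derive_covariant (b c : E -> E) x v : P x ->
  class_C 2 P b -> class_C 2 P c ->
  has_derive (cov t b c) v x
    ('D_('D_v b x) c x + 'D_v ('D_(b x) c) x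
     + ('D_(v, 'D_v t x) (fun z => Gam z (b x) (c x)) (x, t x)
     + Gam (x, t x) ('D_v b x) (c x) + Gam (x, t x) (b x) ('D_v c x))).
Proof.
move=> Px cb cc; apply: has_deriveD.
  apply: (has_derive_along openP Px cc (has_derive_id v x)).
  exact: (differentiable_has_derive v (cb.1 x Px)).
by apply: has_derive_Gam_fields; [|exact: cb.1|exact: cc.1].
Qed.

Variable G2 : E * E -> E.
Hypothesis G2_Gam : forall z X, M z -> nonlinear_connection G2 X z = Gam z X z.2.

(** Along [a x] the point [(x, t x)] moves in the direction [(a x, 'D_(a x) t x)], which is the
    horizontal lift of [a x] plus the vertical vector [cov t a t x]. The vertical part produces the
    terms that the Chern curvature corrects by vertical derivatives. *)
Lemma covariant_covariant (a b c : E -> E) x : P x ->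
  (forall k, class_C k P b) -> (forall k, class_C k P c) ->
  let z := (x, t x) in
  cov t a (cov t b c) x =
  'D_('D_(a x) b x) c x + 'D_(a x) ('D_(b x) c) x
  + ('D_(horizontal_lift G2 (a x) z) (fun z => Gam z (b x) (c x)) z
     + 'D_(0, cov t a t x) (fun z => Gam z (b x) (c x)) z
     + Gam z ('D_(a x) b x) (c x) + Gam z (b x) ('D_(a x) c x))
  + (Gam z (a x) ('D_(b x) c x) + Gam z (a x) (Gam z (b x) (c x))).
Proof.
move=> Px cb cc z; have Mz : M z := slit_field Px.
have [_ e] := has_derive_covariant (a x) Px (cb 2) (cc 2).
apply: (congr2 +%R); last exact: GamDr.
apply: (etrans e); congr (_ + (_ + _ + _)).
have dG : differentiable (fun z => Gam z (b x) (c x)) z by exact: (smooth_Gam 1 _ _).1.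
have := derive_linear dG 1 (horizontal_lift G2 (a x) z) (0, cov t a t x).
rewrite !scale1r => <-; apply: (congr1 (fun v => 'D_v (fun z => Gam z (b x) (c x)) z)).
rewrite /horizontal_lift G2_Gam // /covariant.
by apply: injective_projections; rewrite /= ?addr0 // addrCA addNr addr0.
Qed.

(** Second derivatives of [c] commute, the bracket absorbs the derivatives of [a] and [b], and the
    vertical corrections absorb those of [t]; only the values of the fields at [x] remain. *)
Lemma curvature_covariant (a b c : E -> E) x : P x ->
  (forall k, class_C k P a) -> (forall k, class_C k P b) -> (forall k, class_C k P c) ->
  let z := (x, t x) in let B := 'D_(a x) b x - 'D_(b x) a x in
  cov t a (cov t b c) x - cov t b (cov t a c) x - ('D_B c x + Gam z B (c x))
  - 'D_(0, cov t a t x) (fun z => Gam z (b x) (c x)) z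
  + 'D_(0, cov t b t x) (fun z => Gam z (a x) (c x)) z =
  curvature Gam G2 (a x) (b x) (c x) z.
Proof.
have cancel (A1 A2 B1 B2 p1 q1 r1 s1 u1 v1 w1 y1 p2 q2 r2 s2 u2 y2 : E) :
    A1 = p1 + q1 + (r1 + s1 + u1 + v1) + (w1 + y1) ->
    A2 = p2 + q2 + (r2 + s2 + u2 + w1) + (v1 + y2) ->
    q2 = q1 -> B1 = p1 - p2 -> B2 = u1 - u2 ->
    A1 - A2 - (B1 + B2) - s1 + s2 = r1 + y1 - (r2 + y2).
  by move=> -> -> -> -> ->; apply/rowP => i; rewrite !mxE; ring.
move=> Px ca cb cc z B; have Mz : M z := slit_field Px.
have comm : 'D_(b x) ('D_(a x) c) x = 'D_(a x) ('D_(b x) c) x.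
  exact: derive_comm openP Px (cc 2).
have e1 := covariant_covariant a Px cb cc; have e2 := covariant_covariant b Px ca cc.
have e3 : 'D_B c x = 'D_('D_(a x) b x) c x - 'D_('D_(b x) a x) c x.
  have := derive_linear ((cc 1).1 x Px) (-1) ('D_(b x) a x) ('D_(a x) b x).
  by rewrite !scaleN1r [- _ + _]addrC [in X in _ = X -> _]addrC.
have e4 := GamBl ('D_(a x) b x) ('D_(b x) a x) (c x) Mz.
exact: cancel e1 e2 comm e3 e4.
Qed.

End CoordinateConnections.

(** * Hypersurfaces in isometric charts *)

Section Charts.
Context {R : realType} {V : finNormedModType R} {n : nat}.
Local Notation E := 'rV[R]_n.
Variables (S : set V) (U : set E) (phi : E -> V) (O : set V) (psi : V -> E).
Hypothesis openU : open U.
Hypothesis smooth_phi : forall k, class_C k U phi.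
Hypothesis openO : open O.
Hypothesis phiU : phi @` U = S `&` O.
Hypothesis phiK : {in U, cancel phi psi}.
Hypothesis smooth_psi : smooth_on (S `&` O) psi.

Lemma chart_param : local_param S U phi.
Proof. by split; [split|exists O, psi; split]. Qed.

Lemma chart_in x : U x -> (S `&` O) (phi x).
Proof. by move=> Ux; rewrite -phiU; exists x. Qed.

Lemma chartK x : U x -> psi (phi x) = x.
Proof. by move=> Ux; rewrite phiK // inE. Qed.

Lemma chart_inv q : S q -> O q -> U (psi q) /\ phi (psi q) = q.
Proof.
move=> Sq Oq; have : (S `&` O) q by [].
by rewrite -phiU => -[x Ux <-]; rewrite chartK.
Qed.

Lemma chart_continuous x : U x -> {for x, continuous phi}.
Proof. by move=> Ux; apply: differentiable_continuous; exact: (smooth_phi 1).1. Qed.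

Lemma chart_differentiable x : U x -> differentiable phi x.
Proof. exact: (smooth_phi 1).1. Qed.

Definition chart_preimage (Q : set V) : set E := U `&` phi @^-1` Q.

Lemma open_chart_preimage Q : open Q -> open (chart_preimage Q).
Proof. by move=> oQ; exact: (open_within_preimage openU chart_continuous oQ). Qed.

Lemma smooth_pullback (G : normedModType R) (f : V -> G) (Q : set V) k : open Q ->
  smooth_on (S `&` Q) f -> class_C k (chart_preimage Q) (f \o phi).
Proof.
move=> oQ sf; apply: class_C_local => x [Ux Qx].
have [|Q1 [f' [Q1x [oQ1 cf'] ff']]] := sf (phi x).
  by split => //; have [] := chart_in Ux.
have oQ2 := open_chart_preimage (openI oQ oQ1).
exists (chart_preimage (Q `&` Q1)), (f' \o phi); split=> // [y [Uy [Qy Q1y]]|].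
  rewrite /= ff' // inE; split=> //; split=> //.
  by have [] := chart_in Uy.
apply: (class_C_comp (f := phi) oQ2 _ _ (cf' k)); first by move=> y [_ []].
by apply: class_C_sub (smooth_phi k) => y [].
Qed.

Lemma smooth_pushforward (G : normedModType R) (f : V -> G) (Q : set V) : open Q ->
  (forall k, class_C k (chart_preimage Q) (f \o phi)) ->
  smooth_on (S `&` (O `&` Q)) f.
Proof.
move=> oQ cf q [Sq [Oq Qq]].
have [|Q1 [psi' [Q1q [oQ1 cpsi] pp]]] := smooth_psi (a := q); first by [].
have [Uq pq] := chart_inv Sq Oq.
have cpq z : Q1 z -> {for z, continuous psi'} by move=> Q1z; exact: (cpsi 0) z Q1z.
(* Off [S] the extension [psi'] may leave the chart domain, so it is restricted to the open set
   where it does not. *)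
pose Q2 := Q1 `&` psi' @^-1` (chart_preimage Q).
have oQ2 : open Q2.
  rewrite openE => z [Q1z Uz]; apply: filterI; first exact: open_nbhs_nbhs.
  by apply: (cpq z Q1z); apply: open_nbhs_nbhs; split=> //; exact: open_chart_preimage.
exists Q2, (fun z => (f \o phi) (psi' z)); split.
- split=> //; have e : psi' q = psi q by rewrite pp // inE.
  by rewrite /= e; split=> //=; rewrite pq.
- split=> // k; apply: (class_C_comp (f := psi') oQ2 _ _ (cf k)); first by move=> z [].
  by apply: class_C_sub (cpsi k) => z [].
- move=> z /set_mem [[Sz [Oz Qz]] [Q1z _]] /=.
  by rewrite -pp ?inE //; have [_ ->] := chart_inv Sz Oz.
Qed.

Lemma smooth_pushforwardO (G : normedModType R) (f : V -> G) :
  (forall k, class_C k U (f \o phi)) -> smooth_on (S `&` O) f.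
Proof.
move=> cf; rewrite -(setIid O); apply: smooth_pushforward => // k.
by apply: class_C_sub (cf k) => x [].
Qed.

(** [derive_on] selects an element of a set of candidates. By [key] all candidates agree, since any
    extension composed with [phi] is [f \o phi] near [x]. *)
Lemma derive_on_chart (G : normedModType R) (f : V -> G) (Q : set V) x b : open Q ->
  smooth_on (S `&` Q) f -> U x -> Q (phi x) ->
  derive_on S f (phi x) ('D_b phi x) = 'D_b (f \o phi) x.
Proof.
move=> oQ sf Ux Qx; have [Sx _] := chart_in Ux.
have key Q1 f' : open Q1 -> Q1 (phi x) -> smooth_open Q1 f' ->
    {in S `&` Q1, f =1 f'} -> 'D_('D_b phi x) f' (phi x) = 'D_b (f \o phi) x.
  move=> oQ1 Q1x [_ cf'] ff'.
  rewrite -(@derive_chain _ _ _ _ phi f'); last 2 first.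
  - exact: chart_differentiable.
  - exact: (cf' 1).1.
  apply: near_eq_derive; have oP := open_chart_preimage oQ1.
  have Px : chart_preimage Q1 x by [].
  apply: (near_open oP Px) => y [Uy Q1y] /=; rewrite ff' // inE; split=> //.
  by have [] := chart_in Uy.
apply: xget_subset1.
  have [|Q1 [f' [Q1x sf' ff']]] := sf (phi x); first by [].
  have oQ1 := sf'.1.
  exists (Q1 `&` Q), f'; split=> //; last first.
  - rewrite (key (Q1 `&` Q)) //; first exact: openI.
    + split; first exact: openI.
      by move=> k; apply: class_C_sub (sf'.2 k) => z [].
    + by move=> z /set_mem [Sz [Q1z Qz]]; rewrite ff' // inE.
  - by move=> z /set_mem [Sz [Q1z Qz]]; rewrite ff' // inE.
  - split; first exact: openI.
    by move=> k; apply: class_C_sub (sf'.2 k) => z [].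
move=> l1 l2 [Q1 [f1 [Q1x s1 e1 ->]]] [Q2 [f2 [Q2x s2 e2 ->]]].
by rewrite (key Q1 f1 s1.1 Q1x s1 e1) (key Q2 f2 s2.1 Q2x s2 e2).
Qed.

(** Near its point any other parametrization [phi2] equals [phi \o psi' \o phi2], with [psi'] an
    ambient extension of [psi]; the chain rule then gives the coordinates. *)
Lemma tangent_spaceP x u : U x ->
  tangent_space n S (phi x) u <-> exists b, u = 'D_b phi x.
Proof.
move=> Ux; split=> [|[b ->]]; last first.
  by exists U, phi, x, b; split=> //; exact: chart_param.
move=> [U2 [phi2 [a [b [[[oU2 s2] [Q2 [psi2 [oQ2 e2 _ _]]]] U2a pa <-]]]]].
have [Sx Ox] := chart_in Ux.
have [|Q1 [psi' [Q1x [oQ1 cpsi] pp]]] := smooth_psi (a := phi x); first by [].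
have d2 : differentiable phi2 a by exact: (s2 1).1.
have c2 : {for a, continuous phi2} by exact: differentiable_continuous.
have dpsi : differentiable psi' (phi2 a) by rewrite pa; exact: (cpsi 1).1.
have e : psi' (phi2 a) = x by rewrite pa -pp ?chartK // inE.
exists ('D_('D_b phi2 a) psi' (phi2 a)).
rewrite -(@derive_chain _ _ _ _ phi2 psi') // -e.
rewrite -(@derive_chain _ _ _ _ (psi' \o phi2) phi); last 2 first.
- by apply: differentiable_comp.
- by rewrite /= e; exact: chart_differentiable.
apply: near_eq_derive.
have n1 : \forall y \near a, (O `&` Q1) (phi2 y).
  by apply: c2; rewrite pa; apply: open_nbhs_nbhs; split=> //; exact: openI.
have n2 : \forall y \near a, U2 y by exact: open_nbhs_nbhs.
apply: filterS2 n1 n2 => y [Oy Qy] U2y /=.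
have Sy : S (phi2 y) by have : (S `&` Q2) (phi2 y) by [rewrite -e2; exists y]; case.
by rewrite -pp ?inE //; have [_ ->] := chart_inv Sy Oy.
Qed.

(** * Second fundamental form in an isometric chart *)

Variables (h : {dot V for idfun}) (W : V).
Hypothesis dimV : \dim {: V} = n.+1.
Hypothesis isometric_phi : forall x a b, U x ->
  hdot h ('D_a phi x) ('D_b phi x) = dotr a b.

(** The frame of an isometric chart is orthonormal, so scalar products with it are coordinates. The
    formula makes sense for every ambient vector and gives the coordinates of its tangential
    projection, which keeps smoothness arguments free of tangency conditions. *)
Definition chart_coord (x : E) (v : V) : E :=
  \row_i hdot h v ('D_(delta_mx ord0 i) phi x).
Local Notation co := chart_coord.

Lemma derive_chartD x a b : U x -> 'D_(a + b) phi x = 'D_a phi x + 'D_b phi x.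
Proof.
move=> Ux; have l := derive_linear (chart_differentiable Ux).
by have := l 1 a b; rewrite !scale1r.
Qed.

Lemma derive_chart0 x : U x -> 'D_0 phi x = 0.
Proof.
by move=> Ux; apply: (@addrI _ ('D_0 phi x)); rewrite -derive_chartD // !addr0.
Qed.

Lemma derive_chartZ x c a : U x -> 'D_(c *: a) phi x = c *: 'D_a phi x.
Proof.
move=> Ux; have l := derive_linear (chart_differentiable Ux).
by have := l c a 0; rewrite derive_chart0 // !addr0.
Qed.

Lemma derive_chartB x a b : U x -> 'D_(a - b) phi x = 'D_a phi x - 'D_b phi x.
Proof. by move=> Ux; rewrite -scaleN1r derive_chartD // derive_chartZ // scaleN1r. Qed.

Lemma dotr_chart_coord x v Y : U x -> dotr (co x v) Y = hdot h v ('D_Y phi x).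
Proof.
move=> Ux; have dphi := chart_differentiable Ux.
rewrite deriveE // [Y in RHS]row_sum_delta linear_sum hdot_sumr /dotr.
apply: eq_bigr => i _; rewrite linearZ hdotZr mxE -deriveE //; exact: mulrC.
Qed.

Lemma chart_coordK x Y : U x -> co x ('D_Y phi x) = Y.
Proof. by move=> Ux; apply: dotr_inj => Z; rewrite dotr_chart_coord // isometric_phi. Qed.

Lemma derive_chart_inj x X Y : U x -> 'D_X phi x = 'D_Y phi x -> X = Y.
Proof. by move=> Ux XY; rewrite -(chart_coordK X Ux) XY chart_coordK. Qed.

Lemma chart_coord_is_linear x : linear (co x).
Proof. by move=> c u v; apply/rowP => i; rewrite !mxE hdotDl hdotZl. Qed.

Lemma chart_coordP x u : U x -> tangent_space n S (phi x) u -> 'D_(co x u) phi x = u.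
Proof. by move=> Ux /tangent_spaceP-/(_ Ux)[b ->]; rewrite chart_coordK. Qed.

Lemma class_C_chart_coord (D : normedModType R) k (Q : set D) (p : D -> E) (v : D -> V) :
  open Q -> (forall z, Q z -> U (p z)) -> class_C k Q p -> class_C k Q v ->
  class_C k Q (fun z => co (p z) (v z)).
Proof.
move=> oQ QU cp cv.
apply: (class_C_eq oQ (g := fun z => \sum_i
    hdot h (v z) ('D_(delta_mx ord0 i) phi (p z)) *: delta_mx ord0 i)).
  by move=> z Qz; rewrite [LHS]row_sum_delta; apply: eq_bigr => i _; rewrite mxE.
apply: class_C_sum => // i; apply: class_CZ => //; last exact: class_C_cst.
apply: class_C_bilinear => //; first exact: bilinear_fd_continuous.
exact: (class_C_comp oQ QU cp ((smooth_phi k.+1).2 (delta_mx ord0 i))).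
Qed.

Lemma derive_comm_chart x X Y : U x ->
  'D_X ('D_Y phi) x = 'D_Y ('D_X phi) x.
Proof. by move=> Ux; apply: derive_comm openU Ux (smooth_phi 2). Qed.

Lemma has_derive_dchart x X Y : U x ->
  has_derive ('D_Y phi) X x ('D_X ('D_Y phi) x).
Proof. by move=> Ux; apply: differentiable_has_derive => //; exact: ((smooth_phi 2).2 Y).1. Qed.

Lemma has_derive_d2chart x T X Y : U x ->
  has_derive ('D_X ('D_Y phi)) T x ('D_T ('D_X ('D_Y phi)) x).
Proof.
move=> Ux; apply: differentiable_has_derive => //.
exact: (((smooth_phi 3).2 Y).2 X).1.
Qed.

Lemma has_derive_hdot (D : normedModType R) (f g : D -> V) xi z a b :
  has_derive f xi z a -> has_derive g xi z b ->
  has_derive (fun x => hdot h (f x) (g x)) xi z (hdot h a (g z) + hdot h (f z) b).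
Proof. exact: (has_derive_bilinear (hdot h)). Qed.

Lemma derive_locally_cst (G : normedModType R) (f : E -> G) x v c : U x ->
  (forall y, U y -> f y = c) -> 'D_v f x = 0.
Proof.
move=> Ux fc; have [_ <-] := has_derive_cst c v x.
by apply: near_eq_derive; exact: near_open fc.
Qed.

Lemma second_form_antisym x X Y Z : U x ->
  hdot h ('D_X ('D_Y phi) x) ('D_Z phi x) =
  - hdot h ('D_X ('D_Z phi) x) ('D_Y phi x).
Proof.
move=> Ux; apply/eqP; rewrite -addr_eq0 [X in _ + X]hdotC; apply/eqP.
have [_ <-] := has_derive_hdot (has_derive_dchart X Y Ux) (has_derive_dchart X Z Ux).
by apply: (derive_locally_cst _ Ux (c := dotr Y Z)) => y Uy; exact: isometric_phi.
Qed.

(* [h (D_X D_Y phi, D_Z phi)] is symmetric in [X, Y] and antisymmetric in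
   [Y, Z]. *)
Lemma second_form_normal x X Y Z : U x ->
  hdot h ('D_X ('D_Y phi) x) ('D_Z phi x) = 0.
Proof.
have fixed_opp (t : R) : t = - t -> t = 0 by lra.
move=> Ux; apply: fixed_opp; pose T X Y Z := hdot h ('D_X ('D_Y phi) x) ('D_Z phi x).
have a X' Y' Z' : T X' Y' Z' = - T X' Z' Y' by exact: second_form_antisym.
have s X' Y' Z' : T X' Y' Z' = T Y' X' Z' by rewrite /T derive_comm_chart.
rewrite -/(T X Y Z).
by rewrite {1}a s a opprK s a s.
Qed.

(** Differentiating [second_form_normal] trades a product of two second derivatives for one with a
    third derivative, in which [X] and [T] may be exchanged. *)
Lemma gauss x X Y T Z : U x ->
  hdot h ('D_X ('D_Y phi) x) ('D_T ('D_Z phi) x) =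
  hdot h ('D_T ('D_Y phi) x) ('D_X ('D_Z phi) x).
Proof.
move=> Ux.
have key X' T' : hdot h ('D_X' ('D_Y phi) x) ('D_T' ('D_Z phi) x) =
    - hdot h ('D_T' ('D_X' ('D_Y phi)) x) ('D_Z phi x).
  apply/eqP; rewrite -addr_eq0 addrC; apply/eqP.
  have [_ <-] := has_derive_hdot (has_derive_d2chart T' X' Y Ux) (has_derive_dchart T' Z Ux).
  by apply: (derive_locally_cst _ Ux (c := 0)) => y Uy; exact: second_form_normal.
have e : 'D_T ('D_X ('D_Y phi)) x = 'D_X ('D_T ('D_Y phi)) x.
  by apply: derive_comm openU Ux _; exact: (smooth_phi 3).2.
exact: etrans (key X T) (etrans (congr1 (fun u => - hdot h u ('D_Z phi x)) e) (esym (key T X))).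
Qed.

(** Two orthogonal nonzero normals together with the [n] vectors of the frame would be [n + 2]
    orthogonal nonzero vectors in dimension [n + 1]. *)
Lemma normal_collinear x : U x ->
  exists N, forall v, (forall Y, hdot h v ('D_Y phi x) = 0) -> exists c, v = c *: N.
Proof.
move=> Ux; pose normal v := forall Y, hdot h v ('D_Y phi x) = 0.
have [[N [nN N0]]|none] := pselect (exists N, normal N /\ N != 0); last first.
  exists 0 => v nv; exists 0; rewrite scaler0; apply/eqP/negPn/negP => v0.
  by apply: none; exists v.
exists N => v nv; exists (hdot h v N / hdot h N N).
apply/eqP; rewrite -subr_eq0; apply/negPn/negP => q0; move: q0; set q := (X in X != 0) => q0.
have NN : hdot h N N != 0 by rewrite gt_eqF // hdot_gt0.
have qN : hdot h q N = 0 by rewrite hdotDl hdotNl hdotZl divfK // subrr.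
have nq : normal q by move=> Y; rewrite hdotDl hdotNl hdotZl nv nN mulr0 subr0.
pose s := [seq 'D_(delta_mx ord0 i) phi x | i <- enum 'I_n].
suff : (size (q :: N :: s) <= \dim {: V})%N by rewrite /= size_map size_enum_ord dimV ltnn.
have dd (i j : 'I_n) : hdot h ('D_(delta_mx ord0 i) phi x) ('D_(delta_mx ord0 j) phi x) = (i == j)%:R.
  rewrite isometric_phi // /dotr (bigD1 i) //= big1 ?addr0 => [|k /negPf ki].
    by rewrite !mxE !eqxx mul1r.
  by rewrite !mxE eqxx ki mul0r.
apply: (@orthogonal_size _ _ h) => /=.
  rewrite qN eqxx /= pairwise_map; apply/and3P; split.
  - by apply/allP => _ /mapP[i _ ->]; rewrite nq.
  - by apply/allP => _ /mapP[i _ ->]; rewrite nN.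
  - have := enum_uniq 'I_n; rewrite uniq_pairwise; apply: sub_pairwise => i j /=.
    by rewrite dd => /negPf ->.
rewrite !inE !negb_or eq_sym q0 eq_sym N0 /=; apply/mapP => -[i _ e].
by have := dd i i; rewrite -e hdot0l eqxx => /eqP; rewrite eq_sym oner_eq0.
Qed.

(** The gradient of the height function [h (W, phi x)], and also the coordinates of the tangential
    part of [W]. *)
Definition wind (x : E) : E := co x W.

Lemma smooth_wind k : class_C k U wind.
Proof. by apply: class_C_chart_coord => //; [exact: class_C_id|exact: class_C_cst]. Qed.

Lemma derive_wind x X Y : U x -> dotr ('D_X wind x) Y = hdot h W ('D_X ('D_Y phi) x).
Proof.
move=> Ux; have dw : has_derive wind X x ('D_X wind x).
  by apply: differentiable_has_derive => //; exact: (smooth_wind 1).1.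
have [_ <-] := has_derive_dotr_cst Y dw.
have [_] := has_derive_hdot (has_derive_cst W X x) (has_derive_dchart X Y Ux).
rewrite hdot0l add0r => <-.
by apply: near_eq_derive; apply: (near_open openU Ux) => y Uy; exact: dotr_chart_coord.
Qed.

Lemma wind_sym x X Y : U x -> dotr ('D_X wind x) Y = dotr ('D_Y wind x) X.
Proof.
move=> Ux; apply: etrans (derive_wind X Y Ux) (etrans _ (esym (derive_wind Y X Ux))).
exact: congr1 (derive_comm_chart X Y Ux).
Qed.

(* The normal space being a line, [II = b N] with a symmetric bilinear form [b],
   and the Gauss equation makes the 2x2 minors of [b] vanish. *)
Lemma wind_rank1 x X Y Z T : U x ->
  dotr ('D_X wind x) Y * dotr ('D_Z wind x) T =
  dotr ('D_Z wind x) Y * dotr ('D_X wind x) T.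
Proof.
have scalars (a b c d p q : R) : p != 0 -> a * (b * p) = c * (d * p) ->
    a * q * (b * q) = c * q * (d * q).
  move=> p0 /eqP; rewrite [X in X == _]mulrA [X in _ == X]mulrA (inj_eq (mulIf p0)) => /eqP e.
  by rewrite [LHS]mulrACA e mulrACA.
move=> Ux; have [N Nc] := normal_collinear Ux.
have II A B : exists c, 'D_A ('D_B phi) x = c *: N.
  by apply: Nc => C; exact: second_form_normal.
have dw A B c : 'D_A ('D_B phi) x = c *: N -> dotr ('D_A wind x) B = c * hdot h W N.
  by move=> e; rewrite (derive_wind A B Ux) e hdotZr.
have hh A B C D a b : 'D_A ('D_B phi) x = a *: N -> 'D_C ('D_D phi) x = b *: N ->
    hdot h ('D_A ('D_B phi) x) ('D_C ('D_D phi) x) = a * (b * hdot h N N).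
  by move=> -> ->; rewrite hdotZl hdotZr.
have [a ea] := II X Y; have [b eb] := II Z T; have [c ec] := II Z Y; have [d ed] := II X T.
have := etrans (esym (hh _ _ _ _ _ _ ea eb)) (etrans (gauss X Y Z T Ux) (hh _ _ _ _ _ _ ec ed)).
move=> abcd; apply: etrans (congr2 *%R (dw X Y a ea) (dw Z T b eb)) _.
apply: etrans (esym (congr2 *%R (dw Z Y c ec) (dw X T d ed))); move: abcd.
have [->|N0] := eqVneq N 0; first by rewrite !hdot0r !mulr0.
by apply: scalars; rewrite gt_eqF // hdot_gt0.
Qed.

(** * The restricted norm and its tensors in an isometric chart *)

Variable F : V -> R.
Hypothesis randersF : randers_minkowski h W F.
Local Notation l0 := (1 - hdot h W W).
Local Notation L := (renergy wind l0).
Local Notation g := (vert_hessian L).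

Lemma wind_lt1 : 0 < l0.
Proof. by rewrite subr_gt0; have [] := randersF. Qed.

(** The case [y = 0] is included so that [fund_tensor] differentiates functions that agree along
    whole lines, even through the origin. *)
Lemma finsler_chart x y : U x -> F ('D_y phi x) = rfinsler wind l0 (x, y).
Proof.
have root (l q b f : R) : 0 < l -> 0 < f -> 0 < q ->
    f^-1 * (f^-1 * q) - 2 * (f^-1 * b) + (1 - l) = 1 ->
    f = (Num.sqrt (l * q + b * b) - b) / l.
  move=> l_gt0 f0 q0 e; have fn : f != 0 by rewrite gt_eqF.
  have e2 : l * f * f + 2 * f * b = q.
    have : f * f * (f^-1 * (f^-1 * q) - 2 * (f^-1 * b) + (1 - l)) = f * f by rewrite e mulr1.
    have -> : f * f * (f^-1 * (f^-1 * q) - 2 * (f^-1 * b) + (1 - l)) =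
      q - 2 * f * b + f * f * (1 - l) by field.
    by lra.
  (* This sign selects the root: [f (l f + 2 b) = q] is positive, hence so are [l f + 2 b] and its
     sum with [l f]. *)
  have p0 : 0 < l * f + b.
    have : 0 < f * (l * f + 2 * b) by nra.
    by rewrite pmulr_rgt0 //; have := mulr_gt0 l_gt0 f0; lra.
  have -> : l * q + b * b = (l * f + b) ^+ 2 by rewrite -e2; ring.
  by rewrite sqrtr_sqr gtr0_norm //; field; rewrite gt_eqF.
move=> Ux; rewrite /rfinsler /rnorm /rbeta /rform /=; have [->|y0] := eqVneq y 0.
  rewrite derive_chart0 // !dotr0r !mulr0 addr0 sqrtr0 subr0 mul0r.
  by have [] := randersF.
have [_ _ /(_ ('D_y phi x))[]] := randersF.
  by apply: contra_neq y0 => e; apply: (derive_chart_inj Ux); rewrite derive_chart0.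
move=> f0; rewrite -!/(hdot h _ _) !(hdotDl, hdotNl, hdotZl, hdotDr, hdotNr, hdotZr).
rewrite isometric_phi // [hdot h _ W]hdotC -dotr_chart_coord //.
move=> e; apply: root => //; [exact: wind_lt1|exact: dotr_gt0|].
by rewrite -[RHS]e /wind; move: (hdot h W W) (dotr (co x W) y) (dotr y y) => *; ring.
Qed.

Lemma derive_chart_line x y u (s : R) : U x ->
  'D_y phi x + s *: 'D_u phi x = 'D_(y + s *: u) phi x.
Proof. by move=> Ux; rewrite derive_chartD // derive_chartZ. Qed.

Lemma pair_line (x y u : E) (s : R) : (x, y + s *: u) = (x, y) + s *: (0, u).
Proof. by apply: injective_projections; rewrite /= ?scaler0 ?addr0. Qed.

Lemma fund_tensor_chart x y a b : U x ->
  fund_tensor F ('D_y phi x) ('D_a phi x) ('D_b phi x) = g a b (x, y).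
Proof.
move=> Ux; apply: (congr1 (fun r => 2^-1 * r)).
apply: etrans _ (derive1_line ('D_(0, b) L) (x, y) (0, a)).
apply: (congr1 (fun f => derive1 f 0)); apply/funext => s.
apply: etrans _ (derive1_line L _ (0, b)).
apply: (congr1 (fun f => derive1 f 0)); apply/funext => t.
by rewrite !derive_chart_line // finsler_chart // !pair_line expr2.
Qed.

Lemma cartan_tensor_chart x y a b c : U x ->
  2 * cartan_tensor F ('D_y phi x) ('D_a phi x) ('D_b phi x) ('D_c phi x) =
  'D_(0, c) (g a b) (x, y).
Proof.
have half (r : R) : 2 * (2^-1 * r) = r by field.
move=> Ux; apply: etrans (half _) (etrans _ (derive1_line (g a b) (x, y) (0, c))).
apply: (congr1 (fun f => derive1 f 0)); apply/funext => s.
apply: etrans (congr1 (fun v => fund_tensor F v _ _) (derive_chart_line y c s Ux)) _.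
apply: etrans (fund_tensor_chart _ a b Ux) _.
exact: (congr1 (g a b) (pair_line x y c s)).
Qed.

Definition chart_field (a : E -> E) (q : V) : V := 'D_(a (psi q)) phi (psi q).
Local Notation cst_field Y := (chart_field (fun=> Y)).
Definition field_coord (X : V -> V) (x : E) : E := co x (X (phi x)).
Local Notation hat := field_coord.

Lemma chart_preimage_sub Q : chart_preimage Q `<=` U.
Proof. by move=> x []. Qed.

Lemma vector_field_chart (Q : set V) (X : V -> V) (a : E -> E) : open Q ->
  (forall k, class_C k (chart_preimage Q) a) ->
  (forall x, chart_preimage Q x -> X (phi x) = 'D_(a x) phi x) ->
  vector_field n S (O `&` Q) X.
Proof.
move=> oQ ca Xa; have oP := open_chart_preimage oQ; split; first exact: openI.
  apply: smooth_pushforward => // k; apply: (class_C_eq oP Xa).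
  exact: (class_C_along oP (@chart_preimage_sub Q) (smooth_phi k.+1)
    (@class_C_id _ _ k _) (ca k)).
move=> q Sq [Oq Qq]; have [Uq qE] := chart_inv Sq Oq.
rewrite -[q]qE; apply/tangent_spaceP => //; exists (a (psi q)).
by apply: Xa; split=> //=; rewrite qE.
Qed.

Lemma smooth_hat Q X : vector_field n S Q X -> forall k, class_C k (chart_preimage Q) (hat X).
Proof.
move=> [oQ sX _] k; have oP := open_chart_preimage oQ.
apply: class_C_chart_coord => //; first exact: chart_preimage_sub.
  exact: class_C_id.
exact: (smooth_pullback k oQ sX).
Qed.

Lemma hatK Q X x : vector_field n S Q X -> chart_preimage Q x ->
  'D_(hat X x) phi x = X (phi x).
Proof.
move=> [_ _ tX] [Ux Qx]; apply: chart_coordP => //; apply: tX => //.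
by have [] := chart_in Ux.
Qed.

Lemma hat_neq0 Q X x : vector_field n S Q X -> (forall q, S q -> Q q -> X q != 0) ->
  chart_preimage Q x -> hat X x != 0.
Proof.
move=> vX X0 Px; have [Ux Qx] := Px.
have : X (phi x) != 0 by apply: X0 => //; have [] := chart_in Ux.
by apply: contra_neq => e; rewrite -(hatK vX Px) e derive_chart0.
Qed.

Lemma cst_field_vector_field Y : vector_field n S O (cst_field Y).
Proof.
rewrite -(setIid O); apply: (vector_field_chart (a := fun=> Y)) => // [k|x [Ux _]].
  exact: class_C_cst.
by rewrite /chart_field chartK.
Qed.

Lemma cst_fieldE Y x : U x -> cst_field Y (phi x) = 'D_Y phi x.
Proof. by move=> Ux; rewrite /chart_field chartK. Qed.

Lemma slit_chart x y : U x -> y != 0 -> slit_tangent_bundle n S (phi x, 'D_y phi x).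
Proof.
move=> Ux y0; split=> /=; first by have [] := chart_in Ux.
  by apply/tangent_spaceP => //; exists y.
by apply: contra_neq y0 => e; apply: (derive_chart_inj Ux); rewrite derive_chart0.
Qed.

Lemma tangent_chart x b : U x -> tangent_space n S (phi x) ('D_b phi x).
Proof. by move=> Ux; apply/tangent_spaceP => //; exists b. Qed.

(** * Christoffel symbols of an arbitrary Chern connection *)

Variable nabla : V -> V -> V -> (V -> V) -> V.
Hypothesis chern : chern_connection n S F nabla.

(** The connection on constant coordinate fields. These commute, so the axioms applied to them, with
    a constant reference field as well, become the hypotheses on [Gam] of the coordinate theory. *)
Definition christoffel (z : E * E) (X Y : E) : E :=
  co z.1 (nabla (phi z.1) ('D_(z.2) phi z.1) ('D_X phi z.1) (cst_field Y)).
Local Notation Gam := christoffel.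
Local Notation M := (slit U).

Lemma christoffelE x y X Y : M (x, y) ->
  'D_(Gam (x, y) X Y) phi x =
  nabla (phi x) ('D_y phi x) ('D_X phi x) (cst_field Y).
Proof.
move=> [/= Ux y0]; apply: chart_coordP => //.
apply: (chern_tangent chern (cst_field_vector_field Y)).
- by have [] := chart_in Ux.
- exact: slit_chart.
- exact: tangent_chart.
Qed.

Lemma christoffel_linear z Y : M z -> linear (fun X => Gam z X Y).
Proof.
case: z => x y [/= Ux y0] c X X'; rewrite /christoffel /=.
rewrite derive_chartD // derive_chartZ // (chern_linear chern _ (cst_field_vector_field Y)).
- exact: chart_coord_is_linear.
- by have [] := chart_in Ux.
- exact: slit_chart.
- exact: tangent_chart.
- exact: tangent_chart.
Qed.

Lemma derive_on_cst_field x X Y : U x ->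
  derive_on S (cst_field Y) (phi x) ('D_X phi x) = 'D_X ('D_Y phi) x.
Proof.
move=> Ux; have [Sx Ox] := chart_in Ux; have [_ sY _] := cst_field_vector_field Y.
apply: etrans (derive_on_chart X openO sY Ux Ox) _.
by apply: near_eq_derive; apply: (near_open openU Ux) => y Uy; exact: cst_fieldE.
Qed.

Lemma cst_field_neq0 Y : Y != 0 -> forall q, S q -> O q -> cst_field Y q != 0.
Proof.
move=> Y0 q Sq Oq; have [Uq qE] := chart_inv Sq Oq.
by have [] := slit_chart Uq Y0.
Qed.

Lemma christoffel_sym z X Y : M z -> Gam z X Y = Gam z Y X.
Proof.
case: z => x y [/= Ux y0]; have [Sx Ox] := chart_in Ux.
have := chern_torsion_free chern (cst_field_vector_field y) (cst_field_neq0 y0)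
  (cst_field_vector_field X) (cst_field_vector_field Y) Sx Ox.
rewrite /lie_bracket !cst_fieldE // !derive_on_cst_field //.
have -> := derive_comm_chart X Y Ux; rewrite subrr => /eqP; rewrite subr_eq0 => /eqP e.
by rewrite /christoffel /= e.
Qed.

(** Pulls smoothness on the slit tangent bundle, a subset of [V * V], back to the coordinates
    [(x, y)]. *)
Definition tangent_map (z : E * E) : V * V := (phi z.1, 'D_(z.2) phi z.1).

Lemma class_C_tangent_map k : class_C k M tangent_map.
Proof.
have oM := open_slit openU; have f k' : class_C k' M fst by exact: class_C_fst.
apply: class_C_pair => //.
  exact: (class_C_comp oM (fun z (Mz : M z) => proj1 Mz) (f k) (smooth_phi k)).
exact: (class_C_along oM (fun z (Mz : M z) => proj1 Mz) (smooth_phi k.+1) (f k)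
  (class_C_snd k oM)).
Qed.

Lemma smooth_christoffel k X Y : class_C k M (fun z => Gam z X Y).
Proof.
have oM := open_slit openU; apply: class_C_local => -[x y] Mz.
have [_ _ _ _ _ /(_ _ _ _ (cst_field_vector_field X) (cst_field_vector_field Y)) sn _ _] := chern.
have inA z : M z -> (slit_tangent_bundle n S `&` [set pv | O pv.1]) (tangent_map z).
  by move=> [Ux y0]; split; [exact: slit_chart|have [] := chart_in Ux].
have [Q [f' [Qz [oQ cf'] ff']]] := sn _ (inA _ Mz).
have ct z : M z -> {for z, continuous tangent_map}.
  by move=> Mz'; exact: (class_C_tangent_map 0).
have oP := open_within_preimage oM ct oQ.
exists (M `&` tangent_map @^-1` Q), (fun z => co z.1 (f' (tangent_map z))).
split=> // [z [Mz' Qz']|].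
  rewrite -ff' ?inE; last by split=> //; exact: inA.
  by rewrite /christoffel /= cst_fieldE //; case: Mz'.
have MU z : (M `&` tangent_map @^-1` Q) z -> U z.1 by case=> -[].
apply: (class_C_chart_coord oP MU); first exact: class_C_fst.
apply: (class_C_comp (f := tangent_map) oP _ _ (cf' k)) => [z []//|].
by apply: class_C_sub (class_C_tangent_map k) => z [].
Qed.

Lemma smooth_renergy k : class_C k M L.
Proof. exact: (class_C_renergy openU smooth_wind wind_lt1). Qed.

Lemma pair_derive (f : E * E -> R) x y X : M (x, y) -> differentiable f (x, y) ->
  'D_X (fun x => f (x, y)) x = 'D_(X, 0) f (x, y).
Proof.
move=> Mz df.
have dp : has_derive (fun x : E => (x, y)) X x (X, 0).
  split; first by apply: differentiable_pair => //; exact: differentiable_id.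
  by rewrite (derive_pair (f := id) (g := cst y)) ?derive_id ?derive_cst //; exact: differentiable_id.
exact: (has_derive_comp dp df).2.
Qed.

(** For a reference field with constant coordinates [y] the covariant derivative is just
    [Gam z X y], and the Cartan term becomes a vertical derivative of [g]. *)
Lemma christoffel_metric z X Y Z : M z ->
  'D_(X, 0) (g Y Z) z =
  g (Gam z X Y) Z z + g Y (Gam z X Z) z + 'D_(0, Z) (g (Gam z X z.2) Y) z.
Proof.
case: z => x y Mz; have [/= Ux y0] := Mz; have [Sx Ox] := chart_in Ux.
have := chern_almost_metric chern (cst_field_vector_field y) (cst_field_neq0 y0)
  (cst_field_vector_field X) (cst_field_vector_field Y) (cst_field_vector_field Z) Sx Ox.
rewrite !cst_fieldE // -!christoffelE // !fund_tensor_chart // cartan_tensor_chart // => <-.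
have cg k : class_C k M (g Y Z).
  exact: (class_C_g (open_slit openU) smooth_renergy).
have ft x' : U x' -> fund_tensor F (cst_field y (phi x')) (cst_field Y (phi x'))
    (cst_field Z (phi x')) = g Y Z (x', y).
  move=> Ux'; rewrite (cst_fieldE y Ux') (cst_fieldE Y Ux') (cst_fieldE Z Ux').
  exact: (fund_tensor_chart y Y Z Ux').
have cp k : class_C k U (fun x' : E => (x', y)).
  by apply: class_C_pair => //; [exact: class_C_id|exact: class_C_cst].
have sf : smooth_on (S `&` O) (fun q => fund_tensor F (cst_field y q) (cst_field Y q) (cst_field Z q)).
  apply: smooth_pushforwardO => k; apply: (class_C_eq openU ft).
  by apply: (class_C_comp openU _ (cp k) (cg k)) => x' Ux'.
apply: etrans (esym (derive_on_chart X openO sf Ux Ox)).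
apply: etrans (esym (pair_derive X Mz ((cg 1).1 _ Mz))) _.
by apply: near_eq_derive; apply: (near_open openU Ux) => x' Ux'; exact/esym/ft.
Qed.

Section NablaChart.
Variable Q : set V.
Hypothesis openQ : open Q.
Local Notation P := (chart_preimage Q).

Lemma open_chartQ : open P. Proof. exact: open_chart_preimage. Qed.

Lemma scaled_cst_field (f : E -> R) Y : (forall k, class_C k P f) ->
  [/\ smooth_on (S `&` (O `&` Q)) (f \o psi),
      vector_field n S (O `&` Q) (cst_field Y) &
      vector_field n S (O `&` Q) (fun q => f (psi q) *: cst_field Y q)].
Proof.
move=> cf; have oP := open_chartQ; split.
- apply: smooth_pushforward => // k; apply: (class_C_eq oP _ (cf k)) => x [Ux _].
  by rewrite /= chartK.
- apply: (vector_field_chart (a := fun=> Y)) => // [k|x [Ux _]]; first exact: class_C_cst.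
  exact: cst_fieldE.
- apply: (vector_field_chart (a := fun x => f x *: Y)) => // [k|x [Ux _]].
    by apply: class_CZ => //; exact: class_C_cst.
  by rewrite cst_fieldE // chartK // derive_chartZ.
Qed.

Lemma sum_cst_field m (f : 'I_m -> E -> R) (Y : 'I_m -> E) :
  (forall i k, class_C k P (f i)) ->
  vector_field n S (O `&` Q) (fun q => \sum_i f i (psi q) *: cst_field (Y i) q).
Proof.
move=> cf; have oP := open_chartQ.
apply: (vector_field_chart (a := fun x => \sum_i f i x *: Y i)) => // [k|x [Ux _]].
  by apply: class_C_sum => // i; apply: class_CZ => //; exact: class_C_cst.
have dphi := chart_differentiable Ux.
rewrite deriveE // linear_sum; apply: eq_bigr => i _.
by rewrite cst_fieldE // chartK // linearZ -deriveE.
Qed.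

Lemma derive_on_psi (f : E -> R) x X : (forall k, class_C k P f) -> P x ->
  derive_on S (f \o psi) (phi x) ('D_X phi x) = 'D_X f x.
Proof.
move=> cf Px; have [Ux Qx] := Px; have [sf _ _] := scaled_cst_field 0 cf.
have OQx : (O `&` Q) (phi x) by split=> //; have [] := chart_in Ux.
apply: etrans (derive_on_chart X (openI openO openQ) sf Ux OQx) _.
by apply: near_eq_derive; apply: (near_open openU Ux) => y Uy; rewrite /= chartK.
Qed.

Lemma nabla_sum m (f : 'I_m -> E -> R) (Y : 'I_m -> E) (x y X : E) :
  (forall i k, class_C k P (f i)) -> P x -> y != 0 ->
  nabla (phi x) ('D_y phi x) ('D_X phi x)
    (fun q => \sum_i f i (psi q) *: cst_field (Y i) q) =
  \sum_i 'D_('D_X (f i) x *: Y i + f i x *: Gam (x, y) X (Y i)) phi x.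
Proof.
move=> cf Px y0; have [Ux Qx] := Px; have Mz : M (x, y) by [].
have OQx : (O `&` Q) (phi x) by split=> //; have [] := chart_in Ux.
have sx := slit_chart Ux y0; have tX := tangent_chart X Ux.
elim: m f Y cf => [|m IH] f Y cf.
  rewrite big_ord0; under eq_fun do rewrite big_ord0.
  have v0 : vector_field n S (O `&` Q) (fun=> 0).
    have := sum_cst_field Y cf.
    by under eq_fun do rewrite big_ord0.
  (* Additivity at the zero field: a vector equal to its own double is zero. *)
  have := chern_add chern v0 v0 OQx sx tX.
  under eq_fun do rewrite addr0.
  by move=> /eqP; rewrite addrC -subr_eq subrr => /eqP <-.
have IHm := IH (fun i => f (lift ord0 i)) (fun i => Y (lift ord0 i)) (fun i => cf _).
rewrite big_ord_recl -IHm; under eq_fun do rewrite big_ord_recl.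
have [sf vc vs] := scaled_cst_field (Y ord0) (cf ord0).
have vm := sum_cst_field (fun i => Y (lift ord0 i)) (fun i => cf (lift ord0 i)).
apply: etrans (chern_add chern vs vm OQx sx tX) _; congr (_ + _).
apply: etrans (chern_leibniz chern sf vc OQx sx tX) _.
apply/esym; apply: etrans (derive_chartD _ _ Ux) _; congr (_ + _).
  apply: etrans (derive_chartZ _ _ Ux) _.
  exact: (congr2 *:%R (esym (derive_on_psi X (cf ord0) Px)) (esym (cst_fieldE _ Ux))).
apply: etrans (derive_chartZ _ _ Ux) _; rewrite christoffelE //.
by rewrite /= chartK.
Qed.

(** By locality [Y] may be replaced by its expansion in the coordinate fields, on which additivity
    and the Leibniz rule leave only [Gam]. *)
Lemma nabla_chart Y (x y X : E) : vector_field n S Q Y -> P x -> y != 0 ->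
  nabla (phi x) ('D_y phi x) ('D_X phi x) Y =
  'D_('D_X (hat Y) x + Gam (x, y) X (hat Y x)) phi x.
Proof.
move=> vY Px y0; have [Ux Qx] := Px; have Mz : M (x, y) by [].
have OQx : (O `&` Q) (phi x) by split=> //; have [] := chart_in Ux.
pose e (i : 'I_n) : E := delta_mx ord0 i; pose f i x := dotr (hat Y x) (e i).
have ch := smooth_hat vY; have oP := open_chartQ.
have cf i k : class_C k P (f i) by apply: class_C_dotr => //; exact: class_C_cst.
have vs := sum_cst_field e cf.
have vY' : vector_field n S (O `&` Q) Y.
  have [oQ sY tY] := vY; split; first exact: openI.
    move=> q [Sq [Oq Qq]]; have [//|Q1 [Y' [Q1q s1 e1]]] := sY q.
    exists Q1, Y'; split=> // q' /set_mem [[Sq' [_ Qq']] Q1q'].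
    by apply: e1; rewrite inE.
  by move=> q Sq [_ Qq]; exact: tY.
have eY : {in S `&` (O `&` Q), Y =1 fun q => \sum_i f i (psi q) *: cst_field (e i) q}.
  move=> q /set_mem [Sq [Oq Qq]]; have [Uq qE] := chart_inv Sq Oq.
  have Pq : P (psi q) by split=> //=; rewrite qE.
  have dphi := chart_differentiable Uq.
  rewrite -{1}qE -(hatK vY Pq) deriveE // [hat Y _]row_sum_dotr linear_sum.
  by apply: eq_bigr => i _; rewrite linearZ -deriveE.
apply: etrans (chern_local chern vY' vs eY OQx (slit_chart Ux y0) (tangent_chart X Ux)) _.
apply: etrans (nabla_sum e X cf Px y0) _.
have dphi := chart_differentiable Ux.
under eq_bigr do rewrite deriveE //.
rewrite deriveE // -linear_sum; congr ('d phi x _).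
rewrite big_split /=; congr (_ + _).
  rewrite [RHS]row_sum_dotr; apply: eq_bigr => i _; congr (_ *: _).
  have dh := differentiable_has_derive X ((ch 1).1 x Px).
  exact: (has_derive_dotr_cst (e i) dh).2.
by apply/esym/linear_row_sum; exact: (Gam_linear_r christoffel_linear christoffel_sym).
Qed.

End NablaChart.

(** * Chern curvature and flag curvature in a chart *)

Section CurvatureChart.
Variables (Q : set V) (T X Y Z : V -> V).
Hypothesis openQ : open Q.
Local Notation P := (chart_preimage Q).
Hypothesis vT : vector_field n S Q T.
Hypothesis T_neq0 : forall q, S q -> Q q -> T q != 0.
Local Notation cov := (covariant Gam).

Let oP : open P. Proof. exact: open_chart_preimage. Qed.
Let PU : P `<=` U. Proof. exact: chart_preimage_sub. Qed.

Lemma affine_connection_chart A B x : vector_field n S Q A -> vector_field n S Q B ->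
  P x -> affine_connection nabla T A B (phi x) =
    'D_(cov (hat T) (hat A) (hat B) x) phi x.
Proof.
move=> vA vB Px; rewrite /affine_connection -(hatK vT Px) -(hatK vA Px).
exact: (nabla_chart openQ (hat A x) vB Px (hat_neq0 vT T_neq0 Px)).
Qed.

Lemma affine_connection_field A B : vector_field n S Q A -> vector_field n S Q B ->
  vector_field n S (O `&` Q) (affine_connection nabla T A B).
Proof.
move=> vA vB; apply: (vector_field_chart openQ (a := cov (hat T) (hat A) (hat B))).
  apply: (class_C_covariant christoffel_linear christoffel_sym smooth_christoffel
    oP PU (smooth_hat vT)); [|exact: smooth_hat|exact: smooth_hat].
  by move=> x Px; exact: hat_neq0 Px.
by move=> x Px; exact: affine_connection_chart.
Qed.

Lemma affine_connection2_chart A B C x : vector_field n S Q A -> vector_field n S Q B ->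
  vector_field n S Q C -> P x ->
  affine_connection nabla T A (affine_connection nabla T B C) (phi x) =
  'D_(cov (hat T) (hat A) (cov (hat T) (hat B) (hat C)) x) phi x.
Proof.
move=> vA vB vC Px; have [Ux Qx] := Px; have [Sx Ox] := chart_in Ux.
have Px' : chart_preimage (O `&` Q) x by split.
have vBC := affine_connection_field vB vC.
rewrite /affine_connection -(hatK vT Px) -(hatK vA Px).
apply: etrans (nabla_chart (openI openO openQ) (hat A x) vBC Px' (hat_neq0 vT T_neq0 Px)) _.
have hatBC y : P y -> hat (affine_connection nabla T B C) y = cov (hat T) (hat B) (hat C) y.
  move=> Py; have [Uy Qy] := Py.
  by rewrite /field_coord affine_connection_chart // chart_coordK.
have e1 : 'D_(hat A x) (hat (affine_connection nabla T B C)) x =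
    'D_(hat A x) (cov (hat T) (hat B) (hat C)) x.
  by apply: near_eq_derive; exact: near_open hatBC.
have e2 := hatBC x Px.
exact: (congr1 (fun b => 'D_b phi x) (congr2 (fun a b => a + Gam (x, hat T x) (hat A x) b) e1 e2)).
Qed.

Hypothesis vX : vector_field n S Q X.
Hypothesis vY : vector_field n S Q Y.
Hypothesis vZ : vector_field n S Q Z.

Lemma derive_on_field A B x : vector_field n S Q A -> vector_field n S Q B -> P x ->
  derive_on S B (phi x) (A (phi x)) =
  'D_('D_(hat A x) (hat B) x) phi x + 'D_(hat A x) ('D_(hat B x) phi) x.
Proof.
move=> vA vB Px; have [Ux Qx] := Px; have [_ sB _] := vB.
rewrite -(hatK vA Px); apply: etrans (derive_on_chart (hat A x) openQ sB Ux Qx) _.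
have e : 'D_(hat A x) (B \o phi) x = 'D_(hat A x) (fun x => 'D_(hat B x) phi x) x.
  by apply: near_eq_derive; apply: (near_open oP Px) => y Py; exact/esym/(hatK vB).
apply: etrans e _.
have dB := differentiable_has_derive (hat A x) ((smooth_hat vB 1).1 x Px).
exact: (has_derive_along openU Ux (smooth_phi 2) (has_derive_id (hat A x) x) dB).2.
Qed.

Lemma lie_bracket_chart A B x : vector_field n S Q A -> vector_field n S Q B -> P x ->
  lie_bracket S A B (phi x) =
  'D_('D_(hat A x) (hat B) x - 'D_(hat B x) (hat A) x) phi x.
Proof.
have cancel (p q r s : V) : q = s -> p + q - (r + s) = p - r.
  by move=> ->; rewrite opprD addrACA subrr addr0.
move=> vA vB Px; have [Ux Qx] := Px; rewrite /lie_bracket !derive_on_field //.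
apply: etrans (cancel _ _ _ _ (derive_comm_chart (hat A x) (hat B x) Ux)) _.
exact/esym/derive_chartB.
Qed.

(** In [nabla_chart] the reference vector enters through [Gam] only, and the linear map ['d phi x]
    passes through the derivative. *)
Lemma vertical_derivative_chart (y c a : E) x : P x -> y != 0 ->
  vertical_derivative nabla (phi x) ('D_y phi x) ('D_a phi x) Z ('D_c phi x) =
  'D_('D_(0, c) (fun z => Gam z a (hat Z x)) (x, y)) phi x.
Proof.
move=> Px y0; have [Ux Qx] := Px; have Mz : M (x, y) by [].
have dphi := chart_differentiable Ux.
pose f z := 'd phi x ('D_a (hat Z) x + Gam z a (hat Z x)).
have df : has_derive f (0, c) (x, y) ('D_('D_(0, c) (fun z => Gam z a (hat Z x)) (x, y)) phi x).
  have dG := differentiable_has_derive (0, c) ((smooth_christoffel 1 a (hat Z x)).1 _ Mz).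
  apply: (has_derive_eq (has_derive_linear ('d phi x)
    (has_deriveD (has_derive_cst ('D_a (hat Z) x) (0, c) (x, y)) dG))).
  by rewrite add0r -deriveE.
rewrite /vertical_derivative derive1E.
(* [nabla_chart] requires a nonzero reference vector, and [y + t c] is known to be one for small [t]
   only. *)
have oT : open ((fun t : R => (x, y) + t *: (0, c)) @^-1` M).
  apply: open_comp (open_slit openU) => t _; apply: cvgD; first exact: cvg_cst.
  by apply: cvgZr_tmp; exact: cvg_id.
have M0 : M ((x, y) + (0 : R) *: (0, c)) by rewrite scale0r addr0.
apply: (etrans (y := 'D_1 (fun t : R => f ((x, y) + t *: (0, c))) 0)).
  apply: near_eq_derive; apply: (near_open oT M0) => t.
  rewrite /= /f -pair_line => Mt; rewrite -deriveE // derive_chart_line //.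
  by apply: (nabla_chart openQ a vZ Px); case: Mt.
have df0 : differentiable f ((x, y) + (0 : R) *: (0, c)) by rewrite scale0r addr0; exact: df.1.
rewrite (@derive_val _ _ _ _ _ _ _ (is_derive_line df0)).
by rewrite scale0r addr0; exact: df.2.
Qed.

Local Notation G2 := (rspray wind l0).

(** [rspray] solves the spray equation and the symbols obey the axioms, so [Gam_nonlinear] yields
    this part of [Gam] for any admissible connection. *)
Lemma rspray_christoffel z a : M z -> nonlinear_connection G2 a z = Gam z a z.2.
Proof.
move=> Mz; apply: esym; have oM := open_slit openU.
exact: (Gam_nonlinear oM smooth_renergy (euler_renergy smooth_wind wind_sym wind_lt1)
  christoffel_sym christoffel_metric (rhessian_nondeg openU smooth_wind wind_sym wind_lt1)
  (class_C_rspray openU smooth_wind wind_lt1)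
  (rspray_spray openU smooth_wind wind_sym wind_lt1) a Mz).
Qed.

Lemma chern_curvature_chart x : P x ->
  chern_curvature S nabla T X Y Z (phi x) =
  'D_(curvature Gam G2 (hat X x) (hat Y x) (hat Z x) (x, hat T x)) phi x.
Proof.
move=> Px; have [Ux Qx] := Px; have t0 := hat_neq0 vT T_neq0.
have tx0 := t0 x Px; have Mz : M (x, hat T x) by [].
have := curvature_covariant christoffel_linear christoffel_sym smooth_christoffel
  oP PU (smooth_hat vT) t0 rspray_christoffel Px (smooth_hat vX) (smooth_hat vY) (smooth_hat vZ).
move=> /= <-.
rewrite derive_chartD // !derive_chartB //.
rewrite /chern_curvature /affine_curvature.
congr (_ - _ - _ - _ + _).
- exact: affine_connection2_chart.
- exact: affine_connection2_chart.
- rewrite /affine_connection -{1}(hatK vT Px) lie_bracket_chart //.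
  exact: (nabla_chart openQ _ vZ Px tx0).
- rewrite affine_connection_chart // -{1}(hatK vT Px) -(hatK vY Px).
  exact: (vertical_derivative_chart _ _ Px tx0).
- rewrite affine_connection_chart // -{1}(hatK vT Px) -(hatK vX Px).
  exact: (vertical_derivative_chart _ _ Px tx0).
Qed.

Lemma flag_curvature_chart x y b : P x -> y != 0 ->
  T (phi x) = 'D_y phi x -> X (phi x) = 'D_y phi x ->
  Y (phi x) = 'D_b phi x -> Z (phi x) = 'D_b phi x ->
  flag_curvature S F nabla T X Y Z (phi x) =
  vert_derivative L (curvature Gam G2 y b b (x, y)) (x, y) /
  (L (x, y) * g b b (x, y) - vert_derivative L b (x, y) ^+ 2).
Proof.
move=> Px y0 Ty Xy Yb Zb; have [Ux Qx] := Px; have Mz : M (x, y) by [].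
have hatE A c : A (phi x) = 'D_c phi x -> hat A x = c.
  by move=> Ac; rewrite /field_coord Ac chart_coordK.
have oM := open_slit openU; have eu := euler_renergy smooth_wind wind_sym wind_lt1.
have ell c : g c y (x, y) = vert_derivative L c (x, y).
  by rewrite (g_sym oM smooth_renergy) //; exact: (g_eulerl oM smooth_renergy eu c Mz).
rewrite /flag_curvature chern_curvature_chart //.
rewrite (hatE _ _ Ty) (hatE _ _ Xy) (hatE _ _ Yb) (hatE _ _ Zb) Ty Yb.
rewrite !fund_tensor_chart // !ell finsler_chart // expr2.
Qed.

End CurvatureChart.

Lemma flag_curvature_eq x y : U x -> y != 0 -> exists kappa, forall b,
  (forall k, b <> k *: y) -> forall (Q : set V) T X Y Z,
  Q (phi x) -> vector_field n S Q T -> (forall q, S q -> Q q -> T q != 0) ->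
  vector_field n S Q X -> vector_field n S Q Y -> vector_field n S Q Z ->
  T (phi x) = 'D_y phi x -> X (phi x) = 'D_y phi x ->
  Y (phi x) = 'D_b phi x -> Z (phi x) = 'D_b phi x ->
  flag_curvature S F nabla T X Y Z (phi x) = kappa.
Proof.
move=> Ux y0; have Mz : M (x, y) by [].
have [kappa kE] := rflag_curvature openU smooth_wind wind_sym wind_rank1 wind_lt1
  christoffel_sym (fun z X Y Mz => (smooth_christoffel 1 X Y).1 z Mz) christoffel_metric Mz.
exists kappa => b /kE <- Q T X Y Z Qx vT T0 vX vY vZ.
exact: (flag_curvature_chart (let: And3 oQ _ _ := vT in oQ) vT T0 vX vY vZ (conj Ux Qx) y0).
Qed.

End Charts.

(** * Zermelo data of a flat hypersurface *)

Section FlatHypersurfaces.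
Context {R : realType} {V : finNormedModType R} {n : nat}.
Variables (h : {dot V for idfun}) (W : V) (F : V -> R) (S : set V).
Hypothesis randersF : randers_minkowski h W F.
Hypothesis hypersurfaceS : hypersurface n S.
Hypothesis flatS : flat n S (fun _ u w => h u w).
Local Notation TS := (tangent_space n S).

Lemma flat_scalar_flag_curvature : scalar_flag_curvature n S F.
Proof.
move=> nabla chern.
(* It is enough to find one admissible value for each flagpole; [xget] then assembles them into a
   function. *)
pose K p v := [set k : R | forall u, TS p u -> free [:: v; u] -> forall O T X Y Z,
  O p -> vector_field n S O T -> (forall q, S q -> O q -> T q != 0) ->
  vector_field n S O X -> vector_field n S O Y -> vector_field n S O Z ->
  T p = v -> X p = v -> Y p = u -> Z p = u -> flag_curvature S F nabla T X Y Z p = k].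
suff K_ex p v : slit_tangent_bundle n S (p, v) -> exists k, K p v k.
  exists (fun p v => xget 0 (K p v)) => p v u /K_ex [k Kk] Tu vu O T X Y Z.
  by have Kp : K p v (xget 0 (K p v)) := xgetPex 0 (ex_intro _ k Kk); exact: Kp.
move=> [/= Sp Tv v0]; have [dimV _] := hypersurfaceS.
have [U [phi [[[oU sphi] [Q [psi [oQ phiU phiK spsi]]]] [x Ux px] iso]]] := flatS Sp.
have {}iso y a b : U y -> hdot h ('D_a phi y) ('D_b phi y) = dotr a b.
  by move=> Uy; exact: (iso y (mem_set Uy) a b).
have TP u := tangent_spaceP oU sphi oQ phiU phiK spsi u Ux.
move: Tv v0; rewrite -px => /TP[y ->] v0.
have y0 : y != 0.
  by apply: contra_neq v0 => ->; exact: derive_chart0 sphi _ Ux.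
have [k kE] := flag_curvature_eq oU sphi oQ phiU phiK spsi dimV iso randersF chern Ux y0.
exists k => u /TP[b ->] fr Q1 T X Y Z; apply: kE => c bc; move: fr.
rewrite (@perm_free _ _ _ [:: 'D_b phi x; 'D_y phi x]); last by rewrite (perm_catC [:: _] [:: _]).
rewrite bc (derive_chartZ sphi _ _ Ux) free_cons span_seq1.
by have /vlineP -> : exists k', c *: 'D_y phi x = k' *: 'D_y phi x by exists c.
Qed.

(** * Tangent spaces and existence of Zermelo data *)

Lemma flat_chart p : S p -> exists (U : set 'rV[R]_n) phi Q psi x,
  [/\ [/\ open U, forall k, class_C k U phi, open Q & phi @` U = S `&` Q],
      {in U, cancel phi psi}, smooth_on (S `&` Q) psi,
      forall y a b, U y -> hdot h ('D_a phi y) ('D_b phi y) = dotr a b &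
      U x /\ phi x = p].
Proof.
move=> Sp.
have [U [phi [[[oU sphi] [Q [psi [oQ phiU phiK spsi]]]] [x Ux px] iso]]] := flatS Sp.
by exists U, phi, Q, psi, x; split=> // y a b Uy; exact: (iso y (mem_set Uy) a b).
Qed.

Lemma tangent_spaceD p c u v : S p -> TS p u -> TS p v -> TS p (c *: u + v).
Proof.
move=> Sp; have [U [phi [Q [psi [x [[oU sphi oQ phiU] phiK spsi _ [Ux <-]]]]]]] := flat_chart Sp.
have TP := tangent_spaceP oU sphi oQ phiU phiK spsi _ Ux.
move=> /TP[a ->] /TP[b ->]; apply/TP; exists (c *: a + b).
by rewrite (derive_chartD sphi _ _ Ux) (derive_chartZ sphi _ _ Ux).
Qed.

Lemma tangent_spaceZ p c u : S p -> TS p u -> TS p (c *: u).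
Proof.
move=> Sp Tu; have T0 : TS p 0.
  by have := tangent_spaceD (-1) Sp Tu Tu; rewrite scaleN1r addNr.
by rewrite -[_ *: _]addr0; exact: tangent_spaceD.
Qed.

Lemma tangent_spaceB p u v : S p -> TS p u -> TS p v -> TS p (u - v).
Proof. by move=> Sp Tu Tv; rewrite addrC -scaleN1r; exact: tangent_spaceD. Qed.

(** Chosen without reference to charts, so as to be one field on all of [S]; charts provide
    existence, uniqueness and smoothness. *)
Definition tangential_part p : V :=
  xget 0 [set a | TS p a /\ forall u, TS p u -> hdot h (W - a) u = 0].
Local Notation A := tangential_part.

Section Chart.
Variables (U : set 'rV[R]_n) (phi : 'rV[R]_n -> V) (Q : set V) (psi : V -> 'rV[R]_n).
Hypothesis openU : open U.
Hypothesis smooth_phi : forall k, class_C k U phi.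
Hypothesis openQ : open Q.
Hypothesis phiU : phi @` U = S `&` Q.
Hypothesis phiK : {in U, cancel phi psi}.
Hypothesis smooth_psi : smooth_on (S `&` Q) psi.
Hypothesis isometric_phi : forall y a b, U y ->
  hdot h ('D_a phi y) ('D_b phi y) = dotr a b.

Lemma tangential_part_chart x : U x -> A (phi x) = 'D_(wind phi h W x) phi x.
Proof.
move=> Ux; have TP u := tangent_spaceP openU smooth_phi openQ phiU phiK smooth_psi u Ux.
apply: xget_unique.
  split; first by apply/TP; exists (wind phi h W x).
  move=> u /TP[b ->].
  by rewrite hdotDl hdotNl isometric_phi // -(dotr_chart_coord smooth_phi) // subrr.
move=> _ [/TP[a ->] orth]; congr ('D_ _ phi x); apply: dotr_inj => b.
have /orth := (TP ('D_b phi x)).2 (ex_intro _ b erefl).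
rewrite hdotDl hdotNl isometric_phi // -(dotr_chart_coord smooth_phi) // => /eqP.
by rewrite subr_eq0 => /eqP.
Qed.

End Chart.

Lemma tangential_partP p : S p -> TS p (A p) /\ forall u, TS p u -> hdot h (W - A p) u = 0.
Proof.
move=> Sp; have [U [phi [Q [psi [x [[oU sphi oQ phiU] phiK spsi iso [Ux <-]]]]]]] := flat_chart Sp.
have TP u := tangent_spaceP oU sphi oQ phiU phiK spsi u Ux.
rewrite (tangential_part_chart oU sphi oQ phiU phiK spsi iso Ux).
split=> [|u]; first by apply/TP; exists (wind phi h W x).
move=> /TP[b ->].
by rewrite hdotDl hdotNl iso // -(dotr_chart_coord sphi) // subrr.
Qed.

(** The squared [h]-radius of the indicatrix in the tangent space, a sphere around [A p]. *)
Definition zermelo_factor p : R := 1 - hdot h (W - A p) (W - A p).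
Local Notation mu := zermelo_factor.

Lemma hdot_tangential_part p : S p ->
  hdot h W W = hdot h (W - A p) (W - A p) + hdot h (A p) (A p).
Proof.
move=> Sp; have [TA orth] := tangential_partP Sp.
have := orth _ TA; rewrite -{2 3}(subrK (A p) W); move: (W - A p) => d dA.
by rewrite hdotDl !hdotDr (hdotC h (A p)) dA addr0 add0r.
Qed.

Lemma zermelo_factor_gt0 p : S p -> 0 < mu p.
Proof.
move=> Sp; have [W1 _ _] := randersF; rewrite subr_gt0; apply: le_lt_trans W1.
by rewrite -/(hdot h W W) (hdot_tangential_part Sp) lerDl hdot_ge0.
Qed.

Definition zermelo_metric p u v : R := hdot h u v / mu p.
Local Notation m := zermelo_metric.

Lemma smooth_on_local (G : normedModType R) (f : V -> G) (B : set V) :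
  (forall a, B a -> exists Q, [/\ open Q, Q a & smooth_on (B `&` Q) f]) -> smooth_on B f.
Proof.
move=> loc a Ba; have [Q [oQ Qa sf]] := loc a Ba.
have [//|Q1 [f' [Q1a [oQ1 cf'] ff']]] := sf a.
exists (Q1 `&` Q), f'; split=> //.
  split; first exact: openI.
  by move=> k; apply: class_C_sub (cf' k) => z [].
by move=> z /set_mem [Bz [Q1z Qz]]; apply: ff'; rewrite inE.
Qed.

Lemma tangential_part_field : vector_field n S setT A.
Proof.
split; [exact: openT| |by move=> p Sp _; have [] := tangential_partP Sp].
rewrite setIT; apply: smooth_on_local => p Sp.
have [U [phi [Q [psi [x [[oU sphi oQ phiU] phiK spsi iso [Ux <-]]]]]]] := flat_chart Sp.
exists Q; split=> //; first by have : (S `&` Q) (phi x) by [rewrite -phiU; exists x]; case.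
apply: (smooth_pushforwardO oU sphi oQ phiU phiK spsi) => k.
apply: (class_C_eq oU (g := fun x => 'D_(wind phi h W x) phi x)).
  by move=> y Uy; exact: (tangential_part_chart oU sphi oQ phiU phiK spsi iso Uy).
exact: (class_C_along oU (fun _ => id) (sphi k.+1) (@class_C_id _ _ k U)
  (smooth_wind oU sphi h W k)).
Qed.

Lemma zermelo_metric_riemannian : riemannian_metric n S m.
Proof.
split=> [p Sp|Q X Y vX vY].
  have mu0 := zermelo_factor_gt0 Sp; split.
  - by move=> u v w _ _ _ c; rewrite /m hdotDl hdotZl mulrDl mulrA.
  - by move=> u v _ _; rewrite /m hdotC.
  - by move=> u _ u0; rewrite divr_gt0 // hdot_gt0.
apply: smooth_on_local => p [Sp Qp].
have [U [phi [Q' [psi [x [[oU sphi oQ' phiU] phiK spsi iso [Ux xp]]]]]]] := flat_chart Sp.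
have [oQ sX _] := vX; have [_ sY _] := vY; have [_ sA _] := tangential_part_field.
have oP := open_chart_preimage oU sphi oQ.
have inS y : U y -> S (phi y) by move=> Uy; have : (S `&` Q') (phi y) by [rewrite -phiU; exists y]; case.
exists Q'; split=> //.
  by rewrite -xp; have : (S `&` Q') (phi x) by [rewrite -phiU; exists x]; case.
rewrite -setIA [Q `&` _]setIC.
apply: (smooth_pushforward oU sphi phiU phiK spsi oQ) => k.
have bc := @bilinear_fd_continuous R _ _ _ (hdot h).
have cX := smooth_pullback oU sphi phiU k oQ sX.
have cY := smooth_pullback oU sphi phiU k oQ sY.
apply: class_CM => //; first exact: (class_C_bilinear bc oP cX cY).
apply: class_CV => // [y [Uy _]|].
  by rewrite gt_eqF //; apply: zermelo_factor_gt0; exact: inS.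
have cA : class_C k (chart_preimage U phi Q) (fun y => W - A (phi y)).
  apply: class_CD => //; first exact: class_C_cst.
  have -> : (fun y => - A (phi y)) = fun y => (-1) *: A (phi y).
    by apply/funext => y; rewrite scaleN1r.
  apply: class_CZ => //; first exact: class_C_cst.
  by apply: class_C_sub (smooth_pullback oU sphi phiU k openT sA) => y [].
apply: (class_C_eq oP (g := fun y => 1 + (-1) * hdot h (W - A (phi y)) (W - A (phi y)))).
  by move=> y _; rewrite mulN1r.
apply: class_CD => //; first exact: class_C_cst.
apply: class_CM => //; first exact: class_C_cst.
exact: (class_C_bilinear bc oP cA cA).
Qed.

Lemma zermelo_metric_data : zermelo_data n S F m A.
Proof.
split; [exact: zermelo_metric_riemannian|exact: tangential_part_field| |].
  move=> p Sp; have mu0 := zermelo_factor_gt0 Sp.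
  rewrite ltr_pdivrMr // mul1r ltrBrDr addrC -(hdot_tangential_part Sp).
  by have [] := randersF.
move=> p v [/= Sp Tv v0]; have [TA orth] := tangential_partP Sp.
have [_ _ /(_ v v0)[f0]] := randersF; set q := (F v)^-1 *: v.
have Tq : TS p (q - A p) by apply: tangent_spaceB => //; exact: tangent_spaceZ.
have pythagoras a b : hdot h b a = 0 -> hdot h (a - b) (a - b) = hdot h a a + hdot h b b.
  move=> ba; rewrite hdotDl !hdotDr !hdotNl !hdotNr (hdotC h a b) ba.
  by rewrite oppr0 opprK addr0 add0r.
(* Pythagoras with [q - A p] tangent and [W - A p] normal separates the constant normal contribution
   from Zermelo's equation. *)
have -> : q - W = (q - A p) - (W - A p) by rewrite opprB addrA subrK.
move=> e; have {}e := etrans (esym (pythagoras _ _ (orth _ Tq))) e.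
have mu0 := zermelo_factor_gt0 Sp.
have eq_mu : hdot h (q - A p) (q - A p) = mu p by rewrite /mu -e addrK.
rewrite -[LHS]/(hdot h (q - A p) (q - A p) / mu p) eq_mu.
by rewrite divff // gt_eqF.
Qed.

(* Here [a = m v v], [b = m v A], [c = m A A], [f = F v] and [f' = F (- v)] for
   Zermelo data [(m, A)], or the same with [(h, W)]. *)
Lemma zermelo_arith (a b c f f' : R) : 0 < f -> 0 < f' ->
  f^-1 * (f^-1 * a) - 2 * (f^-1 * b) + c = 1 ->
  f'^-1 * (f'^-1 * a) + 2 * (f'^-1 * b) + c = 1 -> a = (1 - c) * (f * f').
Proof.
move=> f0 f0' e e'; have fn : f != 0 by rewrite gt_eqF.
have fn' : f' != 0 by rewrite gt_eqF.
have e1 : a - 2 * f * b = (1 - c) * f ^+ 2.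
  have <- : f^-1 * (f^-1 * a) - 2 * (f^-1 * b) = 1 - c.
    by move/(congr1 (fun t => t - c)): e; rewrite addrK.
  by field.
have e2 : a + 2 * f' * b = (1 - c) * f' ^+ 2.
  have <- : f'^-1 * (f'^-1 * a) + 2 * (f'^-1 * b) = 1 - c.
    by move/(congr1 (fun t => t - c)): e'; rewrite addrK.
  by field.
have s : f + f' != 0 by rewrite gt_eqF // addr_gt0.
apply: (mulIf s); transitivity (f' * (a - 2 * f * b) + f * (a + 2 * f' * b)); first ring.
by rewrite e1 e2; ring.
Qed.

(** [zermelo_arith] is applied to both pairs, which share the product [F a * F (- a)]. As [m'] is
    bilinear on tangent vectors only, each algebraic rule carries tangency conditions. *)
Lemma zermelo_metric_conformal (m' : V -> V -> V -> R) (A' : V -> V) p u v :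
  zermelo_data n S F m' A' -> S p -> TS p u -> TS p v ->
  m' p u v = (1 - m' p (A' p) (A' p)) / (1 - hdot h W W) * hdot h u v.
Proof.
move=> [[rm' _] [_ _ TA'] _ ind] Sp Tu Tv; have [lin sym pos] := rm' p Sp.
have {}TA' := TA' p Sp I; set c := _ / _.
have l0 : 1 - hdot h W W != 0 by rewrite gt_eqF //; exact: wind_lt1 randersF.
have mD a b d : TS p a -> TS p b -> TS p d -> m' p (a + b) d = m' p a d + m' p b d.
  by move=> Ta Tb Td; have := lin a b d (mem_set Ta) (mem_set Tb) (mem_set Td) 1; rewrite scale1r mul1r.
have T0 : TS p 0 by rewrite -(scale0r u); exact: tangent_spaceZ.
have m0 d : TS p d -> m' p 0 d = 0.
  by move=> Td; apply: (@addrI _ (m' p 0 d)); rewrite -mD // !addr0.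
have mZ k a d : TS p a -> TS p d -> m' p (k *: a) d = k * m' p a d.
  by move=> Ta Td; have := lin a 0 d (mem_set Ta) (mem_set T0) (mem_set Td) k; rewrite m0 // !addr0.
have mC a b : TS p a -> TS p b -> m' p a b = m' p b a.
  by move=> Ta Tb; exact: sym (mem_set Ta) (mem_set Tb).
have TN a : TS p a -> TS p (- a) by move=> Ta; rewrite -scaleN1r; exact: tangent_spaceZ.
have mN a d : TS p a -> TS p d -> m' p (- a) d = - m' p a d.
  by move=> Ta Td; rewrite -scaleN1r mZ // mulN1r.
have diag a : TS p a -> m' p a a = c * hdot h a a.
  move=> Ta; have [->|a0] := eqVneq a 0; first by rewrite m0 // hdot0r mulr0.
  have [_ _ rF] := randersF.
  have na0 : - a != 0 by rewrite oppr_eq0.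
  have [f0 e1] := rF a a0; have [f0' e2] := rF (- a) na0.
  have e3 := ind p a (And3 Sp Ta a0).
  have e4 := ind p (- a) (And3 Sp (TN a Ta) na0).
  have hsq k b : hdot h (k *: b - W) (k *: b - W) =
      k * (k * hdot h b b) - 2 * (k * hdot h b W) + hdot h W W.
    rewrite hdotDl !hdotDr !hdotNl !hdotNr !hdotZl !hdotZr (hdotC h W b).
    by move: (hdot h b b) (hdot h b W) (hdot h W W) => *; ring.
  have msq k b : TS p b -> m' p (k *: b - A' p) (k *: b - A' p) =
      k * (k * m' p b b) - 2 * (k * m' p b (A' p)) + m' p (A' p) (A' p).
    move=> Tb; have Tkb : TS p (k *: b) by exact: tangent_spaceZ.
    have TNA := TN _ TA'.
    have Tq : TS p (k *: b - A' p) by exact: tangent_spaceB.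
    rewrite mD // mN // mZ // !(mC _ (k *: b - A' p)) // !mD // !mN // !mZ //.
    rewrite (mC (A' p) b) //.
    by move: (m' p b b) (m' p b (A' p)) (m' p (A' p) (A' p)) => *; ring.
  have hNN : hdot h (- a) (- a) = hdot h a a by rewrite hdotNl hdotNr opprK.
  have mNN : m' p (- a) (- a) = m' p a a.
    by rewrite mN ?(mC a) ?mN ?opprK //; exact: TN.
  have oppM (r s t x : R) : r - 2 * (s * - t) + x = r + 2 * (s * t) + x.
    by rewrite !mulrN opprK.
  move: (etrans (esym (hsq _ _)) e2); rewrite hNN hdotNl oppM => e2'.
  move: (etrans (esym (msq _ _ (TN a Ta))) e4); rewrite mNN mN // oppM => e4'.
  rewrite (zermelo_arith f0 f0' (etrans (esym (hsq _ _)) e1) e2').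
  rewrite (zermelo_arith f0 f0' (etrans (esym (msq _ _ Ta)) e3) e4').
  by rewrite [RHS]mulrA divfK.
(* Polarization passes from the quadratic forms compared in [diag] to the bilinear ones. *)
have mS : m' p (u + v) (u + v) = m' p u u + 2 * m' p u v + m' p v v.
  have Tuv : TS p (u + v) by rewrite -[u]scale1r; exact: tangent_spaceD.
  rewrite mD // ![m' p _ (u + v)]mC // !mD // (mC v u) //.
  by move: (m' p u u) (m' p u v) (m' p v v) => *; ring.
have Tuv : TS p (u + v) by rewrite -[u]scale1r; exact: tangent_spaceD.
have := mS; rewrite !diag // hdotDl !hdotDr (hdotC h v u).
by move: (m' p u v) (hdot h u u) (hdot h u v) (hdot h v v) => *; lra.
Qed.

(** The isometric chart itself is conformal. The factor is positive since [A'] has [m']-norm below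
    one, and smooth by the smoothness clause of [riemannian_metric] for the pair [A'], [A']. *)
Lemma zermelo_metric_conformally_flat m' A' :
  zermelo_data n S F m' A' -> conformally_flat n S m'.
Proof.
move=> zd p Sp; have [[_ sm'] vA' lt1 _] := zd.
have [U [phi [Q [psi [x [[oU sphi oQ phiU] phiK spsi iso [Ux xp]]]]]]] := flat_chart Sp.
have inS y : U y -> S (phi y).
  by move=> Uy; have : (S `&` Q) (phi y) by [rewrite -phiU; exists y]; case.
have l0 := wind_lt1 randersF.
exists U, phi, (fun y => (1 - m' (phi y) (A' (phi y)) (A' (phi y))) / (1 - hdot h W W)).
split.
- exact: chart_param oU sphi oQ phiU phiK spsi.
- by exists x.
- split=> // k; apply: class_CM => //; last exact: class_C_cst.
  apply: (class_C_eq oU (g := fun y => 1 + (-1) * m' (phi y) (A' (phi y)) (A' (phi y)))).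
    by move=> y _; rewrite mulN1r.
  apply: class_CD => //; first exact: class_C_cst.
  apply: class_CM => //; first exact: class_C_cst.
  have := smooth_pullback oU sphi phiU k openT (sm' _ _ _ vA' vA').
  by apply: class_C_sub => y Uy; split.
- by move=> y /set_mem Uy; rewrite divr_gt0 // subr_gt0; apply: lt1; exact: inS.
- move=> y /set_mem Uy a b.
  have TP u := tangent_spaceP oU sphi oQ phiU phiK spsi u Uy.
  rewrite (zermelo_metric_conformal zd (inS y Uy)); last 2 first.
  + by apply/TP; exists a.
  + by apply/TP; exists b.
  by rewrite iso.
Qed.

End FlatHypersurfaces.

Theorem corollary19 (R : realType) (V : finNormedModType R)
    (h : ({dot V for idfun})%R) (W : V) (F : V -> R)
    (hF : randers_minkowski h W F)
    (n : nat) (S : set V) (hS : hypersurface n S)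
    (hflat : flat n S (fun _ u w => h u w)) :
  scalar_flag_curvature n S F /\
  (exists m A, zermelo_data n S F m A) /\
  (forall m A, zermelo_data n S F m A -> conformally_flat n S m).
Proof.
split; first exact: flat_scalar_flag_curvature hF hS hflat.
split=> [|m A zd]; last exact: zermelo_metric_conformally_flat hF hflat _ _ zd.
by eexists; eexists; exact: zermelo_metric_data hF hflat.
Qed.
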